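(* Let $0<\sigma<2$ and let $\mathcal{O}\subseteq\mathbb{T}^n$ be an open set. Fix a compact subset $K\subset\mathcal{O}$. There exists a positive constant $C$ depending only on $n$, $\sigma$ and $K$ such that $$\sup_Kf\leq C\inf_Kf$$ for all functions $f\in\operatorname{Dom}(-\Delta)$ satisfying $(-\Delta)^{\sigma/2}f=0$ in $L^2(\mathcal{O})$ and $f\ge0$ on $\mathbb{T}^n$. As a consequence, any such $f$ is a Hölder continuous function in $K$.
   Context: $\mathbb{T}^n$, $n\ge1$, is the $n$-dimensional torus $\mathbb{R}^n/2\pi\mathbb{Z}^n$, identified with the cube $Q_n=(-\pi,\pi]^n$. For integrable $f$ on $\mathbb{T}^n$, $c_\nu(f)=\frac1{(2\pi)^n}\int_{\mathbb{T}^n}f(x)e^{-i\nu\cdot x}\,dx$, $\nu\in\mathbb{Z}^n$. $\operatorname{Dom}(-\Delta)=\{f\in L^2(\mathbb{T}^n):\sum_{\nu}|\nu|^4|c_\nu(f)|^2<\infty\}$ (real-valued functions), and the fractional Laplacian is $(-\Delta)^{\sigma/2}f=\sum_{\nu\in\mathbb{Z}^n}|\nu|^\sigma c_\nu(f)e^{i\nu\cdot x}$, with convergence in $L^2(\mathbb{T}^n)$. ''$(-\Delta)^{\sigma/2}f=0$ in $L^2(\mathcal{O})$'' means that the $L^2$ function $(-\Delta)^{\sigma/2}f$ vanishes a.e. on $\mathcal{O}$. Functions are identified when they agree a.e.; the pointwise assertions on $K$ refer to the continuous representative of $f$ on $\mathcal{O}$.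
   Formalization: The constant C may depend on the open set O as well as on n, σ and K; independence of O fails, e.g. for K two points and O the union of two shrinking balls around them. *)

(* Defs.v *)
From HB Require Import structures.
From mathcomp Require Import all_boot all_order all_algebra.
From mathcomp Require Import finmap generic_quotient ring_quotient.
From mathcomp Require Import all_classical all_reals all_analysis.
From mathcomp Require Import complex lra.
From mathcomp.analysis.showcase Require summability.

Set Implicit Arguments.
Unset Strict Implicit.
Unset Printing Implicit Defensive.

Import Order.TTheory GRing.Theory Num.Theory.
Import numFieldNormedType.Exports.

Local Open Scope classical_set_scope.
Local Open Scope ring_scope.
Local Open Scope complex_scope.
Local Open Scope quotient_scope.

Definition tuple_cons (T : Type) (n : nat) (p : T * n.-tuple T) : n.+1.-tuple T :=
  [tuple of p.1 :: p.2].

Lemma measurable_tuple_cons d (T : measurableType d) (n : nat) :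
  measurable_fun [set: T * n.-tuple T] (@tuple_cons T n).
Proof. by apply: measurable_cons; [exact: measurable_fst|exact: measurable_snd]. Qed.

Lemma measurable_tuple_box d (T : measurableType d) (n : nat) (A : 'I_n -> set T) :
  (forall i, measurable (A i)) ->
  measurable [set t : n.-tuple T | forall i, A i (tnth t i)].
Proof.
move=> mA.
rewrite (_ : [set t | _] = \bigcap_(i in [set: 'I_n]) ((@tnth n T)^~ i @^-1` A i)).
  apply: fin_bigcap_measurable => // i _.
  by rewrite -[X in measurable X]setTI; exact: (measurable_tnth i).
apply/seteqP; split=> t tA i; first by move=> _; exact: tA.
exact: (tA i I).
Qed.

Section lebesgue_tuple_step.
Context (R : realType) (n : nat).
Local Notation RT := (measurableTypeR R).
Variable mu : {sigma_finite_measure set (n.-tuple RT) -> \bar R}.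

Definition lebesgue_tuple_step : set (n.+1.-tuple RT) -> \bar R :=
  pushforward (@lebesgue_measure R \x mu)%E (@tuple_cons RT n).

Let nu : {measure set (n.+1.-tuple RT) -> \bar R} :=
  measure_function_pushforward__canonical__measure_function_Measure
  (@lebesgue_measure R \x mu)%E (@measurable_tuple_cons _ RT n).

HB.instance Definition _ := isMeasure.Build _ _ _ lebesgue_tuple_step
  (@measure0 _ _ _ nu) (@measure_ge0 _ _ _ nu)
  (@measure_semi_sigma_additive _ _ _ nu).

Lemma lebesgue_tuple_step_sigma_finite : sigma_finite setT lebesgue_tuple_step.
Proof.
have /sigma_finiteP[F [FT ndF Foo]] := sigma_finiteT (@lebesgue_measure R).
have /sigma_finiteP[G [GT ndG Goo]] := sigma_finiteT mu.
pose h (t : n.+1.-tuple RT) : RT * n.-tuple RT := (thead t, [tuple of behead t]).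
have hK : cancel (@tuple_cons RT n) h.
  by move=> [x t]; rewrite /h /tuple_cons theadE; congr pair; exact: val_inj.
have mh : measurable_fun [set: _] h.
  apply/measurable_fun_pairP.
  by split; [exact: measurable_tnth|exact: measurable_behead].
exists (fun k => h @^-1` (F k `*` G k)).
  apply/esym; rewrite -subTset => t _.
  have [i _ Fi] : (\bigcup_i F i) (h t).1 by rewrite -FT.
  have [j _ Gj] : (\bigcup_i G i) (h t).2 by rewrite -GT.
  exists (maxn i j) => //; split.
    by have /subsetPset := ndF _ _ (leq_maxl i j); apply.
  by have /subsetPset := ndG _ _ (leq_maxr i j); apply.
move=> k; have [mF Fk] := Foo k; have [mG Gk] := Goo k; split.
  by rewrite -[X in measurable X]setTI; apply: mh => //; exact: measurableX.
rewrite /lebesgue_tuple_step /pushforward -comp_preimage.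
rewrite (_ : h \o _ = id); last by apply/funext => p; exact: hK.
rewrite (_ : id @^-1` _ = F k `*` G k)// product_measure1E//.
by rewrite lte_mul_pinfty// ge0_fin_numE.
Qed.

HB.instance Definition _ := @Measure_isSigmaFinite.Build _ _ _ lebesgue_tuple_step
  lebesgue_tuple_step_sigma_finite.

End lebesgue_tuple_step.

(* n-dimensional Lebesgue measure, carried by n.-tuple because 'rV[R]_n has no
   measurable structure in the library. *)
Fixpoint lebesgue_tuple (R : realType) (n : nat) :
    {sigma_finite_measure set (n.-tuple (measurableTypeR R)) -> \bar R} :=
  if n is m.+1 then @lebesgue_tuple_step R m (lebesgue_tuple R m)
  else \d_([tuple] : 0.-tuple (measurableTypeR R)).

Section torus.
Context (R : realType) (n : nat).

Definition torus_lattice : {pred 'rV[R]_n} :=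
  fun x => `[< exists k : 'rV[int]_n, x = \row_i (2 * pi * (k 0 i)%:~R) >].

Lemma torus_lattice_zmod_closed : zmod_closed torus_lattice.
Proof.
split=> [|_ _ /asboolP[k ->] /asboolP[l ->]]; apply/asboolP.
  by exists 0; apply/rowP => i; rewrite !mxE mulr0.
by exists (k - l); apply/rowP => i; rewrite !mxE rmorphB/= mulrBr.
Qed.

HB.instance Definition _ :=
  GRing.isZmodClosed.Build _ torus_lattice torus_lattice_zmod_closed.

Definition torus : Type := quotient_topology (Quotient.quot torus_lattice).

HB.instance Definition _ := Pointed.on torus.
HB.instance Definition _ := Topological.on torus.
HB.instance Definition _ := Quotient.on torus.

Definition torus_of_tuple (t : n.-tuple (measurableTypeR R)) : torus :=
  \pi_torus (\row_i tnth t i).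

HB.instance Definition _ := @isMeasurable.Build (sigma_display (@open torus))
  torus <<s @open torus >>
  (@sigma_algebra0 _ setT open) (@sigma_algebraC _ open)
  (@sigma_algebra_bigcup _ setT open).

Lemma measurable_torus_of_tuple : measurable_fun [set: _] torus_of_tuple.
Proof.
apply: measurability => // _ [U oU <-]; rewrite setTI.
have {}oU : open (\pi_torus @^-1` U : set 'rV[R]_n) by [].
set V := \pi_torus @^-1` U in oU.
pose box (ab : 'rV[rat]_n * 'rV[rat]_n) : set (n.-tuple (measurableTypeR R)) :=
  [set t | forall i, `]ratr (ab.1 0 i), ratr (ab.2 0 i)[%classic (tnth t i)].
rewrite (_ : _ @^-1` U = \bigcup_ab
    if `[< forall t, box ab t -> V (\row_i tnth t i) >] then box ab else set0).
  apply: (@countable_bigcupT_measurable _ _ _ (fun ab => _)) => [|ab].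
    exact: countableP.
  case: ifP => // _; apply: (@measurable_tuple_box _ (measurableTypeR R) n
    (fun i => `]ratr (ab.1 0 i), ratr (ab.2 0 i)[%classic)) => i.
  exact: measurable_itv.
apply/seteqP; split=> [t Vt|t [ab _]]; last by case: asboolP => // abV /abV.
have /nbhs_ballP[e/= e0 eV] : nbhs (\row_i tnth t i) V.
  exact: open_nbhs_nbhs.
have aP i : {a : rat | tnth t i - e < ratr a < tnth t i}.
  apply: cid; have /rat_in_itvoo[q] : tnth t i - e < tnth t i by rewrite gtrBl.
  by rewrite in_itv; exists q.
have bP i : {b : rat | tnth t i < ratr b < tnth t i + e}.
  apply: cid; have /rat_in_itvoo[q] : tnth t i < tnth t i + e by rewrite ltrDl.
  by rewrite in_itv; exists q.
exists (\row_i sval (aP i), \row_i sval (bP i)) => //.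
rewrite asboolT => [i|s st].
  rewrite /= in_itv/= !mxE.
  by case: (aP i) => a /= /andP[_ ->]; case: (bP i) => b /= /andP[->].
apply: eV; split=> // j i; rewrite !mxE /ball/=.
have := st i; rewrite /= in_itv/= !mxE.
case: (aP i) => a /= /andP[ta _]; case: (bP i) => b /= /andP[_ tb] /andP[sa sb].
by rewrite ltr_norml; lra.
Qed.

Definition torus_cube : set (n.-tuple (measurableTypeR R)) :=
  [set t | forall i, - pi < tnth t i <= pi].

Lemma measurable_torus_cube : measurable torus_cube.
Proof.
rewrite (_ : torus_cube = [set t | forall i, `]-pi, pi]%classic (tnth t i)]).
  apply: (@measurable_tuple_box _ (measurableTypeR R) n
    (fun=> `]- pi, pi]%classic)) => i.
  exact: measurable_itv.
by apply/seteqP; split=> t tQ i; have := tQ i; rewrite /= in_itv.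
Qed.

(* Lebesgue measure on the torus (of total mass (2 * pi) ^+ n), transported
   from the cube. *)
Definition torus_measure : set torus -> \bar R :=
  fun A => lebesgue_tuple R n (torus_of_tuple @^-1` A `&` torus_cube).

Let nu : {measure set torus -> \bar R} :=
  measure_function_pushforward__canonical__measure_function_Measure
  (mrestr (lebesgue_tuple R n) measurable_torus_cube)
  measurable_torus_of_tuple.

HB.instance Definition _ := isMeasure.Build _ _ _ torus_measure
  (@measure0 _ _ _ nu) (@measure_ge0 _ _ _ nu)
  (@measure_semi_sigma_additive _ _ _ nu).

End torus.

Section fractional_laplacian.
Context (R : realType) (n : nat).
Local Notation T := (torus R n).
Local Notation mu := (torus_measure (R := R) (n := n)).

Definition enorm (v : 'rV[R]_n) : R := Num.sqrt (\sum_i v 0 i ^+ 2).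

Definition torus_dist (x y : T) : R :=
  inf [set r | exists u v : 'rV[R]_n,
    [/\ \pi_T u = x, \pi_T v = y & r = enorm (u - v)]].

Definition freq_norm (nu : 'rV[int]_n) : R := enorm (map_mx intr nu).

Definition freq_dot (nu : 'rV[int]_n) (x : 'rV[R]_n) : R :=
  \sum_i (nu 0 i)%:~R * x 0 i.

(* The character exp(i nu.x); it does not depend on the representative of x
   in R^n. *)
Definition torus_char (nu : 'rV[int]_n) (x : T) : R[i] :=
  cos (freq_dot nu (repr x)) +i* sin (freq_dot nu (repr x)).

Definition torus_integralC (h : T -> R[i]) : R[i] :=
  (\int[mu]_x complex.Re (h x)) +i* (\int[mu]_x complex.Im (h x)).

Definition fourier_coef (f : T -> R) (nu : 'rV[int]_n) : R[i] :=
  ((2 * pi) ^- n)%:C * torus_integralC (fun x => (f x)%:C * (torus_char nu x)^*).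

Definition Dom_Laplacian (f : T -> R) : Prop :=
  f \in Lfun mu 2%:E /\
  (\esum_(nu in [set: 'rV[int]_n])
     (freq_norm nu ^+ 4 * Normc.normc (fourier_coef f nu) ^+ 2)%:E < +oo)%E.

Definition frac_Laplacian_sum (sigma : R) (f : T -> R)
    (F : {fset 'rV[int]_n}) (x : T) : R[i] :=
  \sum_(nu <- F) (freq_norm nu `^ sigma)%:C * fourier_coef f nu * torus_char nu x.

(* g is (a representative of) (-Delta)^(sigma/2) f: the L^2 function which is
   the unconditional L^2 sum of the Fourier series; for real f it is real. *)
Definition is_frac_Laplacian (sigma : R) (f g : T -> R) : Prop :=
  g \in Lfun mu 2%:E /\
  Lnorm mu 2%:E
    (fun x => (Normc.normc (frac_Laplacian_sum sigma f F x - (g x)%:C))%:E)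
    @[F --> summability.totally] --> 0%E.

Definition hoelder_on (K : set T) (g : T -> R) : Prop :=
  exists a L : R, 0 < a < 1 /\
    forall x y, K x -> K y -> `|g x - g y| <= L * torus_dist x y `^ a.

End fractional_laplacian.

(* Main.v *)
(* Write s = sigma / 2 and h = (-Delta)^s f.  Characters are replaced by the real
   waves cos (k.x + t), and every function is handled through its Fourier
   coefficients.

   Upper bound and regularity.  Let psi be a bump supported in O.  As h vanishes
   on O, all the products h D^alpha psi vanish.  In the Fourier coefficients of
   these products expand
     |nu + k|^sigma = |nu|^sigma (1 - y)^s,  y = - (|k|^2 + 2 k.nu) / |nu|^2,
   in powers of y: each y gains a factor 1 / |nu|, so the decay of the
   coefficients of psi f improves by one power of |nu| at a time, starting from
   the trivial bound by the integral of f.  Hence psi f has a Lipschitz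
   representative controlled by the integral of f.

   Lower bound.  Let Psi be a sum of bumps which is positive on K and u a
   mollification of f.  If u - kappa (int f) Psi had a negative minimum, then
   (-Delta)^s of this difference would be bounded above there by a negative
   multiple of int f: (-Delta)^s is a limit of multiples of (1 - r X)^s, X being
   the average over neighbouring points of a grid, and all the coefficients of
   (1 - y)^s but the first are negative.  But (-Delta)^s u = 0 at that point and
   kappa (-Delta)^s Psi is small. *)
From HB Require Import structures.
Require Import Defs.
From mathcomp Require Import all_boot all_order all_algebra.
From mathcomp Require Import finmap generic_quotient.
From mathcomp Require Import all_classical all_reals all_analysis.
From mathcomp Require Import measurable_realfun.
From mathcomp Require Import complex ring lra zify.
From mathcomp.analysis.showcase Require summability.
Set Implicit Arguments.
Unset Strict Implicit.
Unset Printing Implicit Defensive.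
Import Order.TTheory GRing.Theory Num.Theory.
Import numFieldNormedType.Exports.
Local Open Scope classical_set_scope.
Local Open Scope ring_scope.

(** * Absolutely convergent sums over the frequency lattice *)

(** The operator sees [f] outside [O], where only its sign is known. Both bounds are therefore
    stated against the integral of [f] over the whole torus, and the Harnack constant is the
    quotient of the two. Smoothness is measured by the rate of uniform approximation by
    trigonometric polynomials. This is stable under products and yields Fourier decay at once; the
    bumps are products of positive parts of odd powers of cosines at dyadic frequencies, so no
    smooth cut-off is required. In the minimum principle the grid has mesh [a], and the powers [X^j]
    with [N <= j < 2 N] are kept, where [N a^2 = T] is fixed. This is a random walk run for a time
    long enough to mix, so each [X^j] returns at least a fixed part of the mean value, which is how
    the integral of [f] enters. Over this block the binomial coefficients add up to order [N^(-s)],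
    and this is exactly compensated by the normalisation [(2 n / a^2)^s]: the bound survives the
    limit of vanishing mesh. *)

Lemma ler_sum_uniq_sub (R : realDomainType) (I : eqType) (s s' : seq I)
    (F : I -> R) : uniq s -> uniq s' -> {subset s <= s'} ->
  (forall i, 0 <= F i) -> \sum_(i <- s) F i <= \sum_(i <- s') F i.
Proof.
move=> us us' ss' F0; rewrite [leRHS](bigID (mem s))/=.
have ps : perm_eq [seq i <- s' | i \in s] s.
  apply: uniq_perm; rewrite ?filter_uniq// => i; rewrite mem_filter /=.
  by have := ss' i; case: (i \in s) => //= ->.
by rewrite -[X in X + _]big_filter (perm_big _ ps)/= lerDl sumr_ge0.
Qed.

Section lattice_sums.
Context (R : realType) (n : nat).
Local Notation Z := 'rV[int]_n.

Definition l1deg (k : Z) : nat := \sum_(i < n) absz (k 0%R i).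

(** A bracket that is at least 1 even at [k = 0], so that its negative powers need no case
    distinction. *)
Definition jp (k : Z) : R := (1 + l1deg k)%N%:R.

(** With the exponent [2 * n] the weight lies below the product over the coordinates of
    [(1 + |k_i|)^(-2)], hence can be summed one coordinate at a time. *)
Definition wt (k : Z) : R := (jp k) ^- (2 * n).

(** The lattice is enumerated by [pickle_inv]; naturals that code no frequency contribute 0. *)
Definition zterm (u : Z -> R) (j : nat) : R := oapp u 0 (pickle_inv j).

Definition zsum (u : Z -> R) : R := limn (series (zterm u)).

(** Domination by one fixed summable weight stands for absolute convergence; the constant bounds the
    sum up to the factor [3 ^+ n], uniformly over families. *)
Definition zdom (u : Z -> R) (C : R) : Prop := forall k, `|u k| <= C * wt k.

Lemma l1degD (k l : Z) : (l1deg (k + l) <= l1deg k + l1deg l)%N.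
Proof.
rewrite /l1deg -big_split /=; apply: leq_sum => i _; rewrite mxE.
by rewrite -lez_nat PoszD !abszE ler_normD.
Qed.

Lemma l1degN (k : Z) : l1deg (- k) = l1deg k.
Proof. by apply: eq_bigr => i _; rewrite mxE abszN. Qed.

Lemma l1deg0 : l1deg 0 = 0%N.
Proof. by rewrite /l1deg big1// => i _; rewrite mxE. Qed.

Lemma l1deg_eq0 (k : Z) : (l1deg k == 0%N) = (k == 0).
Proof.
apply/idP/eqP => [|->]; last by rewrite l1deg0.
rewrite /l1deg sum_nat_eq0 => /forallP h; apply/rowP => i; rewrite mxE.
by apply/eqP; rewrite -absz_eq0; exact: h.
Qed.

Lemma jp_ge1 (k : Z) : 1 <= jp k.
Proof. by rewrite /jp ler1n. Qed.

Lemma jp_gt0 (k : Z) : 0 < jp k.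
Proof. exact: lt_le_trans (jp_ge1 k). Qed.

Lemma jpN (k : Z) : jp (- k) = jp k.
Proof. by rewrite /jp l1degN. Qed.

Lemma jp0 : jp 0 = 1.
Proof. by rewrite /jp l1deg0. Qed.

Lemma wt_gt0 (k : Z) : 0 < wt k.
Proof. by rewrite invr_gt0 exprn_gt0// jp_gt0. Qed.

(** The correction [2 / (m + 1)] makes the induction close: the two new terms add [2 / (m + 2)^2],
    while the right side grows by [2 / ((m + 1) (m + 2))]. *)
Lemma sum_inv_sqr_le (m : nat) :
  \sum_(j < m.*2.+1) (1 + `|j%:R - m%:R : R|) ^- 2 <= 3 - 2 / m.+1%:R.
Proof.
elim: m => [|m IH].
  rewrite big_ord_recl big_ord0 /= subrr normr0 !addr0 expr1n invr1.
  lra.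
rewrite doubleS big_ord_recr big_ord_recl/=.
under eq_bigr => i _.
  rewrite /bump/= add1n -addn1 -(addn1 m) !natrD.
  have -> : i%:R + 1 - (m%:R + 1) = i%:R - m%:R :> R by ring.
  over.
rewrite /=.
have -> : 1 + `|0%:R - m.+1%:R| = m.+2%:R :> R.
  by rewrite sub0r normrN ger0_norm// -natr1 -(natr1 _ m.+1) addrC.
have -> : 1 + `|m.*2.+2%:R - m.+1%:R| = m.+2%:R :> R.
  rewrite -natrB; last by lia.
  by rewrite ger0_norm// -natr1 addrC; congr (_ %:R + _); lia.
set S := \sum_(_ < _) _ in IH *.
have a0 : 0 < m.+1%:R :> R by [].
have b0 : 0 < m.+2%:R :> R by [].
have e : m.+2%:R = m.+1%:R + 1 :> R by rewrite -natr1.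
apply: (@le_trans _ _ (m.+2%:R ^- 2 + (3 - 2 / m.+1%:R) + m.+2%:R ^- 2)).
  by rewrite lerD2r lerD2l.
rewrite -subr_ge0 e.
set a : R := m.+1%:R in a0 *.
have -> : 3 - 2 / (a + 1) - ((a + 1) ^- 2 + (3 - 2 / a) + (a + 1) ^- 2) =
   2 / (a * (a + 1) ^+ 2).
  by field; rewrite !gt_eqF//; lra.
by rewrite divr_ge0// mulr_ge0 ?exprn_ge0//; lra.
Qed.

Lemma wt_le_prod (k : Z) :
  wt k <= \prod_(i < n) (1 + absz (k 0%R i))%:R ^- 2.
Proof.
rewrite /wt exprM -exprVn -[X in _ ^+ X]card_ord -prodr_const.
apply: ler_prod => i _; rewrite invr_ge0 exprn_ge0 ?(ltW (jp_gt0 k))//=.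
rewrite lef_pV2 ?posrE ?exprn_gt0 ?jp_gt0 ?ltr0n//.
rewrite lerXn2r ?nnegrE ?ler0n// ler_nat leq_add2l /l1deg.
by rewrite (bigD1 i)//= leq_addr.
Qed.

Lemma sum_wt_le (s : seq Z) : uniq s -> \sum_(k <- s) wt k <= 3 ^+ n.
Proof.
(* All frequencies of [s] lie in a cube of side [2 m + 1], over which the product weight factors. *)
move=> us; pose m := \max_(k <- s) l1deg k.
pose rw (f : {ffun 'I_n -> 'I_m.*2.+1}) : Z := \row_i ((f i)%:Z - m%:Z).
have rwI : injective rw.
  move=> f g /rowP fg; apply/ffunP => i; apply/val_inj/eqP.
  by have := fg i; rewrite !mxE => /addIr[/eqP].
apply: (@le_trans _ _ (\sum_(k <- s) \prod_(i < n) (1 + absz (k 0%R i))%:R ^- 2)).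
  by apply: ler_sum => k _; exact: wt_le_prod.
apply: (@le_trans _ _ (\sum_(k <- [seq rw f | f : {ffun 'I_n -> 'I_m.*2.+1}])
    \prod_(i < n) (1 + absz (k 0%R i))%:R ^- 2)).
  apply: ler_sum_uniq_sub => //.
  - by rewrite map_inj_uniq ?enum_uniq.
  - move=> k ks; have km i : (absz (k 0%R i) <= m)%N.
      apply: (@leq_trans (l1deg k)); first by rewrite /l1deg (bigD1 i)//= leq_addr.
      exact: (@leq_bigmax_seq _ _ xpredT l1deg).
    have lt_k i : (absz (k 0 i + m%:Z)%R < m.*2.+1)%N by have := km i; lia.
    apply/mapP; exists [ffun i => Ordinal (lt_k i)]; first by rewrite mem_enum.
    apply/rowP => i; rewrite !mxE ffunE/= gez0_abs ?addrK//.
    by have := km i; move: (k 0 i : int) => z; lia.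
  - by move=> k; apply: prodr_ge0 => i _; rewrite invr_ge0 exprn_ge0.
rewrite big_map big_enum /=.
have -> : \sum_(f : {ffun 'I_n -> 'I_m.*2.+1})
    \prod_(i < n) (1 + absz (rw f 0%R i))%:R ^- 2 =
    \prod_(i < n) \sum_(j < m.*2.+1) (1 + `|j%:R - m%:R : R|) ^- 2.
  rewrite bigA_distr_bigA/=; apply: eq_bigr => f _; apply: eq_bigr => i _.
  rewrite mxE natrD natr_absz; congr ((1 + _) ^- 2).
  by rewrite intr_norm rmorphB.
rewrite prodr_const card_ord lerXn2r ?nnegrE//.
  by apply: sumr_ge0 => j _; rewrite invr_ge0 exprn_ge0// addr_ge0.
by apply: le_trans (sum_inv_sqr_le m) _; rewrite gerBl divr_ge0.
Qed.

Lemma sum_pmap_zterm (u : Z -> R) (N : nat) :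
  \sum_(k <- pmap (@pickle_inv Z) (iota 0 N)) u k = \sum_(0 <= j < N) zterm u j.
Proof.
rewrite /index_iota subn0 /zterm.
elim: (iota 0 N) => [|j s IH] /=; first by rewrite !big_nil.
by rewrite big_cons -IH; case: pickle_inv => [k|] /=; rewrite ?big_cons ?add0r.
Qed.

Lemma zdom_ge0 (u : Z -> R) (C : R) : zdom u C -> 0 <= C.
Proof.
move=> /(_ 0); rewrite /wt jp0 expr1n invr1 mulr1; exact: le_trans.
Qed.

Lemma zterm_le (u v : Z -> R) : (forall k, u k <= v k) ->
  forall j, zterm u j <= zterm v j.
Proof. by move=> uv j; rewrite /zterm; case: pickle_inv => //=. Qed.

Lemma zterm_norm (u : Z -> R) j : `|zterm u j| = zterm (fun k => `|u k|) j.
Proof. by rewrite /zterm; case: pickle_inv => //=; rewrite normr0. Qed.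

Lemma ztermZ (u : Z -> R) c j : zterm (fun k => c * u k) j = c * zterm u j.
Proof. by rewrite /zterm; case: pickle_inv => //=; rewrite mulr0. Qed.

Lemma ztermD (u v : Z -> R) j :
  zterm (fun k => u k + v k) j = zterm u j + zterm v j.
Proof. by rewrite /zterm; case: pickle_inv => //=; rewrite addr0. Qed.

Lemma series_wt_le N : series (zterm (wt)) N <= 3 ^+ n.
Proof.
rewrite /series/= -sum_pmap_zterm sum_wt_le//.
apply: (pmap_uniq (g := @choice.pickle _)); last exact: iota_uniq.
exact: pickle_invK.
Qed.

Lemma zterm_wt_ge0 j : 0 <= zterm wt j.
Proof. by rewrite /zterm; case: pickle_inv => //= k; exact/ltW/wt_gt0. Qed.

Lemma is_cvg_series_wt : cvgn (series (zterm wt)).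
Proof.
apply: nondecreasing_is_cvgn.
  by apply/nondecreasing_seqP => k; rewrite /series/= big_nat_recr//= lerDl zterm_wt_ge0.
by exists (3 ^+ n) => _ [N _ <-]; exact: series_wt_le.
Qed.

Lemma zterm_norm_le (u : Z -> R) (C : R) j : zdom u C ->
  `|zterm u j| <= C * zterm wt j.
Proof. by move=> uC; rewrite zterm_norm -ztermZ; exact: zterm_le. Qed.

Lemma is_cvg_zsum (u : Z -> R) (C : R) : zdom u C -> cvgn (series (zterm u)).
Proof.
move=> uC; apply: normed_cvg.
apply: (@series_le_cvg _ _ (fun j => C * zterm wt j)) => //.
- by move=> j /=.
- by move=> j; rewrite mulr_ge0 ?zterm_wt_ge0// (zdom_ge0 uC).
- by move=> j; exact: zterm_norm_le.
- exact: is_cvg_seriesZ is_cvg_series_wt.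
Qed.

Lemma cvg_zsum (u : Z -> R) (C : R) : zdom u C ->
  series (zterm u) N @[N --> \oo] --> zsum u.
Proof. by move=> /is_cvg_zsum. Qed.

Lemma zsum_uniq (u : Z -> R) (l : R) :
  series (zterm u) N @[N --> \oo] --> l -> zsum u = l.
Proof. exact: cvg_lim. Qed.

Lemma zsum_ext (u v : Z -> R) : (forall k, u k = v k) -> zsum u = zsum v.
Proof. by move=> uv; congr zsum; exact/funext. Qed.

Lemma zdomD (u v : Z -> R) C D : zdom u C -> zdom v D ->
  zdom (fun k => u k + v k) (C + D).
Proof.
move=> uC vD k; apply: le_trans (ler_normD _ _) _; rewrite mulrDl.
exact: lerD.
Qed.

Lemma zdomZ (u : Z -> R) c C : zdom u C -> zdom (fun k => c * u k) (`|c| * C).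
Proof. by move=> uC k; rewrite normrM -mulrA ler_wpM2l. Qed.

Lemma zdomN (u : Z -> R) C : zdom u C -> zdom (fun k => - u k) C.
Proof. by move=> uC k; rewrite normrN. Qed.

Lemma zdomB (u v : Z -> R) C D : zdom u C -> zdom v D ->
  zdom (fun k => u k - v k) (C + D).
Proof. by move=> uC /zdomN; exact: zdomD. Qed.

Lemma zsumD (u v : Z -> R) C D : zdom u C -> zdom v D ->
  zsum (fun k => u k + v k) = zsum u + zsum v.
Proof.
move=> uC vD; apply: zsum_uniq.
rewrite (_ : series _ = (fun N => series (zterm u) N + series (zterm v) N)).
  exact: cvgD (cvg_zsum uC) (cvg_zsum vD).
apply/funext => N; rewrite /series/= -big_split/=.
by apply: eq_bigr => j _; rewrite -ztermD.
Qed.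

Lemma zsumZ (u : Z -> R) c C : zdom u C ->
  zsum (fun k => c * u k) = c * zsum u.
Proof.
move=> uC; apply: zsum_uniq.
rewrite (_ : series _ = (fun N => c * series (zterm u) N)).
  exact: cvgMr (cvg_zsum uC).
apply/funext => N; rewrite /series/= big_distrr/=.
by apply: eq_bigr => j _; rewrite -ztermZ.
Qed.

Lemma zsumN (u : Z -> R) C : zdom u C -> zsum (fun k => - u k) = - zsum u.
Proof.
move=> uC; rewrite -mulN1r -(zsumZ _ uC); apply: zsum_ext => k.
by rewrite mulN1r.
Qed.

Lemma zsumB (u v : Z -> R) C D : zdom u C -> zdom v D ->
  zsum (fun k => u k - v k) = zsum u - zsum v.
Proof. by move=> uC vD; rewrite (zsumD uC (zdomN vD)) (zsumN vD). Qed.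

Lemma ler_zsum (u v : Z -> R) C D : zdom u C -> zdom v D ->
  (forall k, u k <= v k) -> zsum u <= zsum v.
Proof.
move=> uC vD uv; apply: ler_lim; [exact: is_cvg_zsum uC|exact: is_cvg_zsum vD|].
by near=> N; apply: ler_sum => j _; exact: zterm_le.
Unshelve. all: by end_near. Qed.

Lemma zsum_wt_le : zsum wt <= 3 ^+ n.
Proof.
apply: limr_le; first exact: is_cvg_series_wt.
by near=> N; exact: series_wt_le.
Unshelve. all: by end_near. Qed.

Lemma zdom_wt : zdom wt 1.
Proof. by move=> k; rewrite mul1r gtr0_norm// wt_gt0. Qed.

Lemma zsum_norm_le (u : Z -> R) C : zdom u C -> `|zsum u| <= C * 3 ^+ n.
Proof.
move=> uC; apply: (@le_trans _ _ (C * zsum wt)); last first.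
  by rewrite ler_wpM2l ?zsum_wt_le// (zdom_ge0 uC).
rewrite -(zsumZ _ zdom_wt) ler_norml -(zsumN (zdomZ _ zdom_wt)).
by apply/andP; split;
  (apply: ler_zsum; [|exact: uC|]) || (apply: ler_zsum; [exact: uC| |]);
  try exact: (zdomN (zdomZ _ zdom_wt)); try exact: (zdomZ _ zdom_wt);
  move=> k; have := uC k; rewrite ler_norml => /andP[].
Qed.

(** One truncation index serves all families, since the tail of [wt] controls every tail; dominated
    convergence rests on this uniformity. *)
Lemma zsum_tail (e : R) : 0 < e -> exists K, forall (u : Z -> R) C,
  zdom u C -> `|zsum u - series (zterm u) K| <= C * e.
Proof.
move=> e0; have /cvgrPdist_le/(_ _ e0) := cvg_zsum zdom_wt.
move=> [K _ /(_ K (leqnn K))/= hK]; exists K => u C uC.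
have h : `|series (zterm u) N - series (zterm u) K| @[N --> \oo] -->
    `|zsum u - series (zterm u) K|.
  by apply: cvg_norm; apply: cvgB; [exact: cvg_zsum uC|exact: cvg_cst].
have h2 : C * (series (zterm wt) N - series (zterm wt) K) @[N --> \oo] -->
    C * (zsum wt - series (zterm wt) K).
  by apply: cvgMr; apply: cvgB; [exact: cvg_zsum zdom_wt|exact: cvg_cst].
apply: (@le_trans _ _ (C * (zsum wt - series (zterm wt) K))); last first.
  by rewrite ler_wpM2l ?(zdom_ge0 uC)//; apply: le_trans hK; exact: ler_norm.
apply: ler_cvg_to h h2 _; near=> N.
have KN : (K <= N)%N by near: N; exact: nbhs_infty_ge.
rewrite /= !sub_series_geq//= big_distrr/=; apply: le_trans (ler_norm_sum _ _ _) _.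
by apply: ler_sum => j _; exact: zterm_norm_le.
Unshelve. all: by end_near. Qed.

Lemma zdom_lim (T : Type) (F : set_system T) (FF : ProperFilter F)
    (u : T -> Z -> R) (l : Z -> R) (C : R) :
  (\forall t \near F, zdom (u t) C) ->
  (forall k, u t k @[t --> F] --> l k) -> zdom l C.
Proof.
move=> uC ul k; apply: (@closed_cvg _ _ F _ (fun t => `|u t k|) [set r | r <= C * wt k]).
- exact: closed_le.
- by move: uC; apply: filterS => t; exact.
- exact: cvg_norm.
Qed.

Lemma zsum_dominated_cvg (T : Type) (F : set_system T) (FF : ProperFilter F)
    (u : T -> Z -> R) (l : Z -> R) (C : R) :
  (\forall t \near F, zdom (u t) C) ->
  (forall k, u t k @[t --> F] --> l k) -> zsum (u t) @[t --> F] --> zsum l.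
Proof.
move=> uC ul; have lC := zdom_lim FF uC ul; have C0 := zdom_ge0 lC.
apply/cvgrPdist_le => e e0.
have [|K hK] := @zsum_tail (e / 3 / (C + 1)).
  by rewrite !divr_gt0//; lra.
have CK : C * (e / 3 / (C + 1)) <= e / 3.
  by rewrite mulrCA ler_piMr ?divr_ge0 ?(ltW e0)// ler_pdivrMr; lra.
have : series (zterm (u t)) K @[t --> F] --> series (zterm l) K.
  apply: cvg_big => [|j _]; first exact: add_continuous.
  by rewrite /zterm; case: pickle_inv => [k|] /=; [exact: ul|exact: cvg_cst].
have e3 : 0 < e / 3 by rewrite divr_gt0.
move=> /cvgrPdist_le/(_ _ e3) h; near=> t.
have ut : zdom (u t) C by near: t.
have a := le_trans (hK _ _ lC) CK.
have b := le_trans (hK _ _ ut) CK.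
have c : `|series (zterm l) K - series (zterm (u t)) K| <= e / 3 by near: t.
move: a b c; rewrite !ler_norml; set x := zsum l; set y := zsum (u t).
set z := series _ _; set w := series _ _.
by move=> /andP[? ?] /andP[? ?] /andP[? ?]; apply/andP; split; lra.
Unshelve. all: by end_near. Qed.

Lemma zsum_seq (s : seq Z) (u : Z -> R) : uniq s ->
  (forall k, k \notin s -> u k = 0) -> zsum u = \sum_(k <- s) u k.
Proof.
move=> us u0; apply: zsum_uniq; apply: cvg_near_cst; near=> N.
rewrite /series/= -sum_pmap_zterm.
have sN : {subset s <= pmap (@pickle_inv Z) (iota 0 N)}.
  near: N; exists (\max_(k <- s) (choice.pickle k).+1)%N => // N /= hN k ks.
  rewrite mem_pmap; apply/mapP; exists (choice.pickle k); last by rewrite pickleK_inv.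
  rewrite mem_iota add0n/=; apply: leq_trans hN.
  exact: (@leq_bigmax_seq _ _ xpredT (fun k => (choice.pickle k).+1)).
rewrite (bigID (mem s))/= [X in _ + X]big1 ?addr0 => [|k /u0//].
rewrite -big_filter; apply: perm_big; apply: uniq_perm => //.
  rewrite filter_uniq//; apply: (pmap_uniq (g := @choice.pickle _)); last exact: iota_uniq.
  exact: pickle_invK.
by move=> k; rewrite mem_filter/=; have := sN k; case: (k \in s) => //= ->.
Unshelve. all: by end_near. Qed.

End lattice_sums.

(** * Waves on the torus *)

Section waves.
Context (R : realType) (n : nat).
Local Notation Z := 'rV[int]_n.
Local Notation V := 'rV[R]_n.
Local Notation T := (torus R n).
Implicit Types (k l : Z) (x y : V) (t : R).

(** The free phase replaces complex exponentials: phase 0 gives the cosine, phase [- (pi / 2)] the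
    sine, and the linear span is closed under products and translations. *)
Definition wave k t x : R := cos (freq_dot k x + t).

Lemma freq_dotDl k l x : freq_dot (k + l) x = freq_dot k x + freq_dot l x.
Proof.
rewrite /freq_dot -big_split/=; apply: eq_bigr => i _.
by rewrite mxE rmorphD mulrDl.
Qed.

Lemma freq_dotNl k x : freq_dot (- k) x = - freq_dot k x.
Proof.
by rewrite /freq_dot -sumrN; apply: eq_bigr => i _; rewrite mxE rmorphN mulNr.
Qed.

Lemma freq_dotBl k l x : freq_dot (k - l) x = freq_dot k x - freq_dot l x.
Proof. by rewrite freq_dotDl freq_dotNl. Qed.

Lemma freq_dot0l x : freq_dot (0 : Z) x = 0.
Proof. by rewrite /freq_dot big1// => i _; rewrite mxE mul0r. Qed.

Lemma freq_dotD k x y : freq_dot k (x + y) = freq_dot k x + freq_dot k y.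
Proof.
by rewrite /freq_dot -big_split/=; apply: eq_bigr => i _; rewrite mxE mulrDr.
Qed.

Lemma freq_dotZ k (a : R) x : freq_dot k (a *: x) = a * freq_dot k x.
Proof.
rewrite /freq_dot big_distrr/=; apply: eq_bigr => i _.
by rewrite mxE mulrCA.
Qed.

Lemma freq_dotN k x : freq_dot k (- x) = - freq_dot k x.
Proof. by rewrite -scaleN1r freq_dotZ mulN1r. Qed.

Lemma freq_dotB k x y : freq_dot k (x - y) = freq_dot k x - freq_dot k y.
Proof. by rewrite freq_dotD freq_dotN. Qed.

Lemma freq_dot_delta k i : freq_dot k (delta_mx 0 i : V) = (k 0 i)%:~R.
Proof.
rewrite /freq_dot (bigD1 i)//= big1 ?addr0 ?mxE ?eqxx ?mulr1// => j ji.
by rewrite mxE eqxx (negbTE ji) mulr0.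
Qed.

Lemma cosD2piz (a : R) (m : int) : cos (a + 2 * pi * m%:~R) = cos a.
Proof.
have h (b : R) (j : nat) : cos (b + 2 * pi * j%:R) = cos b.
  elim: j => [|j IH]; first by rewrite mulr0 addr0.
  rewrite -[j.+1%:R]natr1 mulrDr mulr1 addrA mulr_natl.
  by rewrite cosD2pi -mulr_natl.
case: m => j; first exact: h.
by rewrite NegzE -(h _ j.+1) rmorphN mulrN -addrA [X in a + X]addNr addr0.
Qed.

Lemma wave_lattice k t x y : torus_lattice (x - y) -> wave k t x = wave k t y.
Proof.
move=> /asboolP[m xy]; rewrite -(subrK y x) xy /wave freq_dotD.
have -> : freq_dot k (\row_i (2 * pi * (m 0 i)%:~R) : V) =
    2 * pi * (\sum_i k 0 i * m 0 i)%:~R.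
  rewrite /freq_dot rmorph_sum big_distrr/=; apply: eq_bigr => i _.
  by rewrite mxE rmorphM mulrCA.
by rewrite -addrA addrC cosD2piz.
Qed.

Lemma wave_le1 k t x : `|wave k t x| <= 1.
Proof. exact: cos_max. Qed.

Lemma waveM k l t s x : wave k t x * wave l s x =
  2^-1 * (wave (k + l) (t + s) x + wave (k - l) (t - s) x).
Proof.
rewrite /wave freq_dotDl freq_dotBl.
have -> : freq_dot k x + freq_dot l x + (t + s) =
  (freq_dot k x + t) + (freq_dot l x + s) by ring.
have -> : freq_dot k x - freq_dot l x + (t - s) =
  (freq_dot k x + t) - (freq_dot l x + s) by ring.
rewrite [cos (_ + _ + _)]cosD cosB; by field.
Qed.

Lemma waveD k t x y : wave k t (x + y) = wave k (t + freq_dot k y) x.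
Proof. by rewrite /wave freq_dotD addrAC addrA. Qed.

Lemma waveN k t x : wave (- k) (- t) x = wave k t x.
Proof. by rewrite /wave freq_dotNl -opprD cosN. Qed.

Lemma wave0 t x : wave 0 t x = cos t.
Proof. by rewrite /wave freq_dot0l add0r. Qed.

Lemma continuous_freq_dot k : continuous (fun x : V => freq_dot k x).
Proof.
move=> x; rewrite /freq_dot.
apply: (@cvg_big R 'I_n +%R 0 xpredT _ V (nbhs x)) => [|i _].
  exact: add_continuous.
by apply: cvgMr; exact: coord_continuous.
Qed.

Lemma continuous_wave k t : continuous (wave k t).
Proof.
move=> x; apply: (@continuous_comp _ _ _ (fun x : V => freq_dot k x + t) cos).
  by apply: (@cvgD _ _ _ (nbhs x)); [exact: continuous_freq_dot|exact: cvg_cst].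
exact: continuous_cos.
Qed.

Definition periodic_rV (f : V -> R) : Prop :=
  forall x y, torus_lattice (x - y) -> f x = f y.

Lemma wave_periodic k t : periodic_rV (wave k t).
Proof. by move=> x y; exact: wave_lattice. Qed.

Lemma pi_torusP x y : (\pi_T x = \pi_T y)%qT <-> torus_lattice (x - y).
Proof.
have h := Quotient.idealrBE (@torus_lattice R n) x y.
split => [xy|xy].
  have : (x - y \in @torus_lattice R n) by rewrite h; exact/eqP.
  by [].
have : (x - y \in @torus_lattice R n) by [].
by rewrite h => /eqP.
Qed.

Lemma repr_pi_lattice x : torus_lattice (repr (\pi_T x)%qT - x).
Proof. by apply/pi_torusP; rewrite reprK. Qed.

Lemma continuous_torus (f : V -> R) : continuous f -> periodic_rV f ->
  continuous (f \o repr : T -> R).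
Proof.
move=> cf pf; apply: repr_comp_continuous => // x y /eqP/pi_torusP/pf ->.
by rewrite eqxx.
Qed.

Lemma periodic_repr_pi (f : V -> R) x : periodic_rV f ->
  f (repr (\pi_T x)%qT) = f x.
Proof. by apply; exact: repr_pi_lattice. Qed.

End waves.

(** * Integration of waves *)

Section tuple_integral.
Context (R : realType).
Local Notation RT := (measurableTypeR R).
Local Notation lebT := (lebesgue_tuple R).

Lemma integral_mrestr d (X : measurableType d) (mu : {measure set X -> \bar R})
    (D : set X) (mD : measurable D) (f : X -> \bar R) :
  (mrestr mu mD).-integrable setT f ->
  (\int[mrestr mu mD]_x f x = \int[mu]_(x in D) f x)%E.
Proof.
move=> fi; rewrite (@negligible_integral _ _ _ _ setT (~` D)) //=.
- rewrite setTD setCK; apply: eq_measure_integral => A mA AD.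
  by rewrite /= /mrestr setIidl.
- exact: measurableC.
- by rewrite /mrestr setICl measure0.
Qed.

Lemma preimage_torus_cube_cons n :
  @tuple_cons RT n @^-1` @torus_cube R n.+1 = `]-pi, pi]%classic `*` @torus_cube R n.
Proof.
apply/seteqP; split => -[a s] /=.
  move=> h; split => /=; first by have := h ord0; rewrite /= in_itv/= (tnth_nth 0).
  by move=> i; have := h (lift ord0 i); rewrite !(tnth_nth 0).
move=> [a1 s1] i; rewrite (tnth_nth 0)/=.
case: (unliftP ord0 i) => [j ->|->] /=; first by have := s1 j; rewrite (tnth_nth 0).
by move: a1; rewrite /= in_itv.
Qed.

Lemma lebesgue_tuple_cube n : lebT n (@torus_cube R n) = ((2 * pi) ^+ n)%:E.
Proof.
elim: n => [|n IH].
  rewrite /= diracE expr0 mem_set//; by case.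
rewrite /= /lebesgue_tuple_step /pushforward preimage_torus_cube_cons.
rewrite product_measure1E//; last exact: measurable_torus_cube.
rewrite exprS EFinM; congr (_ * _)%E => //.
rewrite [LHS](@lebesgue_measure_itv R `]-pi, pi]) /= lte_fin ifT; last first.
  by have := pi_gt0 R; lra.
by rewrite -EFinB; congr EFin; lra.
Qed.

Lemma derivable_oo_LRcontinuous_of_derivable (F : R -> R) (a b : R) :
  a < b -> (forall x, derivable F x 1) -> derivable_oo_LRcontinuous F a b.
Proof.
move=> ab dF.
have cF x : {for x, continuous F}.
  by apply: differentiable_continuous; apply/derivable1_diffP.
split; first by move=> x _.
- exact/cvg_at_right_filter/cF.
- exact/cvg_at_left_filter/cF.
Qed.

Lemma integral_cos_itv (k : int) (t : R) :
  (\int[lebesgue_measure]_(x in `](- pi)%R, pi%R]) (cos (k%:~R * x + t))%:E =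
   (if k == 0 then 2 * pi * cos t else 0)%R%:E)%E.
Proof.
have pi0 := pi_gt0 R.
have dlin x : is_derive x (1 : R) (fun x => k%:~R * x + t : R) k%:~R.
  by apply: is_derive_eq; rewrite /= ?scaler0 ?addr0 ?mulr1 ?add0r; rewrite /GRing.scale/= mulr1.
have cf : continuous (fun x : R => cos (k%:~R * x + t)).
  move=> x; apply: (@continuous_comp _ _ _ (fun x : R => k%:~R * x + t) cos).
    by apply: differentiable_continuous; apply/derivable1_diffP.
  exact: continuous_cos.
rewrite integral_itv_obnd_cbnd; last first.
  apply/measurable_EFinP; apply: measurable_funTS.
  exact: continuous_measurable_fun.
have [->|k0] := eqVneq k 0.
  under eq_integral do rewrite mul0r add0r.
  rewrite integral_cst// (_ : _ `[_, _]%classic = (2 * pi)%:E).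
    by rewrite -EFinM mulrC.
  rewrite [LHS](@lebesgue_measure_itv R `[-pi, pi])/= lte_fin ifT; last lra.
  by rewrite -EFinB; congr EFin; lra.
have kR0 : k%:~R != 0 :> R by rewrite intr_eq0.
have dF x : is_derive x (1 : R) (fun x => k%:~R^-1 * sin (k%:~R * x + t))
   (cos (k%:~R * x + t)).
  have h := @is_derive1_comp R sin (fun x => k%:~R * x + t) x _ _
    (is_derive_sin _) (dlin x).
  have := is_deriveM (is_derive_cst (k%:~R^-1 : R) x 1) h.
  move=> h2; refine (@is_derive_eq _ _ _ _ _ _ _ _ h2 _).
  by rewrite /GRing.scale/= mulr0 addr0 mulrCA mulVf ?mulr1.
rewrite (@continuous_FTC2 _ _ (fun x => k%:~R^-1 * sin (k%:~R * x + t))).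
- rewrite -EFinB; congr EFin.
  (* The endpoints differ by a multiple of the period; sines are turned into cosines so that
     [cosD2piz] applies. *)
  have -> : k%:~R * pi + t = (k%:~R * - pi + t) + 2 * pi * k%:~R by ring.
  rewrite -[sin (_ + _)]cosBpihalf -[sin _]cosBpihalf.
  have -> a b c : a + b - c = (a - c) + b :> R by ring.
  by rewrite cosD2piz subrr.
- by lra.
- exact: continuous_subspaceT.
- by apply: derivable_oo_LRcontinuous_of_derivable => //; lra.
- by move=> x _; rewrite derive1E; apply: derive_val.
Qed.

Lemma measurable_torus_continuous n (f : torus R n -> R) :
  continuous f -> measurable_fun [set: torus R n] f.
Proof.
move=> /continuousP cf; apply: (measurability _ (RGenOpens.measurableE R)).
move=> _ [_ [a [b ->]] <-]; rewrite setTI; apply: sub_sigma_algebra.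
exact/cf/interval_open.
Qed.

Definition row_of n (s : n.-tuple RT) : 'rV[R]_n := \row_i tnth s i.

Lemma periodic_torus_of_tuple n (f : 'rV[R]_n -> R) s : periodic_rV f ->
  f (repr (torus_of_tuple s)) = f (row_of s).
Proof. exact: periodic_repr_pi. Qed.

Lemma measurable_wave_tuple n (k : 'rV[int]_n) t :
  measurable_fun [set: n.-tuple RT] (fun s => wave k t (row_of s)).
Proof.
rewrite (_ : (fun s => _) = (wave k t \o repr) \o @torus_of_tuple R n).
  apply: measurableT_comp; last exact: measurable_torus_of_tuple.
  apply: measurable_torus_continuous; apply: continuous_torus.
    exact: continuous_wave.
  exact: wave_periodic.
by apply/funext => s /=; rewrite periodic_torus_of_tuple//; exact: wave_periodic.
Qed.

Definition freq_tail n (k : 'rV[int]_n.+1) : 'rV[int]_n :=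
  \row_j k 0 (lift ord0 j).

(** Fubini on the first coordinate: fixing it to [a] only shifts the phase of the wave in the
    remaining ones, which is why the induction lets the phase vary. *)
Lemma integral_wave_tuple n (k : 'rV[int]_n) t :
  (\int[lebT n]_(s in @torus_cube R n) (wave k t (row_of s))%:E =
    (if k == 0 then (2 * pi) ^+ n * cos t else 0)%R%:E)%E.
Proof.
elim: n k t => [|n IH] k t.
  rewrite (thinmx0 k) eqxx expr0 mul1r /=.
  rewrite integral_dirac//=.
  - rewrite diracE mem_set; last by case.
    by rewrite mul1e wave0.
  - exact: measurable_torus_cube.
  - apply/measurable_EFinP; apply: measurable_funTS.
    exact: measurable_wave_tuple.
have wcons (a : RT) (s : n.-tuple RT) :
    wave k t (row_of (tuple_cons (a, s))) =
    wave (freq_tail k) ((k 0 ord0)%:~R * a + t) (row_of s).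
  rewrite /wave /freq_dot big_ord_recl !mxE (tnth_nth 0)/=.
  rewrite -addrA addrCA; congr (cos (_ + _)); apply: eq_bigr => i _.
  by rewrite !mxE !(tnth_nth 0).
have k0E : (k == 0) = (k 0 ord0 == 0) && (freq_tail k == 0).
  apply/idP/idP => [/eqP ->|/andP[/eqP k0 /eqP kt]].
    by rewrite mxE eqxx; apply/eqP/rowP => i; rewrite !mxE.
  apply/eqP/rowP => i; rewrite mxE; case: (unliftP ord0 i) => [j ->|->] //.
  by have /rowP/(_ j) := kt; rewrite !mxE.
have mQ := @measurable_torus_cube R n.
have mf m (l : 'rV[int]_m) r : measurable_fun [set: m.-tuple RT]
    (fun s => (wave l r (row_of s))%:E).
  by apply/measurable_EFinP; exact: measurable_wave_tuple.
pose A : set (RT * n.-tuple RT) := `]-pi, pi]%classic `*` @torus_cube R n.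
have preA : @tuple_cons RT n @^-1` @torus_cube R n.+1 = A.
  exact: preimage_torus_cube_cons.
have mA : measurable A.
  by apply: measurableX => //; exact: measurable_itv.
have Aoo : ((lebesgue_measure \x lebT n)%E
A < +oo)%E.
  have := lebesgue_tuple_cube n.+1.
  rewrite /= /lebesgue_tuple_step /pushforward preA => ->.
  by rewrite ltry.
have fint : (lebesgue_measure \x lebT n)%E.-integrable
    A
    ((fun s => (wave k t (row_of s))%:E) \o @tuple_cons RT n).
  apply: measurable_bounded_integrable => //.
    apply: measurable_funTS.
    exact: (measurableT_comp (measurable_wave_tuple k t)
      (@measurable_tuple_cons _ RT n)).
  exists 1; split=> // r r1 s _; exact: le_trans (wave_le1 _ _ _) (ltW r1).
rewrite [LHS](@integral_pushforward _ _ _ _ _ _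
  (@measurable_tuple_cons _ RT n) (lebesgue_measure \x lebT n)%E); [|exact: mf|by rewrite preA|
    exact: measurable_torus_cube].
rewrite preA integral_mkcond.
rewrite -integral12_prod_meas1; last first.
  by move: fint; rewrite integrable_mkcond.
transitivity (\int[lebesgue_measure]_(a in `](- pi)%R, pi%R])
  (if freq_tail k == 0 then (2 * pi) ^+ n * cos ((k 0 ord0)%:~R * a + t) else 0)%R%:E)%E.
  rewrite [RHS]integral_mkcond; apply: eq_integral => a _.
  rewrite patchE; case: ifPn => [|/negP] aA.
    rewrite -IH [RHS]integral_mkcond; apply: eq_integral => s _.
    rewrite !patchE; have -> : ((a, s) \in A)
      = (s \in @torus_cube R n).
      apply/idP/idP => /set_mem h; apply/mem_set; first exact: h.2.
      by split => //=; exact: set_mem aA.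
    by case: ifPn => // _; rewrite /= wcons.
  apply: integral0_eq => s _; rewrite patchE ifF//.
  by apply/negP => /set_mem -[/= aQ _]; apply: aA; exact: mem_set.
rewrite k0E; case: (_ == 0); last by rewrite andbF integral0_eq.
rewrite andbT; under eq_integral do rewrite EFinM.
rewrite integralZl//=.
  rewrite integral_cos_itv -EFinM; congr EFin; case: ifP => _.
    by rewrite exprS; ring.
  by rewrite mulr0.
apply: measurable_bounded_integrable => //.
- rewrite [ltLHS](@lebesgue_measure_itv R `]-pi, pi])/=.
  by case: ifP => // _; rewrite -EFinB ltry.
- apply: measurable_funTS; apply: continuous_measurable_fun => x.
  apply: (@continuous_comp _ _ _ (fun x : R => (k 0 ord0)%:~R * x + t) cos).
    by apply: differentiable_continuous; apply/derivable1_diffP.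
  exact: continuous_cos.
- by exists 1; split=> // r r1 s _; exact: le_trans (cos_max _) (ltW r1).
Qed.

End tuple_integral.

Section torus_integral.
Context (R : realType) (n : nat).
Local Notation RT := (measurableTypeR R).
Local Notation T := (torus R n).
Local Notation mu := (torus_measure (R := R) (n := n)).
Local Notation V := ((2 * pi : R) ^+ n).

Lemma torus_measureT : mu setT = V%:E.
Proof. by rewrite /torus_measure setTI lebesgue_tuple_cube. Qed.

Lemma volume_gt0 : 0 < V.
Proof. by rewrite exprn_gt0// mulr_gt0// pi_gt0. Qed.

Lemma integral_torus (f : T -> R) : measurable_fun setT f ->
  [bounded f x | x in [set: T]] ->
  (\int[mu]_X (f X)%:E =
   \int[lebesgue_tuple R n]_(s in @torus_cube R n) (f (torus_of_tuple s))%:E)%E.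
Proof.
move=> mf bf.
have fi : (mrestr (lebesgue_tuple R n) (@measurable_torus_cube R n)).-integrable
    setT ((EFin \o f) \o @torus_of_tuple R n).
  apply: measurable_bounded_integrable => //.
  - by rewrite /= /mrestr setTI [ltLHS]lebesgue_tuple_cube ltry.
  - exact: (measurableT_comp mf (@measurable_torus_of_tuple R n)).
  - by case: bf => M [Mr hM]; exists M; split=> // x Mx s _; exact: hM.
rewrite -[RHS](integral_mrestr fi).
apply: (integral_pushforward (@measurable_torus_of_tuple R n) _ fi) => //.
exact/measurable_EFinP.
Qed.

Lemma bounded_integrable (f : T -> R) (C : R) : measurable_fun setT f ->
  (forall X, `|f X| <= C) -> mu.-integrable setT (EFin \o f).
Proof.
move=> mf fC; apply: measurable_bounded_integrable => //.
  by rewrite /= torus_measureT ltry.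
exists C; split; first exact: num_real.
by move=> r Cr X _; exact: le_trans (fC X) (ltW Cr).
Qed.

Lemma measurable_wave (k : 'rV[int]_n) t :
  measurable_fun [set: T] (wave k t \o repr).
Proof.
apply: measurable_torus_continuous; apply: continuous_torus.
  exact: continuous_wave.
exact: wave_periodic.
Qed.

Lemma Rintegral_wave (k : 'rV[int]_n) t :
  \int[mu]_X wave k t (repr X) = if k == 0 then V * cos t else 0.
Proof.
rewrite /Rintegral integral_torus.
- under eq_integral do rewrite (periodic_torus_of_tuple _ (@wave_periodic _ _ _ _)).
  by rewrite integral_wave_tuple.
- exact: measurable_wave.
- by exists 1; split=> // r r1 s _; exact: le_trans (wave_le1 _ _ _) (ltW r1).
Qed.

End torus_integral.

(** * Fourier transform on the torus *)

Section fourier.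
Context (R : realType) (n : nat).
Local Notation Z := 'rV[int]_n.
Local Notation T := (torus R n).
Local Notation mu := (torus_measure (R := R) (n := n)).
Local Notation V := ((2 * pi : R) ^+ n).
Implicit Types (v g : T -> R) (k l : Z) (t : R).

Definition L1 v : Prop := mu.-integrable setT (EFin \o v).

Definition tint v : R := \int[mu]_X v X.

Lemma L1_measurable v : L1 v -> measurable_fun setT v.
Proof. by move=> /measurable_int/measurable_EFinP. Qed.

Lemma L1_mul v g (C : R) : L1 v -> measurable_fun setT g ->
  (forall X, `|g X| <= C) -> L1 (fun X => v X * g X).
Proof.
move=> v1 mg gC; apply: (integrableMl measurableT v1 mg).
exists C; split; first exact: num_real.
by move=> r Cr X _; exact: le_trans (gC X) (ltW Cr).
Qed.

Lemma L1_bounded g (C : R) : measurable_fun setT g ->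
  (forall X, `|g X| <= C) -> L1 g.
Proof. exact: bounded_integrable. Qed.

Lemma L1D v g : L1 v -> L1 g -> L1 (fun X => v X + g X).
Proof. by move=> v1 g1; exact: (integrableD measurableT v1 g1). Qed.

Lemma L1Z c v : L1 v -> L1 (fun X => c * v X).
Proof. by move=> v1; exact: (integrableZl measurableT c v1). Qed.

Lemma L1B v g : L1 v -> L1 g -> L1 (fun X => v X - g X).
Proof. by move=> v1 g1; exact: (integrableB measurableT v1 g1). Qed.

Lemma L1_norm v : L1 v -> L1 (fun X => `|v X|).
Proof. exact: integrable_norm. Qed.

Lemma L1_sum I (s : seq I) (h : I -> T -> R) : (forall i, L1 (h i)) ->
  L1 (fun X => \sum_(i <- s) h i X).
Proof.
move=> h1; elim: s => [|i s IH].
  under eq_fun do rewrite big_nil.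
  by apply: (@L1_bounded _ 0) => [|X]; [exact: measurable_cst|rewrite normr0].
by under eq_fun do rewrite big_cons; exact: L1D.
Qed.

Lemma tintD v g : L1 v -> L1 g -> tint (fun X => v X + g X) = tint v + tint g.
Proof. by move=> v1 g1; exact: RintegralD. Qed.

Lemma tintB v g : L1 v -> L1 g -> tint (fun X => v X - g X) = tint v - tint g.
Proof. by move=> v1 g1; exact: RintegralB. Qed.

Lemma tintZ c v : L1 v -> tint (fun X => c * v X) = c * tint v.
Proof. by move=> v1; exact: RintegralZl. Qed.

Lemma tintZr c v : L1 v -> tint (fun X => v X * c) = tint v * c.
Proof. by move=> v1; exact: RintegralZr. Qed.

Lemma tint_sum I (s : seq I) (h : I -> T -> R) : (forall i, L1 (h i)) ->
  tint (fun X => \sum_(i <- s) h i X) = \sum_(i <- s) tint (h i).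
Proof.
move=> h1; elim: s => [|i s IH].
  rewrite big_nil /tint; under eq_Rintegral do rewrite big_nil.
  by rewrite Rintegral_cst// mul0r.
rewrite big_cons -IH -tintD//; last exact: L1_sum.
by rewrite /tint; under eq_Rintegral do rewrite big_cons.
Qed.

Lemma ler_tint v g : L1 v -> L1 g -> (forall X, v X <= g X) -> tint v <= tint g.
Proof. by move=> v1 g1 vg; exact: le_Rintegral. Qed.

Lemma tint_ge0 v : (forall X, 0 <= v X) -> 0 <= tint v.
Proof. by move=> v0; exact: Rintegral_ge0. Qed.

Lemma tint_norm v : L1 v -> `|tint v| <= tint (fun X => `|v X|).
Proof. by move=> v1; exact: le_normr_Rintegral. Qed.

Lemma eq_tint v g : (forall X, v X = g X) -> tint v = tint g.
Proof. by move=> vg; rewrite (_ : v = g)//; exact/funext. Qed.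

Lemma tint_cst (c : R) : tint (fun=> c) = c * V.
Proof. by rewrite /tint Rintegral_cst//= torus_measureT. Qed.

Lemma tint_mul_le v g (C : R) : L1 v -> measurable_fun setT g ->
  (forall X, `|g X| <= C) ->
  `|tint (fun X => v X * g X)| <= C * tint (fun X => `|v X|).
Proof.
move=> v1 mg gC; have vg := L1_mul v1 mg gC.
apply: le_trans (tint_norm vg) _; rewrite -tintZ; last exact: L1_norm.
apply: ler_tint; [exact: L1_norm|exact/L1Z/L1_norm|move=> X].
by rewrite normrM mulrC ler_wpM2r.
Qed.

Lemma eq_tint_ae v g : measurable_fun setT v -> measurable_fun setT g ->
  {ae mu, forall X, v X = g X} -> tint v = tint g.
Proof.
move=> mv mg vg; rewrite /tint /Rintegral; congr fine.
apply: ae_eq_integral => //; [exact/measurable_EFinP|exact/measurable_EFinP|].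
by apply: filterS vg => X -> _.
Qed.

Lemma measurable_zsum (u : T -> Z -> R) (C : R) :
  (forall k, measurable_fun setT (fun X => u X k)) ->
  (forall X, zdom (u X) C) -> measurable_fun setT (fun X => zsum (u X)).
Proof.
move=> mu' uC; apply: (@measurable_fun_cvg _ _ _ _
  (fun N X => series (zterm (u X)) N)) => [N|X _].
  apply: measurable_sum => j; rewrite /zterm.
  by case: pickle_inv => [k|] /=; [exact: mu'|exact: measurable_cst].
exact: cvg_zsum (uC X).
Qed.

(** Dominated convergence for the partial sums, all of which are bounded by [C * 3 ^+ n]. *)
Lemma tint_zsum v (u : T -> Z -> R) (C : R) : L1 v ->
  (forall k, measurable_fun setT (fun X => u X k)) ->
  (forall X, zdom (u X) C) ->
  tint (fun X => v X * zsum (u X)) = zsum (fun k => tint (fun X => v X * u X k)).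
Proof.
move=> v1 mu' uC.
have mz := measurable_zsum mu' uC.
have mser N : measurable_fun setT (fun X => series (zterm (u X)) N).
  apply: measurable_sum => j; rewrite /zterm.
  by case: pickle_inv => [k|] /=; [exact: mu'|exact: measurable_cst].
have mzt j : measurable_fun setT (fun X => zterm (u X) j).
  rewrite /zterm.
  by case: pickle_inv => [k|] /=; [exact: mu'|exact: measurable_cst].
have C0 : 0 <= C by exact: zdom_ge0 (uC point).
have uB X j : `|zterm (u X) j| <= C * zterm (@wt R n) j by exact: zterm_norm_le.
have sB X N : `|series (zterm (u X)) N| <= C * 3 ^+ n.
  apply: le_trans (ler_norm_sum _ _ _) _.
  apply: (@le_trans _ _ (C * series (zterm (@wt R n)) N)).
    by rewrite /series/= big_distrr/=; apply: ler_sum.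
  by rewrite ler_wpM2l ?series_wt_le.
have v1C : L1 (fun X => C * 3 ^+ n * `|v X|) by exact/L1Z/L1_norm.
have [] := @dominated_convergence _ _ _ mu setT measurableT
  (fun N X => (v X * series (zterm (u X)) N)%:E)
  (fun X => (v X * zsum (u X))%:E) (fun X => (C * 3 ^+ n * `|v X|)%:E).
- move=> N; apply/measurable_EFinP/measurable_funM => //.
  exact: L1_measurable.
- by apply/measurable_EFinP/measurable_funM => //; exact: L1_measurable.
- apply: aeW => X _; apply/cvg_EFin; first by near=> N.
  by apply: cvgMr; exact: cvg_zsum (uC X).
- exact: v1C.
- apply: aeW => X N _; rewrite /= lee_fin normrM mulrC ler_wpM2r//.
- move=> iz _ cz; apply/esym/zsum_uniq.
  have L1ser N : L1 (fun X => v X * series (zterm (u X)) N).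
    exact: L1_mul v1 (mser N) (sB ^~ N).
  have L1z : L1 (fun X => v X * zsum (u X)).
    exact: L1_mul v1 mz (fun X => zsum_norm_le (uC X)).
  rewrite (_ : series _ = (fun N => tint (fun X => v X * series (zterm (u X)) N))).
    rewrite /tint /Rintegral; apply: fine_cvg.
    rewrite fineK; first exact: cz.
    exact: integrable_fin_num.
  apply/funext => N; rewrite /series/=.
  under [in RHS]eq_tint do rewrite big_distrr/=.
  rewrite tint_sum; last first.
    by move=> j; exact: L1_mul v1 (mzt j) (uB ^~ j).
  apply: eq_bigr => j _; rewrite /zterm; case: pickle_inv => //=.
  by rewrite -[LHS](mul0r (V)) -tint_cst; apply: eq_tint => X; rewrite mulr0.
Unshelve. all: by end_near. Qed.

(** Unnormalised real Fourier coefficients. By [ftE] the phases 0 and [- (pi / 2)] determine all the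
    others, but estimates are stated for every phase at once. *)
Definition ft v k t : R := tint (fun X => v X * wave k t (repr X)).

Lemma ft_integrand v k t : L1 v -> L1 (fun X => v X * wave k t (repr X)).
Proof.
move=> v1; apply: (L1_mul v1 (C := 1)); first exact: (@measurable_wave R n k t).
by move=> X; exact: wave_le1.
Qed.

Lemma ft_le v k t : L1 v -> `|ft v k t| <= tint (fun X => `|v X|).
Proof.
move=> v1; rewrite -[leRHS]mul1r; apply: tint_mul_le => //.
  exact: (@measurable_wave R n k t).
by move=> X; exact: wave_le1.
Qed.

Lemma ftD v g k t : L1 v -> L1 g ->
  ft (fun X => v X + g X) k t = ft v k t + ft g k t.
Proof.
move=> v1 g1; rewrite /ft -tintD; [|exact: ft_integrand|exact: ft_integrand].
by apply: eq_tint => X; rewrite mulrDl.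
Qed.

Lemma ftB v g k t : L1 v -> L1 g ->
  ft (fun X => v X - g X) k t = ft v k t - ft g k t.
Proof.
move=> v1 g1; rewrite /ft -tintB; [|exact: ft_integrand|exact: ft_integrand].
by apply: eq_tint => X; rewrite mulrBl.
Qed.

Lemma ftZ c v k t : L1 v -> ft (fun X => c * v X) k t = c * ft v k t.
Proof.
move=> v1; rewrite /ft -tintZ; last exact: ft_integrand.
by apply: eq_tint => X; rewrite mulrA.
Qed.

Lemma ft_wave l s k t : ft (wave l s \o repr) k t =
  2^-1 * ((if l == - k then V * cos (s + t) else 0) +
          (if l == k then V * cos (s - t) else 0)).
Proof.
rewrite /ft; under eq_tint do rewrite /= waveM.
have w k' t' : L1 (wave k' t' \o repr).
  apply: (@L1_bounded _ 1) => [|X]; first exact: measurable_wave.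
  exact: wave_le1.
rewrite tintZ; last exact: L1D (w (l + k) (s + t)) (w (l - k) (s - t)).
congr (_ * _); rewrite (tintD (w (l + k) (s + t)) (w (l - k) (s - t))).
by rewrite /tint/= !Rintegral_wave addr_eq0 subr_eq0.
Qed.

Lemma ftE v k t : L1 v ->
  ft v k t = cos t * ft v k 0 - sin t * ft v k (- (pi / 2)).
Proof.
move=> v1; rewrite /ft -!tintZ; [|exact: ft_integrand|exact: ft_integrand].
rewrite -tintB; [|exact/L1Z/ft_integrand|exact/L1Z/ft_integrand].
apply: eq_tint => X; rewrite /wave cosD cosBpihalf addr0; ring.
Qed.

Lemma ftN v k t : ft v (- k) (- t) = ft v k t.
Proof. by apply: eq_tint => X; rewrite waveN. Qed.

Lemma ftBpi v k t : L1 v -> ft v k (t - pi) = - ft v k t.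
Proof.
move=> v1; rewrite -[RHS]mulN1r -ftZ//; apply: eq_tint => X.
by rewrite /wave addrA cosB cospi sinpi; ring.
Qed.

(* The convolution of [v] with the wave of frequency [k]. *)
Definition dwave v k (x : 'rV[R]_n) : R := ft v k (- freq_dot k x).

Lemma dwaveE v k x : L1 v -> dwave v k x =
  ft v k 0 * wave k 0 x + ft v k (- (pi / 2)) * wave k (- (pi / 2)) x.
Proof.
by move=> v1; rewrite /dwave ftE// /wave cosN sinN cosBpihalf addr0; ring.
Qed.

Lemma dwave_le v k x : L1 v -> `|dwave v k x| <= tint (fun X => `|v X|).
Proof. exact: ft_le. Qed.

Lemma dwave_periodic v k : L1 v -> periodic_rV (dwave v k).
Proof. by move=> v1 x y xy; rewrite !dwaveE// !(wave_periodic _ _ xy). Qed.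

Lemma continuous_dwave v k : L1 v -> continuous (dwave v k).
Proof.
move=> v1; have -> : dwave v k = fun x =>
    ft v k 0 * wave k 0 x + ft v k (- (pi / 2)) * wave k (- (pi / 2)) x.
  by apply/funext => x; exact: dwaveE.
move=> x; apply: (@cvgD _ _ _ (nbhs x)); apply: cvgMr; exact: continuous_wave.
Qed.

Lemma measurable_dwave v k : L1 v -> measurable_fun setT (dwave v k \o @repr _ T).
Proof.
move=> v1; apply: measurable_torus_continuous; apply: continuous_torus.
  exact: continuous_dwave.
exact: dwave_periodic.
Qed.

(** The frequencies [k] and [- k] label the same real wave, hence the two indicators; at [l = 0]
    they coincide and turn [V / 2] into [V]. *)
Lemma ft_dwave v k l t : L1 v -> ft (dwave v k \o repr) l t =
  V / 2 * ft v l t * ((k == l)%:R + (k == - l)%:R).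
Proof.
move=> v1.
have w k' t' : L1 (wave k' t' \o repr).
  apply: (@L1_bounded _ 1) => [|X]; first exact: measurable_wave.
  exact: wave_le1.
have -> : ft (dwave v k \o repr) l t =
    ft (fun X => ft v k 0 * (wave k 0 \o repr) X +
      ft v k (- (pi / 2)) * (wave k (- (pi / 2)) \o repr) X) l t.
  by apply: eq_tint => X /=; rewrite dwaveE.
rewrite ftD; [|exact/L1Z|exact/L1Z].
rewrite !ftZ// !ft_wave [ft v l t]ftE// add0r sub0r cosN.
have -> : - (pi / 2) + t = t - pi / 2 by ring.
have -> : - (pi / 2) - t = - (t + pi / 2) by ring.
rewrite cosN cosBpihalf cosDpihalf.
have b2 : k = l -> ft v k 0 * cos t - ft v k (- (pi / 2)) * sin t =
    cos t * ft v l 0 - sin t * ft v l (- (pi / 2)) by move=> ->; ring.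
have b1 : k = - l -> ft v k 0 * cos t + ft v k (- (pi / 2)) * sin t =
    cos t * ft v l 0 - sin t * ft v l (- (pi / 2)).
  move=> ->; rewrite ftN; have -> : ft v (- l) 0 = ft v l 0.
    by rewrite -{1}oppr0 ftN.
  have -> : ft v l (- (pi / 2)) = - ft v l (pi / 2).
    by rewrite -ftBpi//; congr ft; field.
  ring.
set A := ft v k 0 in b1 b2 *; set B := ft v k (- (pi / 2)) in b1 b2 *.
case: (eqVneq k (- l)) => [/b1 {}b1|_]; case: (eqVneq k l) => [/b2 {}b2|_] /=.
- transitivity (V / 2 * ((A * cos t + B * sin t) + (A * cos t - B * sin t))).
    by field.
  by rewrite b1 b2; field.
- by rewrite -b1; field.
- by rewrite -b2; field.
- by field.
Qed.

End fourier.

(** * Fourier inversion for rapidly approximable functions *)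

Section jackson.
Context (R : realType) (n : nat).
Local Notation Z := 'rV[int]_n.
Local Notation T := (torus R n).
Local Notation W := 'rV[R]_n.
Local Notation V := ((2 * pi : R) ^+ n).
Implicit Types (k l : Z) (t : R) (x y : W) (P Q f g : W -> R) (C D : R).

Lemma continuous_rVP f : continuous f <->
  forall x e, 0 < e -> \forall y \near x, `|f x - f y| <= e.
Proof.
split=> [cf x e e0|h x].
  by have /(@cvgrPdist_le _ _ _ (nbhs x) _ f)/(_ _ e0) := cf x.
by apply/(@cvgrPdist_le _ _ _ (nbhs x) _ f) => e e0; exact: h.
Qed.

(** The degree is strictly below [d]: [tpoly 0] contains only the zero function, so the case [d = 0]
    of an approximation estimate is a sup bound. *)
Inductive tpoly (d : nat) : (W -> R) -> Prop :=
| tpoly0 : tpoly d (fun=> 0)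
| tpoly_wave k t : (l1deg k < d)%N -> tpoly d (wave k t)
| tpolyD P Q : tpoly d P -> tpoly d Q -> tpoly d (fun x => P x + Q x)
| tpolyZ c P : tpoly d P -> tpoly d (fun x => c * P x).

Lemma tpoly_ext d P Q : (forall x, P x = Q x) -> tpoly d P -> tpoly d Q.
Proof. by move=> /funext ->. Qed.

Lemma tpolyW d e P : (d <= e)%N -> tpoly d P -> tpoly e P.
Proof.
move=> de; elim=> [|k t kd|P1 P2 _ h1 _ h2|c P1 _ h].
- exact: tpoly0.
- exact/tpoly_wave/(leq_trans kd).
- exact: tpolyD.
- exact: tpolyZ.
Qed.

Lemma tpoly_deg0 P : tpoly 0 P -> forall x, P x = 0.
Proof.
elim=> [//|//|P1 P2 _ h1 _ h2 x|c P1 _ h x]; first by rewrite h1 h2 addr0.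
by rewrite h mulr0.
Qed.

Lemma tpolyM d e P Q : tpoly d P -> tpoly e Q ->
  tpoly (d + e) (fun x => P x * Q x).
Proof.
move=> + tQ; elim=> [|k t kd|P1 P2 _ h1 _ h2|c P1 _ h].
- by apply: tpoly_ext (tpoly0 _) => x; rewrite mul0r.
- elim: tQ => [|l s le|Q1 Q2 _ h1 _ h2|c Q1 _ h].
  + by apply: tpoly_ext (tpoly0 _) => x; rewrite mulr0.
  + apply: (@tpoly_ext _ (fun x => 2^-1 * (wave (k + l) (t + s) x
        + wave (k - l) (t - s) x))); first by move=> x; rewrite waveM.
    have := l1degD k l; have := l1degD k (- l); rewrite l1degN => h1 h2.
    by apply/tpolyZ/tpolyD; apply: tpoly_wave; lia.
  + by apply: tpoly_ext (tpolyD h1 h2) => x; rewrite mulrDr.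
  + by apply: tpoly_ext (tpolyZ c h) => x; rewrite mulrCA.
- by apply: tpoly_ext (tpolyD h1 h2) => x; rewrite mulrDl.
- by apply: tpoly_ext (tpolyZ c h) => x; rewrite mulrA.
Qed.

Lemma tpoly_cst c : tpoly 1 (fun=> c).
Proof.
apply: (@tpoly_ext _ (fun x => c * wave 0 0 x)).
  by move=> x; rewrite wave0 cos0 mulr1.
by apply/tpolyZ/tpoly_wave; rewrite l1deg0.
Qed.

Lemma tpolyX d P m : tpoly d P -> tpoly (d * m).+1 (fun x => P x ^+ m).
Proof.
move=> tP; elim: m => [|m IH].
  by rewrite muln0; apply: tpoly_ext (tpoly_cst 1) => x; rewrite expr0.
rewrite mulnS -addnS; apply: tpoly_ext (tpolyM tP IH) => x.
by rewrite exprS.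
Qed.

Lemma tpoly_sum d I (s : seq I) (P : I -> W -> R) :
  (forall i, tpoly d (P i)) -> tpoly d (fun x => \sum_(i <- s) P i x).
Proof.
move=> tP; elim: s => [|i s IH].
  by apply: tpoly_ext (tpoly0 _) => x; rewrite big_nil.
by apply: tpoly_ext (tpolyD (tP i) IH) => x; rewrite big_cons.
Qed.

Lemma tpoly_shift d P y : tpoly d P -> tpoly d (fun x => P (x - y)).
Proof.
elim=> [|k t kd|P1 P2 _ h1 _ h2|c P1 _ h].
- exact: tpoly0.
- apply: (@tpoly_ext _ (wave k (t + freq_dot k (- y)))).
    by move=> x; rewrite waveD.
  exact: tpoly_wave.
- exact: tpolyD.
- exact: tpolyZ.
Qed.

Lemma tpoly_continuous d P : tpoly d P -> continuous P.
Proof.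
elim=> [|k t kd|P1 P2 _ h1 _ h2|c P1 _ h].
- exact: cst_continuous.
- exact: continuous_wave.
- by move=> x; apply: (@cvgD _ _ _ (nbhs x)); [exact: h1|exact: h2].
- by move=> x; apply: (@cvgMr _ _ (nbhs x)); exact: h.
Qed.

Lemma tpoly_periodic d P : tpoly d P -> periodic_rV P.
Proof.
elim=> [|k t kd|P1 P2 _ h1 _ h2|c P1 _ h] x y xy //.
- exact: wave_periodic.
- by rewrite (h1 _ _ xy) (h2 _ _ xy).
- by rewrite (h _ _ xy).
Qed.

Lemma tpoly_bounded d P : tpoly d P -> exists C, forall x, `|P x| <= C.
Proof.
elim=> [|k t kd|P1 P2 _ [C1 h1] _ [C2 h2]|c P1 _ [C h]].
- by exists 0 => x; rewrite normr0.
- by exists 1 => x; exact: wave_le1.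
- by exists (C1 + C2) => x; apply: le_trans (ler_normD _ _) _; exact: lerD.
- by exists (`|c| * C) => x; rewrite normrM ler_wpM2l.
Qed.

Lemma L1_periodic f C : continuous f -> periodic_rV f ->
  (forall x, `|f x| <= C) -> L1 (f \o @repr _ T).
Proof.
move=> cf pf bf; apply: (@L1_bounded _ _ _ C) => [|X]; last exact: bf.
by apply: measurable_torus_continuous; exact: continuous_torus.
Qed.

Lemma tpoly_L1 d P : tpoly d P -> L1 (P \o @repr _ T).
Proof.
move=> tP; have [C bP] := tpoly_bounded tP.
by apply: L1_periodic bP; [exact: tpoly_continuous tP|exact: tpoly_periodic tP].
Qed.

Lemma ft_tpoly_eq0 d P k t : tpoly d P -> (d <= l1deg k)%N ->
  ft (P \o @repr _ T) k t = 0.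
Proof.
move=> tP dk; elim: tP => [|l s ld|P1 P2 t1 h1 t2 h2|c P1 t1 h].
- rewrite /ft -[RHS](mul0r V) -tint_cst; apply: eq_tint => X.
  by rewrite /= mul0r.
- rewrite ft_wave ifF ?ifF ?addr0 ?mulr0//; apply/eqP => e; move: ld; rewrite e.
    by lia.
  by rewrite l1degN; lia.
- by have := ftD k t (tpoly_L1 t1) (tpoly_L1 t2); rewrite h1 h2 addr0.
- by have := ftZ c k t (tpoly_L1 t1); rewrite h mulr0.
Qed.

(** Smoothness of order [m] in the sense of Jackson's theorem on polynomial approximation. *)
Definition jackson (m : nat) f (C : R) : Prop :=
  forall d, exists2 P, tpoly d P & forall x, `|f x - P x| <= C / d.+1%:R ^+ m.

Lemma jackson_bounded m f C : jackson m f C -> forall x, `|f x| <= C.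
Proof.
move=> /(_ 0%N) [P tP h] x.
by have := h x; rewrite (tpoly_deg0 tP) subr0 expr1n divr1.
Qed.

Lemma jackson_ge0 m f C : jackson m f C -> 0 <= C.
Proof. by move=> /jackson_bounded/(_ 0); exact: le_trans. Qed.

Lemma jackson_leq m m' f C : (m <= m')%N -> jackson m' f C -> jackson m f C.
Proof.
move=> mm jf d; have [P tP h] := jf d; exists P => // x.
apply: le_trans (h x) _; rewrite ler_wpM2l ?(jackson_ge0 jf)//.
by rewrite lef_pV2 ?posrE ?exprn_gt0// ler_weXn2l// ler1n.
Qed.

Lemma jacksonD m f g C D : jackson m f C -> jackson m g D ->
  jackson m (fun x => f x + g x) (C + D).
Proof.
move=> jf jg d; have [P tP hP] := jf d; have [Q tQ hQ] := jg d.
exists (fun x => P x + Q x) => [|x]; first exact: tpolyD.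
rewrite opprD addrACA mulrDl; apply: le_trans (ler_normD _ _) _; exact: lerD.
Qed.

Lemma jackson_sum m I (s : seq I) (f : I -> W -> R) :
  (forall i, exists C, jackson m (f i) C) ->
  exists C, jackson m (fun x => \sum_(i <- s) f i x) C.
Proof.
move=> jf; elim: s => [|i s [C IH]].
  exists 0 => d; exists (fun=> 0) => [|x]; first exact: tpoly0.
  by rewrite big_nil subrr normr0 mul0r.
have [D jD] := jf i; exists (D + C).
rewrite (_ : (fun x => _) = (fun x => f i x + \sum_(j <- s) f j x)).
  exact: jacksonD.
by apply/funext => x; rewrite big_cons.
Qed.

(** Approximants of half the degree are multiplied, which costs [2 ^+ m] in each error. The error of
    [f] contributes [C D]; the error of [g] is multiplied by [P], with [|P| <= 2 C], and contributes
    [2 C D]. *)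
Lemma jacksonM m f g C D : jackson m f C -> jackson m g D ->
  jackson m (fun x => f x * g x) (3 * 2 ^+ m * C * D).
Proof.
move=> jf jg d; have [P tP hP] := jf d./2; have [Q tQ hQ] := jg d./2.
exists (fun x => P x * Q x) => [|x].
  by apply: tpolyW (tpolyM tP tQ); rewrite addnn; have := odd_double_half d; lia.
have C0 := jackson_ge0 jf; have D0 := jackson_ge0 jg.
set e := (d./2.+1%:R ^+ m)^-1 in hP hQ.
have e0 : 0 <= e by rewrite invr_ge0 exprn_ge0.
have e1 : e <= 1 by rewrite invf_le1 ?exprn_gt0// exprn_ege1// ler1n.
have bP : `|P x| <= 2 * C.
  have := jackson_bounded jf x; have := hP x.
  have : C * e <= C by rewrite ler_piMr.
  by rewrite !ler_norml => ? /andP[? ?] /andP[? ?]; apply/andP; split; lra.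
have -> : f x * g x - P x * Q x = (f x - P x) * g x + P x * (g x - Q x) by ring.
apply: (@le_trans _ _ (C * e * D + 2 * C * (D * e))).
  apply: le_trans (ler_normD _ _) _; rewrite !normrM; apply: lerD.
    by apply: ler_pM => //; exact: jackson_bounded jg x.
  exact: ler_pM.
have -> : C * e * D + 2 * C * (D * e) = 3 * C * D * e by ring.
have -> : 3 * 2 ^+ m * C * D / d.+1%:R ^+ m =
  3 * C * D * (2 ^+ m / d.+1%:R ^+ m) by ring.
rewrite ler_wpM2l ?mulr_ge0// -exprVn -exprMn /e -exprVn.
rewrite lerXn2r ?nnegrE ?divr_ge0//.
rewrite ler_pdivlMr// mulrC ler_pdivrMr// -natrM ler_nat.
by have := odd_double_half d; lia.
Qed.

Lemma jackson_prod m I (s : seq I) (f : I -> W -> R) :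
  (forall i, exists C, jackson m (f i) C) ->
  exists C, jackson m (fun x => \prod_(i <- s) f i x) C.
Proof.
move=> jf; elim: s => [|i s [C IH]].
  (* The constant 1 is not of degree below 0, so the approximant of the empty product is 0 when
     [d = 0]. *)
  exists 1 => d; exists (fun=> (0 < d)%:R) => [|x].
    case: d => [|d]; first exact: tpoly0.
    exact: tpolyW (tpoly_cst _).
  rewrite big_nil; case: d => [|d]; first by rewrite subr0 normr1 expr1n divr1.
  by rewrite subrr normr0 divr_ge0// exprn_ge0.
have [D jD] := jf i; exists (3 * 2 ^+ m * D * C).
rewrite (_ : (fun x => _) = (fun x => f i x * \prod_(j <- s) f j x)).
  exact: jacksonM.
by apply/funext => x; rewrite big_cons.
Qed.

Lemma jackson_shift m f C y : jackson m f C -> jackson m (fun x => f (x - y)) C.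
Proof.
move=> jf d; have [P tP hP] := jf d; exists (fun x => P (x - y)) => [|x].
  exact: tpoly_shift.
exact: hP.
Qed.

Lemma jackson_approx f C : jackson 1 f C -> forall e, 0 < e ->
  exists2 P, (exists d, tpoly d P) & forall x, `|f x - P x| <= e.
Proof.
move=> jf e e0; have C0 := jackson_ge0 jf.
have [P tP h] := jf (Num.truncn (C / e)).
exists P => [|y]; first by eexists; exact: tP.
apply: le_trans (h y) _; rewrite expr1 ler_pdivrMr// mulrC -ler_pdivrMr//.
exact/ltW/truncnS_gt.
Qed.

Lemma jackson_continuous m f C : jackson m.+1 f C -> continuous f.
Proof.
move=> /(@jackson_leq 1 m.+1 _ _ isT) jf.
apply/continuous_rVP => x e e0.
have e3 : 0 < e / 3 by rewrite divr_gt0.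
have [P [d tP] hP] := jackson_approx jf e3.
have /continuous_rVP/(_ x _ e3) := tpoly_continuous tP.
apply: filterS => y; have := hP x; have := hP y; rewrite !ler_norml.
by move=> /andP[? ?] /andP[? ?] /andP[? ?]; apply/andP; split; lra.
Qed.

Lemma jackson_periodic m f C : jackson m.+1 f C -> periodic_rV f.
Proof.
move=> /(@jackson_leq 1 m.+1 _ _ isT) jf x y xy; apply/eqP.
rewrite -subr_eq0 -normr_le0; apply/ler_addgt0Pr => e e0.
have e3 : 0 < e / 3 by rewrite divr_gt0.
have [P [d tP] hP] := jackson_approx jf e3; rewrite add0r.
have := hP x; have := hP y; rewrite (tpoly_periodic tP xy) !ler_norml.
by move=> /andP[? ?] /andP[? ?]; apply/andP; split; lra.
Qed.

Lemma jackson_L1 m f C : jackson m.+1 f C -> L1 (f \o @repr _ T).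
Proof.
move=> jf; apply: L1_periodic (jackson_bounded jf).
  exact: jackson_continuous jf.
exact: jackson_periodic jf.
Qed.

Lemma jackson_measurable m f C : jackson m.+1 f C ->
  measurable_fun setT (f \o @repr _ T).
Proof. by move=> /jackson_L1/L1_measurable. Qed.

(** The approximant of degree below [l1deg k] has no component at [k]; subtracting it leaves only
    the approximation error. *)
Lemma ft_jackson m f C k t : jackson m.+1 f C ->
  `|ft (f \o @repr _ T) k t| <= V * C / jp R k ^+ m.+1.
Proof.
move=> jf; have [P tP hP] := jf (l1deg k).
have -> : ft (f \o @repr _ T) k t =
    ft (fun X => (f \o repr) X - (P \o @repr _ T) X) k t.
  rewrite ftB ?(ft_tpoly_eq0 _ tP) ?subr0//; first exact: jackson_L1 jf.
  exact: tpoly_L1 tP.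
have L1fP : L1 (fun X => (f \o repr) X - (P \o @repr _ T) X).
  by apply: L1B; [exact: jackson_L1 jf|exact: tpoly_L1 tP].
apply: le_trans (ft_le _ _ L1fP) _.
rewrite -mulrA mulrC -tint_cst; apply: ler_tint; first exact: L1_norm.
  by apply: L1_bounded => [|X]; [exact: measurable_cst|exact: lexx].
by move=> X; exact: hP.
Qed.

Definition decay (v : T -> R) C : Prop := forall k t, `|ft v k t| <= C * wt R k.

Definition synth (v : T -> R) x : R := V^-1 * zsum (fun k => dwave v k x).

Lemma zdom_dwave v C x : decay v C -> zdom (fun k => dwave v k x) C.
Proof. by move=> vC k; exact: vC. Qed.

Lemma zsum_delta (l : Z) (u : Z -> R) : zsum (fun k => if k == l then u k else 0) = u l.
Proof.
rewrite (@zsum_seq _ _ [:: l])// ?big_seq1 ?eqxx// => k.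
by rewrite inE => /negbTE ->.
Qed.

Lemma zdom_delta (l : Z) (u : Z -> R) :
  zdom (fun k => if k == l then u k else 0) (`|u l| / wt R l).
Proof.
move=> k; case: eqP => [->|_]; first by rewrite divfK// gt_eqF// wt_gt0.
by rewrite normr0 mulr_ge0 ?divr_ge0// ltW// wt_gt0.
Qed.

Lemma zsum_delta2 (l : Z) (c c' : R) :
  zsum (fun k => (if k == l then c else 0) + (if k == - l then c' else 0)) = c + c'.
Proof.
rewrite (zsumD (zdom_delta l (fun=> c)) (zdom_delta (- l) (fun=> c'))).
by rewrite (zsum_delta l (fun=> c)) (zsum_delta (- l) (fun=> c')).
Qed.

Lemma decay_tpoly d P : tpoly d P -> exists C, decay (P \o @repr _ T) C.
Proof.
move=> tP; set M := tint (fun X : T => `|(P \o repr) X|).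
have M0 : 0 <= M by exact: tint_ge0.
exists (M * d.+1%:R ^+ (2 * n)) => k t.
have [dk|kd] := leqP d (l1deg k).
  by rewrite (ft_tpoly_eq0 _ tP dk) normr0 mulr_ge0 ?mulr_ge0 ?exprn_ge0// ltW// wt_gt0.
apply: le_trans (ft_le _ _ (tpoly_L1 tP)) _; rewrite -mulrA ler_peMr//.
rewrite /wt ler_pdivlMr ?exprn_gt0 ?jp_gt0// mul1r.
by rewrite lerXn2r ?nnegrE ?ler0n// ler_nat; lia.
Qed.

Lemma synth_tpoly d P x : tpoly d P -> synth (P \o @repr _ T) x = P x.
Proof.
elim=> [|l s ld|P1 P2 t1 h1 t2 h2|c P1 t1 h].
- rewrite /synth (zsum_ext (v := fun=> 0)) => [|k].
    by rewrite (@zsum_seq _ _ [::])// big_nil mulr0.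
  exact: ft_tpoly_eq0 (tpoly0 0) _.
- rewrite /synth (zsum_ext (v := fun k =>
      (if k == l then V / 2 * wave l s x else 0) +
      (if k == - l then V / 2 * wave l s x else 0))) => [|k].
    by rewrite zsum_delta2; field; rewrite gt_eqF// volume_gt0.
  rewrite /dwave ft_wave [l == k]eq_sym [l == - k]eq_sym eqr_oppLR addrC mulrDr.
  congr (_ + _); case: eqP => [->|_]; rewrite ?mulr0// /wave.
    by rewrite opprK [s + _]addrC; field.
  by rewrite freq_dotNl opprK [s + _]addrC; field.
- have [C1 d1] := decay_tpoly t1; have [C2 d2] := decay_tpoly t2.
  rewrite -h1 -h2 /synth -mulrDr -(zsumD (zdom_dwave x d1) (zdom_dwave x d2)).
  congr (_ * _); apply: zsum_ext => k.
  exact: ftD (tpoly_L1 t1) (tpoly_L1 t2).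
- have [C1 d1] := decay_tpoly t1.
  rewrite -h /synth mulrCA -(zsumZ _ (zdom_dwave x d1)).
  congr (_ * _); apply: zsum_ext => k.
  exact: ftZ (tpoly_L1 t1).
Qed.

Lemma decay_jackson f C : jackson (2 * n).+1 f C -> decay (f \o @repr _ T) (V * C).
Proof.
move=> jf k t; apply: le_trans (ft_jackson _ _ jf) _.
rewrite ler_wpM2l ?mulr_ge0 ?(jackson_ge0 jf) ?(ltW (volume_gt0 R n))//.
rewrite /wt lef_pV2 ?posrE ?exprn_gt0 ?jp_gt0// exprS ler_peMl ?jp_ge1//.
by rewrite exprn_ge0 ?(ltW (jp_gt0 _ _)).
Qed.

(** Inversion is exact on polynomials ([synth_tpoly]), so only [f - P] and its synthesis remain, and
    both are of size [1 / (d + 1)]. *)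
Lemma jackson_inversion f C x : jackson (2 * n).+1 f C ->
  f x = synth (f \o @repr _ T) x.
Proof.
move=> jf; have V0 := volume_gt0 R n; have C0 := jackson_ge0 jf.
apply/eqP; rewrite -subr_eq0 -normr_le0; apply/ler_addgt0Pr => e e0; rewrite add0r.
pose B := C * (1 + 3 ^+ n).
have B0 : 0 <= B by rewrite mulr_ge0// addr_ge0// exprn_ge0.
pose d := Num.truncn (B / e).
have Bd : B / d.+1%:R <= e.
  by rewrite ler_pdivrMr// mulrC -ler_pdivrMr//; exact/ltW/truncnS_gt.
apply: le_trans Bd; have [P tP hP] := jf d.
have [D dP] := decay_tpoly tP; have df := decay_jackson jf.
have L1fP : L1 (fun X => (f \o repr) X - (P \o @repr _ T) X).
  by apply: L1B; [exact: jackson_L1 jf|exact: tpoly_L1 tP].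
have cd : C / d.+1%:R ^+ (2 * n).+1 <= C / d.+1%:R.
  rewrite ler_wpM2l// lef_pV2 ?posrE ?exprn_gt0// exprS ler_peMr// exprn_ege1//.
  by rewrite ler1n.
(* Of the [2 n + 1] powers, one is kept as [1 / (d + 1)] and the others pay for [wt]. At high
   frequencies they come from the decay of [f] alone, at low ones from the uniform error, as
   [jp k <= d + 1] there. *)
have key : zdom (fun k => dwave (f \o @repr _ T) k x - dwave (P \o @repr _ T) k x)
    (V * (C / d.+1%:R)).
  move=> k; have [dk|kd] := leqP d (l1deg k).
    rewrite [X in _ - X](ft_tpoly_eq0 _ tP dk) subr0.
    apply: le_trans (ft_jackson _ _ jf) _; rewrite exprS -!mulrA.
    rewrite ler_wpM2l ?(ltW V0)// ler_wpM2l// invfM ler_wpM2r//.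
      exact/ltW/wt_gt0.
    by rewrite lef_pV2 ?posrE ?jp_gt0// ler_nat; lia.
  rewrite /dwave -ftB; [|exact: jackson_L1 jf|exact: tpoly_L1 tP].
  apply: le_trans (ft_le _ _ L1fP) _.
  apply: (@le_trans _ _ (V * (C / d.+1%:R ^+ (2 * n).+1))).
    rewrite mulrC -tint_cst; apply: ler_tint; first exact: L1_norm.
      by apply: L1_bounded => [|X]; [exact: measurable_cst|exact: lexx].
    by move=> X; exact: hP.
  rewrite -mulrA ler_wpM2l ?(ltW V0)// exprS invfM mulrA ler_wpM2l ?divr_ge0//.
  rewrite /wt lef_pV2 ?posrE ?exprn_gt0 ?jp_gt0//.
  by rewrite lerXn2r ?nnegrE ?ler0n// ler_nat; lia.
have -> : f x - synth (f \o @repr _ T) x = (f x - P x) -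
    V^-1 * zsum (fun k => dwave (f \o @repr _ T) k x - dwave (P \o @repr _ T) k x).
  rewrite (zsumB (zdom_dwave x df) (zdom_dwave x dP)) mulrBr -!/(synth _ _).
  by rewrite (synth_tpoly x tP); ring.
have -> : B / d.+1%:R = C / d.+1%:R + C / d.+1%:R * 3 ^+ n by rewrite /B; ring.
apply: le_trans (ler_normB _ _) _.
apply: lerD; first exact: le_trans (hP x) cd.
rewrite normrM gtr0_norm ?invr_gt0// mulrC ler_pdivrMr//.
apply: le_trans (zsum_norm_le key) _; rewrite le_eqVlt; apply/orP; left.
by apply/eqP; ring.
Qed.

Lemma synth_continuous v C : L1 v -> decay v C -> continuous (synth v).
Proof.
move=> v1 vC x; apply: (@cvgMr _ _ (nbhs x)).
apply: (@zsum_dominated_cvg R n _ (nbhs x) _ _ _ C).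
  by near=> y; exact: zdom_dwave.
by move=> k; exact: continuous_dwave.
Unshelve. all: by end_near. Qed.

Lemma synth_periodic v : L1 v -> periodic_rV (synth v).
Proof.
move=> v1 x y xy; rewrite /synth; congr (_ * _); apply: zsum_ext => k.
exact: dwave_periodic.
Qed.

Lemma synth_le v C x : decay v C -> `|synth v x| <= V^-1 * (C * 3 ^+ n).
Proof.
move=> vC; rewrite normrM gtr0_norm ?invr_gt0 ?volume_gt0//.
by rewrite ler_wpM2l ?invr_ge0 ?(ltW (volume_gt0 _ _))// (zsum_norm_le (zdom_dwave x vC)).
Qed.

(** Termwise integration: by [ft_dwave] only the terms [k = l] and [k = - l] survive, each giving
    one half. *)
Lemma ft_synth v C l t : L1 v -> decay v C ->
  ft (synth v \o @repr _ T) l t = ft v l t.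
Proof.
move=> v1 vC; have V0 := volume_gt0 R n.
pose w (X : T) := V^-1 * wave l t (repr X).
have mw : measurable_fun setT (wave l t \o @repr _ T) by exact: measurable_wave.
have w1 : L1 (wave l t \o @repr _ T).
  by apply: (@L1_bounded _ _ _ 1) => // X; exact: wave_le1.
transitivity (tint (fun X => w X * zsum (fun k => dwave v k (repr X)))).
  by apply: eq_tint => X; rewrite /w /synth /=; ring.
rewrite (tint_zsum (C := C)); last 2 first.
- by move=> k; exact: measurable_dwave.
- by move=> X; exact: zdom_dwave.
- rewrite (zsum_ext (v := fun k => (if k == l then ft v l t / 2 else 0) +
      (if k == - l then ft v l t / 2 else 0))) => [|k].
    by rewrite zsum_delta2; field.
  transitivity (V^-1 * ft (dwave v k \o @repr _ T) l t).
    rewrite -tintZ; first by apply: eq_tint => X; rewrite /w /=; ring.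
    apply: (L1_mul (C := 1)); last by move=> X; exact: wave_le1.
      apply: (@L1_bounded _ _ _ (tint (fun X => `|v X|))) => [|X].
        exact: measurable_dwave.
      exact: dwave_le.
    exact: measurable_wave.
  rewrite ft_dwave//; case: (k == l); case: (k == - l) => /=; by field; rewrite gt_eqF.
- exact: L1Z w1.
Qed.

End jackson.

(** * Uniqueness of Fourier coefficients *)

Section boxes.
Context (R : realType) (n : nat).
Local Notation T := (torus R n).
Local Notation W := 'rV[R]_n.

(** [1 - cos] behaves like the squared distance to the multiples of the period, so membership does
    not depend on the representative of a torus point. *)
Definition near_box (a : W) (d : R) : set W :=
  [set x | forall i, 1 - cos (x 0 i - a 0 i) <= d].

(** [1 - cos a] is twice the square of [sin (a / 2)]; like any squared distance it satisfies a
    triangle inequality with factor 2. *)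
Lemma cosD_quasi (a b : R) :
  1 - cos (a + b) <= 2 * (1 - cos a) + 2 * (1 - cos b).
Proof.
have ca := cos2Dsin2 a; have cb := cos2Dsin2 b; rewrite cosD.
have h : (1 - cos a) * (1 - cos b) >= 0.
  by rewrite mulr_ge0// subr_ge0 cos_le1.
have := sqr_ge0 (sin a - sin b); have := cos_le1 a; have := cos_le1 b.
nra.
Qed.

Lemma near_box_trans (a b x : W) (d e : R) :
  near_box a d b -> near_box b e x -> near_box a (2 * d + 2 * e) x.
Proof.
move=> ab bx i.
have -> : x 0 i - a 0 i = (b 0 i - a 0 i) + (x 0 i - b 0 i) by ring.
apply: le_trans (cosD_quasi _ _) _; by apply: lerD; rewrite ler_wpM2l//.
Qed.

Lemma lattice_reduce (x : W) : exists2 y : W, torus_lattice (x - y) &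
  forall i, - pi <= y 0 i <= pi.
Proof.
have pi0 := pi_gt0 R.
pose k i : int := Num.floor ((x 0 i + pi) / (2 * pi)).
exists (x - \row_i (2 * pi * (k i)%:~R)).
  apply/asboolP; exists (\row_i k i); apply/rowP => i.
  by rewrite subKr !mxE.
move=> i; rewrite !mxE /k; have := floor_itv ((x 0 i + pi) / (2 * pi)).
set m := Num.floor _; rewrite ler_pdivlMr ?ltr_pdivrMr; lra.
Qed.

Lemma cos_close (e : R) : 0 < e -> exists2 d : R, 0 < d &
  forall t, `|t| <= pi -> 1 - cos t <= d -> `|t| < e.
Proof.
move=> e0; have pi0 := pi_gt0 R; pose r := Num.min e (pi / 2).
have r0 : 0 < r by rewrite lt_min e0/=; lra.
have rpi : r <= pi by rewrite ge_min; apply/orP; right; lra.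
have rcos : cos r < 1.
  rewrite -cos0 ltr_cos ?in_itv//= ?lexx ?(ltW r0) ?rpi//=; exact: ltW.
exists ((1 - cos r) / 2) => [|t tpi ct]; first by lra.
rewrite ltNge; apply/negP => et.
have : cos `|t| <= cos r.
  rewrite leNgt ltr_cos ?in_itv/= ?normr_ge0 ?tpi ?(ltW r0) ?rpi// -leNgt.
  by apply: le_trans et; rewrite /r ge_min lexx.
rewrite cos_norm; lra.
Qed.

Lemma nbhs_near_box (x : W) (d : R) : 0 < d -> \forall y \near x, near_box x d y.
Proof.
move=> d0; pose f (i : 'I_n) (y : W) := cos (y 0 i - x 0 i).
have cf i : \forall y \near x, 1 - f i y <= d.
  have : f i y @[y --> x] --> f i x.
    apply: (@continuous_comp _ _ _ (fun y : W => y 0 i - x 0 i) cos).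
      apply: (@cvgB _ _ _ (nbhs x)); first exact: coord_continuous.
      exact: cvg_cst.
    exact: continuous_cos.
  move=> /(@cvgrPdist_le _ _ _ (nbhs x))/(_ _ d0); apply: filterS => y.
  rewrite /f subrr cos0 ler_norml => /andP[_]; lra.
exact: (@filter_forall _ 'I_n (fun i y => 1 - f i y <= d) (nbhs x) _ cf).
Qed.

Lemma freq_dot_deltal (i : 'I_n) (x : W) : freq_dot (delta_mx 0 i) x = x 0 i.
Proof.
rewrite /freq_dot (bigD1 i)//= big1 ?addr0 ?mxE ?eqxx ?mul1r// => j ji.
by rewrite mxE eqxx (negbTE ji) mul0r.
Qed.

(** A lattice vector brings [x - a] into the cube, where a small [1 - cos] forces each coordinate to
    be small ([cos_close]). *)
Lemma open_near_box (O : set T) (a : W) : open O -> O (\pi_T a)%qT ->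
  exists2 d : R, 0 < d & forall x, near_box a d x -> O (\pi_T x)%qT.
Proof.
move=> oO Oa; have {}oO : open ((fun x : W => \pi_T x)%qT @^-1` O) by [].
have /nbhs_ballP[e/= e0 eO] : nbhs a ((fun x : W => \pi_T x)%qT @^-1` O).
  exact: open_nbhs_nbhs.
have [d d0 hd] := cos_close e0; exists d => // x ax.
have [z zx zb] := lattice_reduce (x - a).
have -> : (\pi_T x)%qT = (\pi_T (a + z))%qT :> T.
  by apply/pi_torusP; rewrite opprD addrA.
apply: eO; split => // j i; rewrite !mxE (ord1 j) /ball/= opprD addNKr normrN.
apply: hd; first by rewrite ler_norml; exact: zb.
have := ax i; congr (1 - _ <= _).
have := @wave_lattice R n (delta_mx 0 i) 0 (x - a) z zx.
by rewrite /wave !addr0 !freq_dot_deltal !mxE.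
Qed.

End boxes.

(** * Indicators of boxes as bounded limits of trigonometric polynomials *)

Section uniqueness.
Context (R : realType) (n : nat).
Local Notation T := (torus R n).
Local Notation W := 'rV[R]_n.
Local Notation Z := 'rV[int]_n.
Local Notation mu := (torus_measure (R := R) (n := n)).

(* On [0, 1] these polynomials converge to the indicator of [0, 1/2[. *)
Definition step_poly (k : nat) (z : R) : R := (1 - z ^+ k) ^+ (k * 2 ^ k).

Lemma step_poly01 k z : 0 <= z <= 1 -> 0 <= step_poly k z <= 1.
Proof.
move=> /andP[z0 z1]; have zk : 0 <= z ^+ k by exact: exprn_ge0.
have zk1 : z ^+ k <= 1 by exact: exprn_ile1.
by rewrite exprn_ge0 ?exprn_ile1//; lra.
Qed.

Lemma bernoulli_ge (x : R) k : 0 <= x -> 1 + k%:R * x <= (1 + x) ^+ k.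
Proof.
move=> x0; elim: k => [|k IH]; first by rewrite mul0r addr0 expr0.
rewrite exprS; apply: (@le_trans _ _ ((1 + x) * (1 + k%:R * x))).
  rewrite -[k.+1%:R]natr1; have := mulr_ge0 (ler0n R k) (mulr_ge0 x0 x0); lra.
by rewrite ler_wpM2l// addr_ge0.
Qed.

Lemma bernoulli_le (x : R) k : 0 <= x <= 1 -> 1 - k%:R * x <= (1 - x) ^+ k.
Proof.
move=> /andP[x0 x1]; elim: k => [|k IH]; first by rewrite mul0r subr0 expr0.
rewrite exprS; apply: (@le_trans _ _ ((1 - x) * (1 - k%:R * x))).
  rewrite -[k.+1%:R]natr1; have := mulr_ge0 (ler0n R k) (mulr_ge0 x0 x0); lra.
by rewrite ler_wpM2l// subr_ge0.
Qed.

(** Write [x = q y] with [x < y < 1]: the factor [k q^k] stays bounded and [y^k] tends to 0. *)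
Lemma cvg_natr_geometric (x : R) : 0 <= x < 1 ->
  k%:R * x ^+ k @[k --> \oo] --> (0 : R).
Proof.
move=> /andP[x0 x1]; pose y := (1 + x) / 2; pose q := x / y.
have y0 : 0 < y by rewrite /y; lra.
have y1 : y < 1 by rewrite /y; lra.
have q0 : 0 <= q by rewrite divr_ge0// ltW.
have q1 : q < 1 by rewrite /q ltr_pdivrMr// /y; lra.
have xE : x = q * y by rewrite /q divfK// gt_eqF.
have kq k : k%:R * (1 - q) * q ^+ k <= 1 - q ^+ k.
  elim: k => [|k IH]; first by rewrite mul0r mul0r expr0 subrr.
  rewrite -[k.+1%:R]natr1 exprS.
  have h : 0 <= (1 - q) * (1 - q * q ^+ k).
    rewrite mulr_ge0 ?subr_ge0 ?(ltW q1)// -exprS exprn_ile1//; exact: ltW.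
  have := ler_wpM2l q0 IH; set z := q ^+ k in h *; lra.
apply: (@squeeze_cvgr _ _ _ _ (fun=> 0) (fun k => (1 - q)^-1 * y ^+ k)).
- near=> k; rewrite mulr_ge0 ?exprn_ge0//= {1}xE exprMn mulrA.
  rewrite ler_wpM2r ?exprn_ge0 ?(ltW y0)//.
  rewrite -[leRHS]mul1r ler_pdivlMr ?subr_gt0// mulrAC.
  by apply: le_trans (kq k) _; rewrite gerBl exprn_ge0.
- exact: cvg_cst.
- rewrite -[X in _ --> X](mulr0 (1 - q)^-1); apply: cvgMr.
  by apply: cvg_expr; rewrite gtr0_norm.
Unshelve. all: by end_near. Qed.

(** Bernoulli on both sides. Below [1 / 2] the value is at least [1 - k (2 z)^k]. From [1 / 2] on,
    with [w = z^k], it is at most [(1 + w)^(-N) <= 1 / (1 + k)] because [2^k w >= 1]; the factor [k]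
    in the exponent [N] settles the point [z = 1 / 2] itself. *)
Lemma step_poly_cvg (z : R) : 0 <= z <= 1 ->
  step_poly k z @[k --> \oo] --> ((z < 2^-1)%R%:R : R).
Proof.
move=> /andP[z0 z1]; case: ltP => hz.
  apply: (@squeeze_cvgr _ _ _ _ (fun k => 1 - k%:R * (2 * z) ^+ k) (fun=> 1)).
  - near=> k; have /andP[_ ->] := @step_poly01 k z (introT andP (conj z0 z1)).
    rewrite andbT; apply: le_trans (bernoulli_le _ _); last first.
      by rewrite exprn_ge0 ?exprn_ile1.
    by rewrite natrM natrX exprMn mulrA.
  - rewrite -[X in _ --> X]subr0; apply: cvgB; first exact: cvg_cst.
    by apply: cvg_natr_geometric; apply/andP; split; lra.
  - exact: cvg_cst.
apply: (@squeeze_cvgr _ _ _ _ (fun=> 0) (fun k => (1 + k%:R)^-1)).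
- near=> k; have /andP[-> _] := @step_poly01 k z (introT andP (conj z0 z1)).
  rewrite andTb /step_poly; set N := (k * 2 ^ k)%N; set w := z ^+ k.
  have w0 : 0 <= w by exact: exprn_ge0.
  have w1 : w <= 1 by exact: exprn_ile1.
  have b : 1 + k%:R <= (1 + w) ^+ N.
    apply: le_trans (bernoulli_ge N w0); rewrite lerD2l /N natrM natrX -mulrA.
    rewrite ler_peMr// /w -exprMn exprn_ege1//; lra.
  rewrite -[leRHS]mul1r ler_pdivlMr; last by rewrite ltr_pwDl.
  apply: (@le_trans _ _ ((1 - w) ^+ N * (1 + w) ^+ N)).
    by rewrite ler_wpM2l// exprn_ge0// subr_ge0.
  rewrite -exprMn exprn_ile1//; first by rewrite mulr_ge0//; lra.
  by have := sqr_ge0 w; rewrite expr2; lra.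
- exact: cvg_cst.
- have : (fun k : nat => (k.+1%:R)^-1) @ \oo --> (0 : R) by exact: cvg_harmonic.
  by apply: cvg_trans; apply: near_eq_cvg; near=> k; rewrite /= nat1r.
Unshelve. all: by end_near. Qed.

Lemma tint_dominated (v g : T -> R) (h : nat -> T -> R) : L1 v ->
  (forall k, measurable_fun setT (h k)) -> (forall k X, `|h k X| <= 1) ->
  (forall X, h k X @[k --> \oo] --> g X) ->
  tint (fun X => v X * h k X) @[k --> \oo] --> tint (fun X => v X * g X).
Proof.
move=> v1 mh h1 hg.
have mg : measurable_fun setT g by apply: measurable_fun_cvg mh _ => X _; exact: hg.
have [] := @dominated_convergence _ _ _ mu setT measurableT
  (fun k X => (v X * h k X)%:E) (fun X => (v X * g X)%:E) (fun X => `|v X|%:E).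
- move=> k; apply/measurable_EFinP/measurable_funM => //; exact: L1_measurable.
- by apply/measurable_EFinP/measurable_funM => //; exact: L1_measurable.
- apply: aeW => X _; apply/cvg_EFin; first by near=> k.
  by apply: cvgMr; exact: hg.
- exact: L1_norm.
- by apply: aeW => X k _; rewrite /= lee_fin normrM ler_piMr.
- move=> iz _ cz; rewrite /tint /Rintegral; apply: fine_cvg.
  by rewrite fineK; [exact: cz|exact: integrable_fin_num].
Unshelve. all: by end_near. Qed.

Lemma tint_tpoly_eq0 (v : T -> R) d P : L1 v -> (forall k t, ft v k t = 0) ->
  tpoly d P -> tint (fun X => v X * P (repr X)) = 0.
Proof.
move=> v1 v0; have z0 : tint ((fun=> 0) : T -> R) = 0.
  exact: etrans (@tint_cst R n 0) (mul0r _).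
have L (Q : W -> R) : tpoly d Q -> L1 (fun X => v X * Q (repr X)).
  move=> tQ; have [C QC] := tpoly_bounded tQ.
  apply: (@L1_mul _ _ v (Q \o repr) C) => //; last by move=> X; exact: QC.
  exact: L1_measurable (tpoly_L1 tQ).
elim=> [|k t _|P1 P2 t1 h1 t2 h2|c P1 t1 h].
- by rewrite -[RHS]z0; apply: eq_tint => X; rewrite mulr0.
- exact: v0.
- rewrite -[RHS](addr0 0) -[X in X + _]h1 -[X in _ + X]h2 -tintD; [|exact: L|exact: L].
  by apply: eq_tint => X; rewrite mulrDr.
- rewrite -[RHS](mulr0 c) -[X in _ * X]h -tintZ; last exact: L.
  by apply: eq_tint => X; rewrite mulrCA.
Qed.

(** The triple consists of a coordinate, a centre and a threshold. *)
Definition arc (p : 'I_n * R * R) (X : T) : bool :=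
  p.2 < cos (repr X 0 p.1.1 - p.1.2).

Definition arc_box (s : seq ('I_n * R * R)) : set T := [set X | all (arc ^~ X) s].

Definition arc_boxes : set (set T) :=
  [set B | exists2 s, all (fun p => `|p.2| <= 1) s & B = arc_box s].

(** The affine change of variable turns [cos > c] into [z < 1 / 2] and keeps [z] in [[0, 1]] as long
    as [|c| <= 1]. *)
Definition arc_poly k (p : 'I_n * R * R) (x : W) : R :=
  step_poly k (2^-1 - (cos (x 0 p.1.1 - p.1.2) - p.2) / 4).

Lemma arc_arg (c t : R) : `|c| <= 1 -> 0 <= 2^-1 - (cos t - c) / 4 <= 1.
Proof.
rewrite ler_norml => /andP[c1 c2]; have := cos_le1 t; have := cos_geN1 t.
by move=> ? ?; apply/andP; split; lra.
Qed.

Lemma tpoly_arc_poly k p : exists d, tpoly d (arc_poly k p).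
Proof.
pose c x : R := wave (delta_mx 0 p.1.1) (- p.1.2) (x : W).
have tc : tpoly (l1deg (delta_mx 0 p.1.1 : Z)).+1 c by exact: tpoly_wave.
set d := _.+1 in tc; exists (((d * k).+1 * (k * 2 ^ k)).+1).
apply: (@tpoly_ext _ _ _ (fun x => (1 + (-1) *
    (2^-1 + p.2 / 4 + (- (4^-1)) * c x) ^+ k) ^+ (k * 2 ^ k))) => [x|].
  rewrite /arc_poly /step_poly /c /wave freq_dot_deltal.
  by rewrite mulN1r; congr ((1 - _ ^+ _) ^+ _); field.
apply: tpolyX; apply: tpolyD.
  by apply: tpolyW (tpoly_cst _ _).
by apply: tpolyZ; apply: tpolyX; apply: tpolyD;
  [apply: tpolyW (tpoly_cst _ _)|exact: tpolyZ].
Qed.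

Lemma tpoly_arc_prod k s : exists d,
  tpoly d (fun x : W => \prod_(p <- s) arc_poly k p x).
Proof.
elim: s => [|p s [d td]].
  by exists 1%N; apply: tpoly_ext (tpoly_cst n 1) => x; rewrite big_nil.
have [e te] := tpoly_arc_poly k p.
by exists (e + d)%N; apply: tpoly_ext (tpolyM te td) => x; rewrite big_cons.
Qed.

Lemma open_arc p : open [set X : T | arc p X].
Proof.
have cw : continuous (wave (delta_mx 0 p.1.1) (- p.1.2) \o @repr _ T).
  by apply: continuous_torus; [exact: continuous_wave|exact: wave_periodic].
rewrite (_ : [set X | _] = (wave (delta_mx 0 p.1.1) (- p.1.2) \o @repr _ T) @^-1`
    `]p.2, +oo[%classic).
  by move/continuousP: cw; apply; exact: interval_open.
apply/seteqP; split => X; rewrite /arc /= in_itv/= andbT;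
  by rewrite /wave freq_dot_deltal.
Qed.

Lemma open_arc_box s : open (arc_box s).
Proof.
elim: s => [|p s IH].
  by rewrite (_ : arc_box _ = setT); [exact: openT|apply/seteqP; split].
rewrite (_ : arc_box _ = [set X | arc p X] `&` arc_box s).
  by apply: openI => //; exact: open_arc.
by apply/seteqP; split => X /= => [/andP[? ?]|[? ?]]; [split|apply/andP; split].
Qed.

Lemma measurable_open (O : set T) : open O -> measurable O.
Proof. by move=> oO; exact: sub_sigma_algebra. Qed.

(** [v] is orthogonal to all trigonometric polynomials, and the products of the [arc_poly] converge
    boundedly to the indicator. *)
Lemma tint_arc_box (v : T -> R) s : L1 v -> (forall k t, ft v k t = 0) ->
  all (fun p => `|p.2| <= 1) s ->
  tint (fun X => v X * \1_(arc_box s) X) = 0.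
Proof.
move=> v1 v0 hs.
pose h k X := \prod_(p <- s) arc_poly k p (repr (X : T)).
have h0 k : tint (fun X => v X * h k X) = 0.
  by have [d td] := tpoly_arc_prod k s; exact: tint_tpoly_eq0 v1 v0 td.
have mh k : measurable_fun setT (h k).
  by have [d td] := tpoly_arc_prod k s; exact: L1_measurable (tpoly_L1 td).
have arc01 k p x : p \in s -> 0 <= arc_poly k p x <= 1.
  by move=> ps; apply: step_poly01; apply: arc_arg; exact: (allP hs).
have h1 k X : `|h k X| <= 1.
  rewrite /h big_seq; apply: (big_ind (fun z => `|z| <= 1)).
  - by rewrite normr1.
  - by move=> x y x1 y1; rewrite normrM mulr_ile1.
  - by move=> p ps; have /andP[a0 a1] := arc01 k p (repr X) ps; rewrite ger0_norm.
have hc X : h k X @[k --> \oo] --> (\1_(arc_box s) X : R).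
  rewrite indicE; have -> : (X \in arc_box s) = all (arc ^~ X) s.
    by apply/idP/idP => [/set_mem|] // a; exact: mem_set.
  rewrite /h; elim: s hs {h0 mh h1 h arc01} => [_|p s IH /= /andP[p1 hs]].
    by under eq_fun do rewrite big_nil; exact: cvg_cst.
  under eq_fun do rewrite big_cons.
  rewrite -mulnb natrM; apply: cvgM; last exact: IH.
  have := step_poly_cvg (arc_arg (repr X 0 p.1.1 - p.1.2) p1).
  set a := (_ < 2^-1); have -> // : a = arc p X.
  by apply/idP/idP; rewrite /a /arc; lra.
have := tint_dominated v1 mh h1 hc.
under eq_fun do rewrite h0.
by move=> /(cvg_lim (@Rhausdorff R)) <-; rewrite lim_cst.
Qed.

Lemma setI_closed_arc_boxes : setI_closed arc_boxes.
Proof.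
move=> _ _ [s hs ->] [r hr ->]; exists (s ++ r); first by rewrite all_cat hs.
by apply/seteqP; split => X; rewrite /arc_box /= all_cat; [move=> [? ?]; apply/andP|move=> /andP].
Qed.

(** Every open set is a union of boxes with rational centres and thresholds [1 - 1 / (j + 1)], of
    which there are countably many. *)
Lemma arc_boxes_generate : @measurable _ T = <<s arc_boxes >>.
Proof.
apply/seteqP; split; last first.
  apply: smallest_sub; first exact: sigma_algebra_measurable.
  by move=> _ [s _ ->]; apply: measurable_open; exact: open_arc_box.
apply: smallest_sub; first exact: smallest_sigma_algebra.
move=> O oO.
pose bx (a : 'rV[rat]_n) (j : nat) := [seq (i, ratr (a 0 i) : R, 1 - j.+1%:R^-1 : R) | i : 'I_n].
have bxE a j X : arc_box (bx a j) X <->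
    forall i, 1 - j.+1%:R^-1 < cos (repr X 0 i - ratr (a 0 i)).
  rewrite /arc_box /= all_map; split => [/allP h i|h].
    by have /= := h i (mem_enum _ _).
  by apply/allP => i _ /=; exact: h.
rewrite (_ : O = \bigcup_aj if `[< arc_box (bx aj.1 aj.2) `<=` O >]
    then arc_box (bx aj.1 aj.2) else set0); last first.
  apply/seteqP; split => [X OX|X [aj _]]; last by case: asboolP => // h /h.
  have [|d d0 hd] := @open_near_box R n O (repr X) oO; first by rewrite reprK.
  (* Two points of a box of level [j] are separated, by [cosD_quasi], by at most
     [2 / (j + 1) + 2 / (j + 1)]. *)
  pose j := Num.truncn (4 / d).
  have jd : 4 * j.+1%:R^-1 <= d.
    rewrite ler_pdivrMr// mulrC -ler_pdivrMr//; exact/ltW/truncnS_gt.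
  have j0 : 0 < j.+1%:R^-1 :> R by rewrite invr_gt0.
  have [r r0 hr] : exists2 r : R, 0 < r & forall t, `|t| <= r -> 1 - cos t < j.+1%:R^-1.
    have : cos t @[t --> (0 : R)] --> (cos 0 : R) by exact: continuous_cos.
    have j2 : 0 < j.+1%:R^-1 / 2 :> R by rewrite divr_gt0.
    move=> /cvgrPdist_le/(_ _ j2) /nbhs_ballP[r /= r0 hr].
    exists (r / 2); first by rewrite divr_gt0.
    move=> t tr; have /hr : ball (0 : R) r t.
      by rewrite /ball/= sub0r normrN; apply: le_lt_trans tr _; lra.
    by move: j0; rewrite /= cos0; move: (_ ^-1) => w w0 /ler_normlP[? ?]; lra.
  have aP i : {a : rat | `|repr X 0 i - ratr a| <= r}.
    apply: cid; have /rat_in_itvoo[q] : repr X 0 i - r < repr X 0 i by rewrite gtrBl.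
    rewrite in_itv/= => /andP[q1 q2]; exists q; rewrite ger0_norm; lra.
  exists (\row_i sval (aP i), j) => //=.
  have Xin : arc_box (bx (\row_i sval (aP i)) j) X.
    apply/bxE => i; rewrite mxE; case: (aP i) => a /= ha.
    by have := hr _ ha; move: (cos _) (_ ^-1) => c w; lra.
  rewrite asboolT// => Y /bxE hY; rewrite -[Y]reprK; apply: hd => i.
  have -> : repr Y 0 i - repr X 0 i = (repr Y 0 i - ratr (sval (aP i))) +
     - (repr X 0 i - ratr (sval (aP i))) by ring.
  apply: le_trans (cosD_quasi _ _) _; rewrite cosN.
  have := hY i; rewrite mxE; case: (aP i) => a /= ha; have := hr _ ha.
  by move: jd; move: (cos _) (cos _) (_ ^-1) => c c' w; lra.
apply: (@countable_bigcupT_measurable _ (g_sigma_algebraType arc_boxes)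
  _ (fun aj : 'rV[rat]_n * nat => _)) => [|[a j]]; first exact: countableP.
case: ifP => // _; apply: sub_sigma_algebra; exists (bx a j) => //.
rewrite all_map; apply/allP => i _ /=.
have j0 : 0 < j.+1%:R^-1 :> R by rewrite invr_gt0.
have j1 : j.+1%:R^-1 <= 1 :> R by rewrite invf_le1// ler1n.
by rewrite ger0_norm ?gerBl ?subr_ge0// ltW.
Qed.

Lemma measurable_indicT (B : set T) : measurable B ->
  measurable_fun setT (\1_B : T -> R).
Proof. by move=> mB; exact: measurable_indic. Qed.

Lemma indic_le1 (B : set T) X : `|\1_B X : R| <= 1.
Proof. by rewrite indicE; case: (_ \in _); rewrite ?normr1 ?normr0. Qed.

Lemma L1_mul_indic (v : T -> R) (B : set T) : L1 v -> measurable B ->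
  L1 (fun X => v X * \1_B X).
Proof.
move=> v1 mB; apply: (L1_mul v1 (C := 1)); first exact: measurable_indicT.
exact: indic_le1.
Qed.

(** Dynkin's lemma: the boxes form a generating pi-system, and the sets over which [v] integrates to
    0 are stable under complements and countable disjoint unions. *)
Lemma tint_indic_eq0 (v : T -> R) (B : set T) : L1 v ->
  (forall k t, ft v k t = 0) -> measurable B ->
  tint (fun X => v X * \1_B X) = 0.
Proof.
move=> v1 v0 mB.
have vT : tint v = 0.
  rewrite -[RHS](v0 0 0); apply: eq_tint => X.
  by rewrite wave0 cos0 mulr1.
apply: (@dynkin_induction _ T arc_boxes (fun B => tint (fun X => v X * \1_B X) = 0)) => //.
- exact: arc_boxes_generate.
- exact: setI_closed_arc_boxes.
- by rewrite -[RHS]vT; apply: eq_tint => X; rewrite indicT mulr1.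
- by move=> _ [s hs ->]; exact: tint_arc_box.
- move=> S mS hS; transitivity (tint v - tint (fun X => v X * \1_S X)).
    rewrite -tintB//; last exact: L1_mul_indic.
    apply: eq_tint => X; rewrite !indicE in_setC.
    by case: (_ \in S); rewrite /=; ring.
  by rewrite vT hS subr0.
- move=> F mF tF hF.
  pose h k X := \sum_(i < k) \1_(F i) (X : T) : R.
  have hE k X : h k X = \1_(\big[setU/set0]_(i < k) F i) X.
    elim: k => [|k IH]; first by rewrite /h !big_ord0 indic0.
    rewrite /h !big_ord_recr/= -/(h k X) IH !indicE in_setU.
    have [XF|] := boolP (X \in F k); last by rewrite orbF addr0.
    rewrite (_ : (X \in \big[setU/set0]_(i < k) F i) = false) ?add0r ?orbT//.
    apply/negP => /set_mem; rewrite -bigcup_mkord => -[i /= ik Fi].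
    have := tF i k I I; move/set_mem in XF.
    by move=> e; rewrite e ?ltnn in ik => //; exists X.
  have mh k : measurable_fun setT (h k).
    rewrite (_ : h k = \1_(\big[setU/set0]_(i < k) F i)).
      by apply: measurable_indicT; apply: bigsetU_measurable.
    exact/funext.
  have h1 k X : `|h k X| <= 1 by rewrite hE indic_le1.
  have hc X : h k X @[k --> \oo] --> (\1_(\bigcup_i F i) X : R).
    have [[i _ Fi]|nF] := pselect ((\bigcup_i F i) X).
      apply: cvg_near_cst; exists i.+1 => // k /= ik; rewrite hE !indicE !mem_set//.
        by exists i.
      by rewrite -bigcup_mkord; exists i.
    apply: cvg_near_cst; near=> k; rewrite hE !indicE !memNset//.
    by rewrite -bigcup_mkord => -[i _ Fi]; apply: nF; exists i.
  have := tint_dominated v1 mh h1 hc.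
  have h0 k : tint (fun X => v X * h k X) = 0.
    rewrite /h; under eq_tint do rewrite big_distrr/=.
    rewrite tint_sum => [|i]; last exact: L1_mul_indic.
    by rewrite big1.
  under eq_fun do rewrite h0.
  by move=> /(cvg_lim (@Rhausdorff R)) <-; rewrite lim_cst.
- by rewrite -arc_boxes_generate.
Unshelve. all: by end_near. Qed.

(** Integrating [v] over [B = {v > 0}] and over its complement shows that [|v|] has integral 0. *)
Theorem ft_unique (v : T -> R) : L1 v -> (forall k t, ft v k t = 0) ->
  {ae mu, forall X, v X = 0}.
Proof.
move=> v1 v0; pose B := [set X | 0 < v X].
have mv := L1_measurable v1.
have mB : measurable B.
  have := mv measurableT `]0, +oo[%classic (measurable_itv _).
  by rewrite setTI; congr measurable; apply/seteqP; split=> X;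
    rewrite /B/= in_itv/= andbT.
have a0 : tint (fun X => `|v X|) = 0.
  transitivity (tint (fun X => v X * \1_B X) - tint (fun X => v X * \1_(~` B) X)).
    rewrite -tintB; [|exact: L1_mul_indic|by apply: L1_mul_indic => //; exact: measurableC].
    apply: eq_tint => X; rewrite !indicE in_setC /B.
    case: (ltP 0 (v X)) => vX.
      by rewrite mem_set//= mulr1 mulr0 subr0 gtr0_norm.
    rewrite memNset/= ?mulr0 ?mulr1 ?sub0r ?ler0_norm//.
    by apply/negP; rewrite -leNgt.
  by rewrite !tint_indic_eq0 ?subr0//; exact: measurableC.
have : (\int[mu]_X `|(v X)%:E| = 0)%E.
  rewrite -[LHS]fineK; last exact: (integrable_fin_num measurableT (L1_norm v1)).
  by congr EFin; exact: a0.
move=> /(ae_eq_integral_abs mu measurableT _).1.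
have mEv : measurable_fun setT (EFin \o v) by exact/measurable_EFinP.
move=> /(_ mEv); apply: filterS => X h; have := h I.
by move=> [].
Qed.


End uniqueness.

(** * The binomial series and trigonometric bumps *)

Section binomial_series.
Context (R : realType) (s : R).
Hypothesis s0 : 0 < s.

(** The Taylor coefficients of [(1 - y)^s], that is [(-1)^k] times the binomial coefficient of [s]
    and [k]. *)
Fixpoint bcoef (k : nat) : R :=
  if k is j.+1 then bcoef j * (j%:R - s) / j.+1%:R else 1.

Arguments bcoef : simpl never.

Definition bsum (K : nat) (y : R) : R := \sum_(k < K.+1) bcoef k * y ^+ k.

Definition dbsum (K : nat) (y : R) : R :=
  \sum_(k < K) bcoef k.+1 * k.+1%:R * y ^+ k.

Lemma bcoefS k : bcoef k.+1 * k.+1%:R = bcoef k * (k%:R - s).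
Proof. by rewrite /bcoef -/bcoef divfK// pnatr_eq0. Qed.

(** [(1 - y)^s] solves [(1 - y) S' + s S = 0]; a partial sum misses this equation by a single
    term. *)
Lemma bsum_ode K y : (1 - y) * dbsum K y + s * bsum K y =
  (s - K%:R) * bcoef K * y ^+ K.
Proof.
elim: K => [|K IH].
  by rewrite /dbsum /bsum big_ord0 big_ord_recl big_ord0 /= !expr0 /bcoef; ring.
rewrite /dbsum /bsum !(big_ord_recr K) !(big_ord_recr K.+1) /= -/(dbsum K y) -/(bsum K y).
have e := bcoefS K; set c := bcoef K.+1 in e *.
transitivity ((1 - y) * dbsum K y + s * bsum K y +
   ((1 - y) * (c * K.+1%:R * y ^+ K) + s * (c * y ^+ K.+1))); first by ring.
rewrite IH exprS e -[K.+1%:R]natr1; rewrite -[K.+1%:R]natr1 in e.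
transitivity (- (c * (K%:R + 1)) * (y * y ^+ K) + s * c * (y * y ^+ K)); last by ring.
by rewrite e; ring.
Qed.

Lemma is_derive_bsum K y : is_derive y (1 : R) (bsum K) (dbsum K y).
Proof.
elim: K => [|K IH].
  rewrite (_ : bsum 0 = cst 1); last first.
    by apply/funext => z; rewrite /bsum big_ord_recl big_ord0 /= expr0 /bcoef addr0 mulr1.
  by rewrite /dbsum big_ord0; exact: is_derive_cst.
have -> : bsum K.+1 = bsum K + (bcoef K.+1 *: (fun z : R => z ^+ K.+1)).
  by apply/funext => z; rewrite /bsum big_ord_recr.
have -> : dbsum K.+1 y = dbsum K y + bcoef K.+1 *: (K.+1%:R * y ^+ K).
  by rewrite /dbsum big_ord_recr /= /GRing.scale /=; ring.
apply: is_deriveD; apply: is_deriveZ.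
have -> : (fun z : R => z ^+ K.+1) = id ^+ K.+1.
  by apply/funext => z; rewrite exprfctE.
refine (@is_derive_eq _ _ _ _ _ _ _ _
  (@is_deriveX R R id K.+1 y 1 1 (is_derive_id _ _)) _).
by rewrite /GRing.scale/= mulr1.
Qed.

(** By [bsum_ode] the quotient [h] of the partial sum by [(1 - z)^s] has the explicit derivative
    [dh], and [h 0 = 1]; the mean value theorem concludes. The factor [2^s] bounds [(1 - y)^s]. *)
Lemma bsum_remainder K (y r : R) : `|y| <= r -> r < 1 ->
  `|bsum K y - (1 - y) `^ s| <=
  2 `^ s * (`|s - K%:R| * `|bcoef K| * r ^+ K * (1 - r) `^ (- s - 1) * `|y|).
Proof.
move=> yr r1; have r0 : 0 <= r by exact: le_trans yr.
pose h z := bsum K z * (1 - z) `^ (- s).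
pose dh z := (s - K%:R) * bcoef K * z ^+ K * (1 - z) `^ (- s - 1).
have pos z : `|z| <= r -> 0 < 1 - z.
  by rewrite ler_norml subr_gt0 => /andP[_ zr]; exact: le_lt_trans zr r1.
have dhP z : `|z| <= r -> is_derive z (1 : R) h (dh z).
  move=> /pos z1.
  have d1 : is_derive z (1 : R) (fun z => 1 - z) (-1).
    refine (@is_derive_eq _ _ _ _ _ _ _ _
      (is_deriveB (is_derive_cst (1 : R) z 1) (is_derive_id z 1)) _).
    by rewrite sub0r.
  have d2 := @is_derive1_comp R (@powR R ^~ (- s)) (fun z => 1 - z) z _ _
    (is_derive1_powR (- s) z1) d1.
  have d3 := is_deriveM (is_derive_bsum K z) d2.
  refine (@is_derive_eq _ _ _ _ _ _ _ _ d3 _).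
  rewrite /dh -bsum_ode /GRing.scale/=.
  have -> : (1 - z) `^ (- s) = (1 - z) * (1 - z) `^ (- s - 1).
    rewrite -{2}[1 - z]powRr1 ?(ltW z1)// -powRD ?subrKC//.
    by rewrite (gt_eqF z1) implybT.
  ring.
have dhB z : `|z| <= `|y| ->
    `|dh z| <= `|s - K%:R| * `|bcoef K| * r ^+ K * (1 - r) `^ (- s - 1).
  move=> zy; have zr := le_trans zy yr; rewrite /dh !normrM normrX.
  apply: ler_pM => //.
    by rewrite ler_wpM2l ?mulr_ge0// lerXn2r ?nnegrE.
  rewrite ger0_norm ?powR_ge0//.
  have -> : - s - 1 = - (s + 1) by ring.
  rewrite !powRN lef_pV2 ?posrE ?powR_gt0 ?subr_gt0 ?pos//.
    rewrite ge0_ler_powR ?nnegrE ?subr_ge0 ?(ltW r1)//; first by rewrite addr_ge0// ltW.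
      by rewrite -subr_ge0 ltW// pos.
    by rewrite lerD2l lerN2; move: zr; rewrite ler_norml => /andP[].
  by rewrite -subr_gt0 pos.
have h0 : h 0 = 1.
  rewrite /h subr0 powR1 mulr1 /bsum big_ord_recl big1 => [|i _].
    by rewrite expr0 mulr1 addr0.
  by rewrite /= /bump/= add1n exprS mul0r mulr0.
have ch a b : (forall z, z \in `[a, b] -> `|z| <= r) ->
    {within `[a, b], continuous h}.
  move=> ab; apply: derivable_within_continuous => z zab.
  by have := dhP z (ab z zab); move=> [].
have hy : `|h y - 1| <= `|s - K%:R| * `|bcoef K| * r ^+ K * (1 - r) `^ (- s - 1) * `|y|.
  rewrite -[X in h y - X]h0; have [y0|y0] := leP 0 y.
    have sub z : z \in `[0, y] -> `|z| <= `|y|.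
      by rewrite in_itv/= => /andP[z0 zy]; rewrite !ger0_norm.
    have sub' z : z \in `]0, y[ -> `|z| <= `|y|.
      by rewrite in_itv/= => /andP[z0 zy]; apply: sub; rewrite in_itv/= !ltW.
    have [|c cy ->] := @MVT_segment R h dh 0 y y0 _ (ch _ _ (fun z zy => le_trans (sub z zy) yr)).
      by move=> z zy; apply: dhP; exact: le_trans (sub' z zy) yr.
    by rewrite subr0 normrM ler_wpM2r// dhB// sub.
  have sub z : z \in `[y, 0] -> `|z| <= `|y|.
    rewrite in_itv/= => /andP[z0 zy]; rewrite !ler0_norm ?(ltW y0)//.
    by rewrite lerN2.
  have sub' z : z \in `]y, 0[ -> `|z| <= `|y|.
    by rewrite in_itv/= => /andP[z0 zy]; apply: sub; rewrite in_itv/= !ltW.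
  have [|c cy e] := @MVT_segment R h dh y 0 (ltW y0) _ (ch _ _ (fun z zy => le_trans (sub z zy) yr)).
    by move=> z zy; apply: dhP; exact: le_trans (sub' z zy) yr.
  by rewrite distrC e sub0r normrM normrN ler_wpM2r// dhB// sub.
have y1 := pos _ yr.
have -> : bsum K y - (1 - y) `^ s = (1 - y) `^ s * (h y - 1).
  rewrite /h mulrBr mulr1 mulrCA -powRD; last by rewrite (gt_eqF y1) implybT.
  by rewrite addrN powRr0 mulr1.
rewrite normrM; apply: ler_pM => //.
rewrite ger0_norm ?powR_ge0// ge0_ler_powR ?nnegrE ?(ltW y1) ?(ltW s0)//.
by have := le_trans yr (ltW r1); rewrite ler_norml => /andP[? _]; lra.
Qed.

(** Once [k >= s] the ratio of consecutive coefficients is [1 - (s + 1) / (k + 1)], which Bernoulli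
    compares with [(k / (k + 1))^(m + 2)]. So [|bcoef k| k^(m + 2)] no longer increases, and [C]
    takes care of the finitely many earlier indices. *)
Lemma bcoef_decay (m : nat) : m.+1%:R <= s ->
  exists C, forall k, (0 < k)%N -> `|bcoef k| <= C / k%:R ^+ m.+2.
Proof.
move=> ms; pose k0 := (Num.truncn s).+1; have sk0 : s < k0%:R by exact: truncnS_gt.
have step k : s <= k%:R -> (0 < k)%N ->
    `|bcoef k.+1| * k.+1%:R ^+ m.+2 <= `|bcoef k| * k%:R ^+ m.+2.
  move=> sk k1; have k0' : 0 < k.+1%:R :> R by [].
  have -> : bcoef k.+1 = bcoef k * ((k%:R - s) / k.+1%:R).
    by rewrite mulrA -bcoefS mulfK// pnatr_eq0.
  rewrite normrM -mulrA ler_wpM2l// ger0_norm ?divr_ge0 ?subr_ge0//.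
  rewrite -ler_pdivlMr ?exprn_gt0// -expr_div_n.
  have x01 : 0 <= (k.+1%:R^-1 : R) <= 1 by rewrite invr_ge0 ler0n/= invf_le1// ler1n.
  have -> : k%:R / k.+1%:R = 1 - k.+1%:R^-1 :> R.
    by rewrite -[k.+1%:R]natr1; field; rewrite natr1 pnatr_eq0.
  apply: le_trans (bernoulli_le m.+2 x01).
  rewrite ler_pdivrMr// mulrBl mul1r mulfVK ?pnatr_eq0//.
  by rewrite -[k.+1%:R]natr1 -[m.+2%:R]natr1; lra.
pose C := \sum_(k < k0.+1) `|bcoef k| * k%:R ^+ m.+2.
have Ck k : (k <= k0)%N -> `|bcoef k| * k%:R ^+ m.+2 <= C.
  by rewrite -ltnS => kk; rewrite /C (bigD1 (Ordinal kk))//= lerDl sumr_ge0.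
exists C => k k1; rewrite ler_pdivlMr ?exprn_gt0 ?ltr0n//.
have [kk|kk] := leqP k k0; first exact: Ck.
rewrite -(subnKC kk) addSnnS; elim: (k - k0.+1)%N => [|j IH].
  rewrite addn1; apply: le_trans (step _ (ltW sk0) _) _ => //; exact: Ck.
rewrite addnS; apply: le_trans (step _ _ _) IH; last by lia.
by rewrite natrD; have := ler0n R j.+1; lra.
Qed.

Lemma inv_natr_diff (a : nat) : (0 < a)%N ->
  a%:R^-1 - a.+1%:R^-1 = (a%:R * a.+1%:R)^-1 :> R.
Proof.
rewrite -(ltr0n R) -[a.+1%:R]natr1; move: (a%:R : R) => x x0.
have x1 : 0 < x + 1 by rewrite addr_gt0.
by field; rewrite !gt_eqF.
Qed.

(** Two of the powers telescope through [1 / a^2 <= 1 / (a - 1) - 1 / a]; the other [m] are bounded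
    by [K ^- m]. *)
Lemma sum_inv_pow_le (m K M : nat) : (0 < K)%N ->
  \sum_(K.+1 <= k < M) (k%:R ^- m.+2 : R) <= K%:R ^- m.+1.
Proof.
move=> K0; have Kp : 0 < K%:R :> R by rewrite ltr0n.
have [MK|KM] := leqP M K.+1.
  by rewrite big_geq// invr_ge0 exprn_ge0.
suff : \sum_(K.+1 <= k < M) (k%:R ^- m.+2 : R) <= K%:R ^- m * (K%:R^-1 - M.-1%:R^-1).
  move/le_trans; apply; rewrite exprSr invfM ler_wpM2l ?invr_ge0 ?exprn_ge0//.
  by rewrite gerBl invr_ge0.
rewrite -(subnKC KM); elim: (M - K.+2)%N => [|j IH].
  rewrite addn0 big_nat1 /= -[m.+2]addn2 exprD invfM ler_pM ?invr_ge0 ?exprn_ge0//.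
    by rewrite lef_pV2 ?posrE ?exprn_gt0 ?ltr0n// lerXn2r ?nnegrE ?ler0n// ler_nat.
  rewrite inv_natr_diff//.
  rewrite lef_pV2 ?posrE ?mulr_gt0 ?exprn_gt0 ?ltr0n// expr2 ler_wpM2r//.
  by rewrite ler_nat.
rewrite addnS big_nat_recr/=; last by lia.
set a := (K.+2 + j)%N in IH *; have a0 : 0 < a%:R :> R by rewrite ltr0n.
have aK : (K <= a)%N by lia.
have a1 : 0 < a.-1%:R :> R by rewrite ltr0n; lia.
have : a%:R ^- m.+2 <= K%:R ^- m * (a.-1%:R^-1 - a%:R^-1) :> R.
  rewrite -[m.+2]addn2 exprD invfM ler_pM ?invr_ge0 ?exprn_ge0//.
    by rewrite lef_pV2 ?posrE ?exprn_gt0// lerXn2r ?nnegrE ?ler0n// ler_nat.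
  have -> : a.-1%:R^-1 - a%:R^-1 = (a.-1%:R * a%:R)^-1 :> R.
    by rewrite -inv_natr_diff// -(ltr0n R).
  rewrite lef_pV2 ?posrE ?mulr_gt0 ?exprn_gt0// expr2 ler_wpM2r ?ltW//.
  by rewrite ltr_nat; lia.
by move: IH; rewrite !mulrBr; lra.
Qed.

Lemma bsum_cauchy (m : nat) : m.+1%:R <= s -> exists2 C, 0 <= C &
  forall y K M, 0 <= y <= 1 -> (0 < K)%N -> (K <= M)%N ->
    `|bsum M y - bsum K y| <= C / K%:R ^+ m.+1.
Proof.
move=> ms; have [C hC] := bcoef_decay ms.
have C0 : 0 <= C.
  have := hC 1%N isT; rewrite expr1n divr1; exact: le_trans.
exists C => // y K M /andP[y0 y1] K0 KM.
have -> : bsum M y - bsum K y = \sum_(K.+1 <= k < M.+1) bcoef k * y ^+ k.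
  rewrite /bsum -!(big_mkord xpredT (fun k => bcoef k * y ^+ k)).
  by rewrite (@big_cat_nat _ _ _ K.+1 _ M.+1)//= addrAC subrr add0r.
apply: le_trans (ler_norm_sum _ _ _) _.
apply: (@le_trans _ _ (\sum_(K.+1 <= k < M.+1) C * k%:R ^- m.+2)).
  rewrite big_nat_cond [leRHS]big_nat_cond; apply: ler_sum => k /andP[/andP[k1 _] _].
  rewrite normrM; apply: (@le_trans _ _ `|bcoef k|).
    by rewrite ler_piMr// ger0_norm ?exprn_ge0// exprn_ile1.
  by apply: hC; lia.
by rewrite -mulr_sumr ler_wpM2l// sum_inv_pow_le.
Qed.

(** At [y = 1] the derivative drops out of [bsum_ode], leaving [s * bsum K 1 = (s - K) * bcoef K],
    which tends to 0 by [bcoef_decay]. *)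
Lemma bsum_cvg1 (m : nat) : m.+1%:R <= s ->
  bsum K 1 @[K --> \oo] --> (0 : R).
Proof.
move=> ms; have [C hC] := bcoef_decay ms.
have C0 : 0 <= C.
  have := hC 1%N isT; rewrite expr1n divr1; exact: le_trans.
have e K : bsum K 1 = s^-1 * ((s - K%:R) * bcoef K).
  have := bsum_ode K 1; rewrite subrr mul0r add0r expr1n mulr1 => <-.
  by rewrite mulKf// gt_eqF.
apply/cvgr0Pnorm_le => e0 e00.
pose B := s^-1 * (s + 1) * C.
have B0 : 0 <= B by rewrite !mulr_ge0 ?invr_ge0 ?addr_ge0// ltW.
exists (Num.truncn (B / e0)).+1 => // K /= hK.
have K0 : 0 < K%:R :> R by rewrite ltr0n; lia.
have BK : B / K%:R <= e0.
  rewrite ler_pdivrMr// mulrC -ler_pdivrMr//.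
  by apply: le_trans (ltW (truncnS_gt _)) _; rewrite ler_nat.
apply: le_trans BK; rewrite e normrM gtr0_norm ?invr_gt0// -!mulrA.
rewrite ler_wpM2l ?invr_ge0 ?(ltW s0)// normrM.
apply: (@le_trans _ _ ((s + 1) * K%:R * (C / K%:R ^+ 2))).
  apply: ler_pM => //.
    apply: le_trans (ler_normB _ _) _; rewrite !gtr0_norm// mulrDl mul1r lerD2r.
    by rewrite ler_peMr ?(ltW s0)// ler1n; lia.
  apply: le_trans (hC K _) _; first by lia.
  rewrite ler_wpM2l// lef_pV2 ?posrE ?exprn_gt0// ler_weXn2l// ler1n; lia.
rewrite le_eqVlt; apply/orP; left; apply/eqP; field; rewrite gt_eqF//.
Qed.

Lemma bsum_cvg_lt1 (m : nat) y : m.+1%:R <= s -> 0 <= y < 1 ->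
  bsum K y @[K --> \oo] --> ((1 - y) `^ s : R).
Proof.
move=> ms /andP[y0 y1].
have e K : (s - K%:R) * bcoef K = s * bsum K 1.
  by have := bsum_ode K 1; rewrite subrr mul0r add0r expr1n mulr1.
pose D := 2 `^ s * (s * (1 - y) `^ (- s - 1) * y).
apply/cvgrPdist_le => d d0.
have D0 : 0 <= D by rewrite !mulr_ge0 ?powR_ge0// ltW.
have dD : 0 < d / (D + 1) by rewrite divr_gt0// ltr_pwDr.
have /cvgr0Pnorm_le/(_ _ dD) := bsum_cvg1 ms.
apply: filterS => K hK.
have ny : `|y| <= y by rewrite ger0_norm.
rewrite distrC; apply: le_trans (bsum_remainder K ny y1) _.
apply: (@le_trans _ _ (D * `|bsum K 1|)).
  rewrite -[X in X * y ^+ K]normrM e normrM (gtr0_norm s0) (ger0_norm y0) /D.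
  have -> : 2 `^ s * (s * `|bsum K 1| * y ^+ K * (1 - y) `^ (- s - 1) * y) =
    2 `^ s * (s * (1 - y) `^ (- s - 1) * y) * `|bsum K 1| * y ^+ K by ring.
  rewrite -/D ler_piMr; [by []|exact: mulr_ge0|exact/exprn_ile1/ltW].
apply: le_trans (ler_wpM2l D0 hK) _; rewrite mulrCA ler_piMr ?(ltW d0)//.
by rewrite ler_pdivrMr ?mul1r ?ltr_pwDr// lerDl.
Qed.

(** The rate comes from the coefficients alone and so persists up to the singular point [y = 1],
    which is attained at the zeros of the cosines below. *)
Lemma bsum_uniform (m : nat) : m.+1%:R <= s -> exists2 C, 0 <= C &
  forall y K, 0 <= y <= 1 -> (0 < K)%N ->
    `|(1 - y) `^ s - bsum K y| <= C / K%:R ^+ m.+1.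
Proof.
move=> ms; have [C C0 hC] := bsum_cauchy ms; exists C => // y K y01 K0.
have cv : bsum M y @[M --> \oo] --> ((1 - y) `^ s : R).
  have /andP[y0] := y01; rewrite le_eqVlt => /predU1P[->|y1].
    by rewrite subrr powR0 ?gt_eqF//; exact: bsum_cvg1 ms.
  by apply: (bsum_cvg_lt1 ms); rewrite y0.
have cn : `|bsum M y - bsum K y| @[M --> \oo] --> `|(1 - y) `^ s - bsum K y|.
  by apply: cvg_norm; apply: cvgB => //; exact: cvg_cst.
rewrite -(cvg_lim (@Rhausdorff R) cn); apply: limr_le; first exact: cvgP cn.
by exists K => // M /= KM; exact: hC.
Qed.

End binomial_series.

(** * Trigonometric bumps of finite smoothness and small support *)

Section bumps.
Context (R : realType) (n : nat).
Local Notation W := 'rV[R]_n.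
Local Notation Z := 'rV[int]_n.
Local Notation T := (torus R n).
Implicit Types (f g : W -> R).

Lemma jackson_tpoly m d (P : W -> R) : tpoly d P -> exists C, jackson m P C.
Proof.
move=> tP; have [B hB] := tpoly_bounded tP; exists (B * d.+1%:R ^+ m) => e.
have B0 : 0 <= B by exact: le_trans (hB 0).
have [de|ed] := leqP d e.
  exists P => [|x]; first exact: tpolyW tP.
  by rewrite subrr normr0 divr_ge0 ?mulr_ge0 ?exprn_ge0.
exists (fun=> 0) => [|x]; first exact: tpoly0.
rewrite subr0; apply: le_trans (hB x) _; rewrite -mulrA ler_peMr//.
rewrite ler_pdivlMr ?exprn_gt0// mul1r lerXn2r ?nnegrE// ler_nat; lia.
Qed.

Lemma jacksonZ m f C c : jackson m f C -> jackson m (fun x => c * f x) (`|c| * C).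
Proof.
move=> jf d; have [P tP h] := jf d; exists (fun x => c * P x) => [|x].
  exact: tpolyZ.
by rewrite -mulrBr normrM -mulrA ler_wpM2l.
Qed.

(** [|cos|^(2 m + 3)] is [(1 - y)^s] with [y = 1 - cos^2] a trigonometric polynomial and
    [s = (2 m + 3) / 2 >= m + 1]; the approximants are binomial partial sums in [y]. The odd power
    lets [pos_cos] cancel the negative part. *)
Lemma jackson_abs_cos (m : nat) (k : Z) t : exists C,
  jackson m (fun x : W => `|wave k t x| ^+ (m.*2.+3)) C.
Proof.
pose s : R := m.*2.+3%:R / 2.
have s0 : 0 < s by rewrite divr_gt0.
have ms : m.+1%:R <= s.
  by rewrite /s ler_pdivlMr// -natrM ler_nat; lia.
have [C C0 hC] := bsum_uniform s0 ms.
pose y (x : W) := 1 - wave k t x ^+ 2.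
have y01 x : 0 <= y x <= 1.
  have : wave k t x ^+ 2 <= 1.
    by rewrite -[leRHS](expr1n _ 2) -real_normK ?num_real// lerXn2r ?nnegrE ?wave_le1.
  by rewrite /y; have := sqr_ge0 (wave k t x); lra.
have fE x : `|wave k t x| ^+ m.*2.+3 = (1 - y x) `^ s.
  rewrite /y subKr -real_normK ?num_real// -[LHS]powR_mulrn// -[in RHS]powR_mulrn//.
  by rewrite -powRrM /s mulrCA divff ?mulr1// pnatr_eq0.
pose D := ((l1deg k).+1 * 2).+2.
have ty : tpoly D y.
  have tw : tpoly (l1deg k).+1 (wave k t : W -> R) by exact: tpoly_wave.
  apply: (@tpoly_ext _ _ _ (fun x => 1 + (-1) * wave k t x ^+ 2)).
    by move=> x; rewrite mulN1r.
  apply: tpolyD; first by apply: tpolyW (tpoly_cst _ _).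
  by apply: tpolyZ; apply: tpolyW (tpolyX 2 tw); rewrite /D; lia.
have tb K : tpoly (D * K).+1 (fun x => bsum s K (y x)).
  rewrite /bsum; apply: tpoly_sum => i; apply: tpolyZ.
  by apply: tpolyW (tpolyX i ty); rewrite ltnS leq_mul2l; have := ltn_ord i; lia.
have D0 : 1 <= D.+1%:R ^+ m :> R by rewrite exprn_ege1// ler1n.
exists (D.+1%:R ^+ m + C * (4 * D)%:R ^+ m.+1) => d.
have [dD|Dd] := leqP d D.
  exists (fun=> 0) => [|x]; first exact: tpoly0.
  rewrite subr0 ger0_norm ?exprn_ge0// ler_pdivlMr ?exprn_gt0//.
  apply: (@le_trans _ _ (1 * D.+1%:R ^+ m)).
    by apply: ler_pM; rewrite ?exprn_ge0 ?exprn_ile1 ?wave_le1// lerXn2r ?nnegrE// ler_nat.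
  by rewrite mul1r lerDl mulr_ge0 ?exprn_ge0.
(* The largest [K] with [D K + 1 <= d], the degree allowed by [tb]; it is positive because
   [d > D]. *)
pose K := (d.-1 %/ D)%N.
have K0 : (0 < K)%N by rewrite divn_gt0; lia.
have KE : (d.+1 <= 4 * D * K)%N.
  have := divn_eq d.-1 D; have := ltn_pmod d.-1 (isT : (0 < D)%N); rewrite -/K.
  have : (D <= K * D)%N by rewrite leq_pmull.
  by move: (d.-1 %% D)%N (K * D)%N (mulnC K D) => r kd e; rewrite -mulnA -e; lia.
exists (fun x => bsum s K (y x)) => [|x].
  by apply: tpolyW (tb K); have := leq_trunc_div d.-1 D; rewrite -/K mulnC; lia.
rewrite fE; apply: le_trans (hC _ _ (y01 x) K0) _.
rewrite ler_pdivlMr ?exprn_gt0// mulrAC ler_pdivrMr ?exprn_gt0 ?ltr0n//.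
rewrite mulrDl; apply: (@le_trans _ _ (C * (4 * D)%:R ^+ m.+1 * K%:R ^+ m.+1)).
  rewrite -mulrA ler_wpM2l// -exprMn -natrM.
  apply: (@le_trans _ _ (d.+1%:R ^+ m.+1)); first by rewrite ler_weXn2l// ler1n.
  by rewrite lerXn2r ?nnegrE// ler_nat.
by rewrite lerDr mulr_ge0 ?exprn_ge0.
Qed.

Definition pos_cos (m : nat) (k : Z) (x : W) : R :=
  2^-1 * (wave k 0 x ^+ m.*2.+3 + `|wave k 0 x| ^+ m.*2.+3).

Lemma jackson_pos_cos m k : exists C, jackson m (pos_cos m k) C.
Proof.
have [C1 j1] := jackson_abs_cos m k 0.
have tw : tpoly (l1deg k).+1 (wave k 0 : W -> R) by exact: tpoly_wave.
have [C2 j2] := jackson_tpoly m (tpolyX m.*2.+3 tw).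
by exists (`|2^-1| * (C2 + C1)); apply/jacksonZ/jacksonD.
Qed.

Lemma pos_cosE m k x : pos_cos m k x =
  if 0 < wave k 0 x then wave k 0 x ^+ m.*2.+3 else 0.
Proof.
rewrite /pos_cos; case: ltP => h; first by rewrite gtr0_norm//; field.
rewrite ler0_norm// [X in _ + X]exprNn -signr_odd /= odd_double /= expr1.
by rewrite mulN1r subrr mulr0.
Qed.

Definition dyadic (l : nat) (i : 'I_n) : Z := (2 ^ l)%:Z *: delta_mx 0 i.

Lemma wave_dyadic l i (x : W) : wave (dyadic l i) 0 x = cos ((2 ^ l)%:R * x 0 i).
Proof.
rewrite /wave addr0 /freq_dot (bigD1 i)//= big1 ?addr0 => [|j ji].
  by rewrite !mxE !eqxx mulr1.
by rewrite !mxE eqxx (negbTE ji) mulr0 mul0r.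
Qed.

(** The factor [l = 0] alone is supported on half a period of its coordinate; the further dyadic
    frequencies shrink the support around 0, and the value at 0 stays 1. *)
Definition cos_bump (m L : nat) (x : W) : R :=
  \prod_(i < n) \prod_(l < L.+1) pos_cos m (dyadic l i) x.

Lemma cos_bump_ge0 m L x : 0 <= cos_bump m L x.
Proof.
apply: prodr_ge0 => i _; apply: prodr_ge0 => l _.
by rewrite pos_cosE; case: ltP => // h; rewrite exprn_ge0// ltW.
Qed.

Lemma cos_bump0 m L : cos_bump m L 0 = 1.
Proof.
rewrite /cos_bump big1// => i _; rewrite big1// => l _.
by rewrite pos_cosE wave_dyadic mxE mulr0 cos0 ltr01 expr1n.
Qed.

Lemma jackson_cos_bump m L : exists C, jackson m (cos_bump m L) C.
Proof.
apply: jackson_prod => i; apply: jackson_prod => l; exact: jackson_pos_cos.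
Qed.

(* If cos (2 ^ l t) > 0 for all l <= L, each doubling at least doubles
   1 - cos, so 1 - cos t <= 2 ^- L. *)
Lemma cos_bump_support m L x : cos_bump m L x != 0 ->
  forall i, 1 - cos (x 0 i) <= 2^-1 ^+ L.
Proof.
move=> bx i.
have pos l : (l <= L)%N -> 0 < cos ((2 ^ l)%:R * x 0 i).
  move=> lL; move: bx; rewrite /cos_bump => /prodf_neq0/(_ i isT)/prodf_neq0.
  have lL' : (l < L.+1)%N by [].
  move=> /(_ (Ordinal lL') isT); rewrite pos_cosE wave_dyadic.
  by case: ltP => //; rewrite eqxx.
suff h l : (l <= L)%N -> 1 - cos (x 0 i) <= 2^-1 ^+ l * (1 - cos ((2 ^ l)%:R * x 0 i)).
  apply: le_trans (h L (leqnn L)) _; rewrite ler_piMr ?exprn_ge0//.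
  by have := pos L (leqnn L); lra.
elim: l => [|l IH] lL; first by rewrite expr0 mul1r expn0 mul1r.
apply: le_trans (IH (ltnW lL)) _; rewrite exprSr -mulrA ler_wpM2l ?exprn_ge0//.
have := pos l (ltnW lL); have := cos_le1 ((2 ^ l)%:R * x 0 i).
have -> : (2 ^ l.+1)%:R * x 0 i = ((2 ^ l)%:R * x 0 i) *+ 2.
  by rewrite -mulr_natr expnS natrM; ring.
rewrite cos_mulr2n; set c := cos _; rewrite -mulr_natr expr2; nra.
Qed.

End bumps.

(** * Interior regularity *)

Section symbol.
Context (R : realType) (n : nat).
Local Notation Z := 'rV[int]_n.
Local Notation W := 'rV[R]_n.
Implicit Types (k l nu : Z).

Definition sq k : R := \sum_i (k 0 i)%:~R ^+ 2.

Definition dotZ k l : R := \sum_i (k 0 i)%:~R * (l 0 i)%:~R.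

Lemma sq_ge0 k : 0 <= sq k.
Proof. by apply: sumr_ge0 => i _; exact: sqr_ge0. Qed.

Lemma freq_normE k : freq_norm R k = Num.sqrt (sq k).
Proof.
by rewrite /freq_norm /enorm; congr Num.sqrt; apply: eq_bigr => i _; rewrite mxE.
Qed.

Lemma freq_norm_sqr k : freq_norm R k ^+ 2 = sq k.
Proof. by rewrite freq_normE sqr_sqrtr// sq_ge0. Qed.

Lemma freq_norm_ge0 k : 0 <= freq_norm R k.
Proof. by rewrite freq_normE sqrtr_ge0. Qed.

Lemma sqD k l : sq (k + l) = sq k + 2 * dotZ l k + sq l.
Proof.
rewrite /sq /dotZ big_distrr/= -!big_split/=; apply: eq_bigr => i _.
by rewrite mxE rmorphD/=; ring.
Qed.

Lemma sqN k : sq (- k) = sq k.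
Proof. by apply: eq_bigr => i _; rewrite mxE rmorphN sqrrN. Qed.

Lemma coord_le_jp k i : `|(k 0 i)%:~R : R| <= jp R k.
Proof.
rewrite -intr_norm -natr_absz /jp ler_nat /l1deg (bigD1 i)//=.
by rewrite addnCA leq_addr.
Qed.

Lemma sum_abs_le_jp k : \sum_i `|(k 0 i)%:~R : R| <= jp R k.
Proof.
rewrite /jp natrD natr_sum; apply: ler_wpDl => //.
by apply: ler_sum => i _; rewrite -intr_norm -natr_absz.
Qed.

Lemma sq_le_jp k : sq k <= jp R k ^+ 2.
Proof.
apply: (@le_trans _ _ (\sum_i `|(k 0 i)%:~R : R| * jp R k)).
  apply: ler_sum => i _; rewrite -real_normK ?num_real// expr2 ler_wpM2l//.
  exact: coord_le_jp.
by rewrite -mulr_suml expr2 ler_wpM2r ?sum_abs_le_jp// ltW// jp_gt0.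
Qed.

Lemma freq_norm_le_jp k : freq_norm R k <= jp R k.
Proof.
rewrite freq_normE -(@ler_pXn2r _ 2)// ?nnegrE ?sqrtr_ge0 ?(ltW (jp_gt0 _ _))//.
by rewrite sqr_sqrtr ?sq_ge0// sq_le_jp.
Qed.

Lemma coord_le_norm k i : `|(k 0 i)%:~R : R| <= freq_norm R k.
Proof.
rewrite -(@ler_pXn2r _ 2)// ?nnegrE ?freq_norm_ge0// freq_norm_sqr.
rewrite real_normK ?num_real// /sq (bigD1 i)//= lerDl; apply: sumr_ge0 => j _.
exact: sqr_ge0.
Qed.

Lemma freq_norm_ge1 k : k != 0 -> 1 <= freq_norm R k.
Proof.
move=> k0; have [i ki] : exists i, k 0 i != 0.
  apply/existsP; apply: contraNT k0; rewrite negb_exists => /forallP h.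
  by apply/eqP/rowP => i; rewrite mxE; apply/eqP; have := h i; rewrite negbK.
apply: le_trans (coord_le_norm k i); rewrite -intr_norm -natr_absz ler1n.
by rewrite absz_gt0.
Qed.

Lemma jp_le_norm k : k != 0 -> jp R k <= n.+1%:R * freq_norm R k.
Proof.
move=> k0; rewrite /jp natrD natr_sum -[n.+1%:R]natr1 mulrDl mul1r addrC.
apply: lerD; last exact: freq_norm_ge1.
apply: (@le_trans _ _ (\sum_(i < n) freq_norm R k)).
  apply: ler_sum => i _; apply: le_trans (coord_le_norm k i).
  by rewrite -intr_norm -natr_absz.
by rewrite sumr_const card_ord mulr_natl.
Qed.

Lemma dotZ_le k l : `|dotZ k l| <= jp R k * freq_norm R l.
Proof.
apply: le_trans (ler_norm_sum _ _ _) _.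
apply: (@le_trans _ _ (\sum_i `|(k 0 i)%:~R : R| * freq_norm R l)).
  by apply: ler_sum => i _; rewrite normrM ler_wpM2l// coord_le_norm.
by rewrite -mulr_suml ler_wpM2r ?freq_norm_ge0// sum_abs_le_jp.
Qed.

Definition shift_ratio nu k : R := - (sq k + 2 * dotZ k nu) / sq nu.

Lemma sq_shift nu k : nu != 0 -> sq (nu + k) = sq nu * (1 - shift_ratio nu k).
Proof.
move=> nu0; have N1 := freq_norm_ge1 nu0.
have s0 : sq nu != 0 by rewrite -freq_norm_sqr expf_neq0// gt_eqF//; lra.
by rewrite sqD /shift_ratio; field.
Qed.

(** The leading part is [2 k.nu / |nu|^2], of first order in [1 / |nu|]; the price is quadratic in
    [jp k]. *)
Lemma shift_ratio_le nu k : nu != 0 ->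
  `|shift_ratio nu k| <= 3 * jp R k ^+ 2 / freq_norm R nu.
Proof.
move=> nu0; have N1 := freq_norm_ge1 nu0.
have N0 : 0 < freq_norm R nu by lra.
have J1 := jp_ge1 R k; have J0 := jp_gt0 R k.
rewrite /shift_ratio normrM normrN normfV -(freq_norm_sqr nu).
rewrite (ger0_norm (exprn_ge0 2 (ltW N0))) ler_pdivrMr ?exprn_gt0//.
rewrite [freq_norm R nu ^+ 2]expr2 mulrA divfK ?gt_eqF//.
apply: le_trans (ler_normD _ _) _; rewrite normrM (ger0_norm (sq_ge0 k)) ger0_norm//.
apply: (@le_trans _ _ (jp R k ^+ 2 * freq_norm R nu + 2 * (jp R k ^+ 2 * freq_norm R nu))).
  apply: lerD.
    by apply: le_trans (sq_le_jp k) _; rewrite ler_peMr// exprn_ge0// ltW.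
  rewrite ler_wpM2l//; apply: le_trans (dotZ_le _ _) _.
  by rewrite ler_wpM2r ?(ltW N0)// expr2 ler_peMr// ltW.
by rewrite le_eqVlt; apply/orP; left; apply/eqP; ring.
Qed.

Lemma bsum_le (s : R) J (y B : R) : 1 <= B -> `|y| <= B ->
  `|bsum s J y| <= (\sum_(k < J.+1) `|bcoef s k|) * B ^+ J.
Proof.
move=> B1 yB; apply: le_trans (ler_norm_sum _ _ _) _.
rewrite mulr_suml; apply: ler_sum => i _; rewrite normrM ler_wpM2l// normrX.
apply: (@le_trans _ _ (B ^+ i)); first by rewrite lerXn2r ?nnegrE//; lra.
by rewrite ler_weXn2l//; have := ltn_ord i; lia.
Qed.

Definition symb (sigma : R) k : R := freq_norm R k `^ sigma.

Lemma symbE sigma k : symb sigma k = sq k `^ (sigma / 2).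
Proof.
by rewrite /symb freq_normE -powR12_sqrt ?sq_ge0// -powRrM mulrC.
Qed.

(** Two regimes. If [3 jp(k)^2 / |nu| <= 1 / 2], the binomial remainder applies. Otherwise
    [6 jp(k)^2 / |nu| >= 1], so crude bounds for the power and the partial sum may be multiplied by
    the power [J + 1] of this quantity; this case dictates the exponent [4 (J + 1)]. *)
Lemma symb_remainder (sigma : R) (J : nat) : 0 < sigma <= 2 ->
  exists2 C, 0 <= C & forall nu k, nu != 0 ->
  `|symb sigma (nu + k) - symb sigma nu * bsum (sigma / 2) J (shift_ratio nu k)|
  <= symb sigma nu * (C * jp R k ^+ (4 * J.+1) / jp R nu ^+ J.+1).
Proof.
move=> /andP[sg0 sg2]; set s := sigma / 2.
have s0 : 0 < s by rewrite divr_gt0.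
have s1 : s <= 1 by rewrite /s; lra.
pose B := \sum_(k < J.+1) `|bcoef s k|.
have B0 : 0 <= B by apply: sumr_ge0.
pose C1 := 2 `^ s * (`|s - J%:R| * `|bcoef s J| * 2 `^ (s + 1)) * 3 ^+ J.+1.
pose C2 := (4 + B * 3 ^+ J) * 6 ^+ J.+1.
have C10 : 0 <= C1 by rewrite !mulr_ge0 ?powR_ge0 ?exprn_ge0.
have C20 : 0 <= C2 by rewrite mulr_ge0 ?exprn_ge0// addr_ge0// mulr_ge0 ?exprn_ge0.
exists ((C1 + C2) * n.+1%:R ^+ J.+1).
  by rewrite mulr_ge0 ?exprn_ge0// addr_ge0.
move=> nu k nu0.
have N1 := freq_norm_ge1 nu0; set N := freq_norm R nu in N1.
have N0 : 0 < N by lra.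
have J1 := jp_ge1 R k; have J0 := jp_gt0 R k; set j := jp R k in J1 J0 *.
have Jn0 := jp_gt0 R nu.
set y := shift_ratio nu k.
have yr : `|y| <= 3 * j ^+ 2 / N by exact: shift_ratio_le.
have j21 : 1 <= j ^+ 2 by rewrite exprn_ege1.
have fac : symb sigma (nu + k) = symb sigma nu * (1 - y) `^ s.
  rewrite !symbE sq_shift// powRM ?sq_ge0//.
  have := sq_ge0 (nu + k); rewrite sq_shift// pmulr_rge0// -(freq_norm_sqr nu).
  by rewrite exprn_gt0.
have y1 : 0 <= 1 - y.
  have := sq_ge0 (nu + k); rewrite sq_shift// pmulr_rge0// -(freq_norm_sqr nu).
  by rewrite exprn_gt0.
rewrite fac -mulrBr normrM (ger0_norm (powR_ge0 _ _)) ler_wpM2l ?powR_ge0//.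
have NJ : N ^- J.+1 <= n.+1%:R ^+ J.+1 / jp R nu ^+ J.+1.
  rewrite -[leLHS]mul1r ler_pdivrMr ?exprn_gt0// mulrAC ler_pdivlMr ?exprn_gt0//.
  rewrite mul1r -exprMn lerXn2r ?nnegrE ?mulr_ge0 ?(ltW N0) ?(ltW Jn0)//.
  exact: jp_le_norm.
suff main : `|(1 - y) `^ s - bsum s J y| <= (C1 + C2) * j ^+ (4 * J.+1) * N ^- J.+1.
  apply: le_trans main _.
  have -> : (C1 + C2) * n.+1%:R ^+ J.+1 * j ^+ (4 * J.+1) / jp R nu ^+ J.+1 =
    (C1 + C2) * j ^+ (4 * J.+1) * (n.+1%:R ^+ J.+1 / jp R nu ^+ J.+1) by ring.
  by rewrite ler_wpM2l// mulr_ge0 ?addr_ge0// exprn_ge0// ltW.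
have [small|big] := leP (3 * j ^+ 2 / N) (2^-1).
  rewrite distrC; apply: le_trans (bsum_remainder s0 J yr _) _.
    by move: small; clear; lra.
  set r := 3 * j ^+ 2 / N in yr small *.
  have r0 : 0 <= r by rewrite divr_ge0 ?mulr_ge0 ?exprn_ge0 ?(ltW N0)// ltW.
  apply: (@le_trans _ _ (C1 * j ^+ (4 * J.+1) * N ^- J.+1)); last first.
    by rewrite ler_wpM2r ?invr_ge0 ?exprn_ge0 ?(ltW N0)// ler_wpM2r ?exprn_ge0 ?(ltW J0)// lerDl.
  apply: (@le_trans _ _ (2 `^ s * (`|s - J%:R| * `|bcoef s J| * 2 `^ (s + 1)) * r ^+ J.+1)).
    have r1 : 0 < 1 - r by move: small; clear; lra.
    have wz : (1 - r) `^ (- s - 1) <= 2 `^ (s + 1).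
      have -> : - s - 1 = - (s + 1) by ring.
      rewrite powRN -[leLHS]mul1r ler_pdivrMr ?powR_gt0// -powRM//; last exact: ltW.
      have e1 : 1 `^ (s + 1) = 1 :> R by rewrite powR1.
      rewrite -[leLHS]e1 ge0_ler_powR ?nnegrE//; first by rewrite addr_ge0// ltW.
        by rewrite mulr_ge0// ltW.
      by move: small; clear; lra.
    have E0 : 0 <= 2 `^ s * (`|s - J%:R| * `|bcoef s J|) by rewrite mulr_ge0 ?powR_ge0.
    move: wz (powR_ge0 (1 - r) (- s - 1)) E0.
    move: ((1 - r) `^ _) (2 `^ (s + 1)) (2 `^ s) `|s - J%:R| `|bcoef s J|.
    move=> w z A P Q wz w0 E0.
    have -> : A * (P * Q * r ^+ J * w * `|y|) = A * (P * Q) * (w * (r ^+ J * `|y|)) by ring.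
    have -> : A * (P * Q * z) * r ^+ J.+1 = A * (P * Q) * (z * (r ^+ J * r)).
      by rewrite exprSr; ring.
    rewrite ler_wpM2l//; apply: ler_pM; rewrite ?mulr_ge0 ?exprn_ge0//.
    by rewrite ler_wpM2l// exprn_ge0.
  rewrite /C1; set E := 2 `^ s * _.
  have E0 : 0 <= E by rewrite !mulr_ge0 ?powR_ge0.
  have -> : E * 3 ^+ J.+1 * j ^+ (4 * J.+1) / N ^+ J.+1 =
    E * (3 ^+ J.+1 * (j ^+ (4 * J.+1) / N ^+ J.+1)) by ring.
  rewrite ler_wpM2l// /r !exprMn exprVn -mulrA ler_wpM2l ?exprn_ge0//.
  rewrite ler_wpM2r ?invr_ge0 ?exprn_ge0 ?(ltW N0)// -exprD ler_weXn2l//; clear; lia.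
have N6 : 1 <= 6 * j ^+ 2 / N.
  rewrite ler_pdivlMr// mul1r; move: big; rewrite ltr_pdivlMr//.
  by clear; move: (j ^+ 2) => z; lra.
have y4 : 1 - y <= 4 * j ^+ 2.
  have : `|y| <= 3 * j ^+ 2.
    by apply: le_trans yr _; rewrite ler_pdivrMr// ler_peMr// mulr_ge0// exprn_ge0// ltW.
  rewrite ler_norml => /andP[+ _]; move: j21; clear; move: (j ^+ 2) => z; lra.
apply: (@le_trans _ _ ((4 + B * 3 ^+ J) * j ^+ (2 * J.+1))).
  apply: le_trans (ler_normB _ _) _; rewrite mulrDl; apply: lerD.
    rewrite ger0_norm ?powR_ge0//; apply: (@le_trans _ _ ((4 * j ^+ 2) `^ s)).
      by rewrite ge0_ler_powR ?nnegrE ?(ltW s0)// mulr_ge0// exprn_ge0// ltW.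
    apply: le_trans (ler1_powR _ s1) _.
      by move: j21; clear; move: (j ^+ 2) => z; lra.
    by rewrite ler_wpM2l// ler_weXn2l//; clear; lia.
  have yB : `|y| <= 3 * j ^+ 2.
    by apply: le_trans yr _; rewrite ler_pdivrMr// ler_peMr// mulr_ge0// exprn_ge0// ltW.
  apply: le_trans (bsum_le s J _ yB) _.
    by move: j21; clear; move: (j ^+ 2) => z; lra.
  rewrite -/B exprMn mulrA ler_wpM2l ?mulr_ge0 ?exprn_ge0// -exprM.
  by rewrite ler_weXn2l//; clear; lia.
apply: (@le_trans _ _ (C2 * j ^+ (4 * J.+1) * N ^- J.+1)); last first.
  by rewrite ler_wpM2r ?invr_ge0 ?exprn_ge0 ?(ltW N0)// ler_wpM2r ?exprn_ge0 ?(ltW J0)// lerDr.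
have -> : C2 * j ^+ (4 * J.+1) * N ^- J.+1 =
    (4 + B * 3 ^+ J) * j ^+ (2 * J.+1) * (6 * j ^+ 2 / N) ^+ J.+1.
  rewrite /C2 expr_div_n [(6 * _) ^+ _]exprMn -exprM
    (_ : (4 * J.+1 = 2 * J.+1 + 2 * J.+1)%N); last by clear; lia.
  by rewrite exprD; ring.
rewrite ler_peMr ?exprn_ege1//.
by rewrite mulr_ge0 ?exprn_ge0 ?(ltW J0)// addr_ge0// mulr_ge0// exprn_ge0.
Qed.

End symbol.

(** * Local regularity of s-harmonic functions *)

Section zsum_more.
Context (R : realType) (n : nat).
Local Notation Z := 'rV[int]_n.
Implicit Types (u : Z -> R) (C : R).

(** The enumeration behind [zsum] is not symmetric, so both sides are first written as limits over
    the symmetric finite sets [s N]. *)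
Lemma zsum_opp u C : zdom u C -> zsum (fun k => u (- k)) = zsum u.
Proof.
move=> uC; pose l N := pmap (@pickle_inv Z) (iota 0 N).
pose s N := undup (l N ++ map -%R (l N)).
have sN N k : (- k \in s N) = (k \in s N).
  rewrite !mem_undup !mem_cat orbC; congr (_ || _).
    by rewrite (mem_map oppr_inj).
  by rewrite -[X in _ = X](mem_map oppr_inj)// -map_comp (eq_map (g := id)) ?map_id// => j /=; rewrite opprK.
have ls k : \forall N \near \oo, k \in s N.
  near=> N; rewrite mem_undup mem_cat mem_pmap; apply/orP; left.
  apply/mapP; exists (choice.pickle k); last by rewrite pickleK_inv.
  by rewrite mem_iota add0n; near: N; exact: nbhs_infty_gt.
have dom (v : Z -> R) : zdom v C -> zsum (fun k => if k \in s N then v k else 0) @[N --> \oo] --> zsum v.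
  move=> vC; apply: zsum_dominated_cvg.
    near=> N => k; case: ifP => // _; rewrite normr0.
    by rewrite mulr_ge0 ?(zdom_ge0 uC)// ltW// wt_gt0.
  move=> k; apply: cvg_near_cst; near=> N.
  by case: ifPn => //; rewrite (near (ls k) N).
have uN : zdom (fun k => u (- k)) C.
  by move=> k; have := uC (- k); rewrite /wt jpN.
apply: (cvg_unique _ (dom _ uN)) => //.
rewrite (_ : (fun N => _) = fun N => zsum (fun k => if k \in s N then u k else 0)).
  exact: dom.
apply/funext => N.
rewrite (@zsum_seq _ _ (s N)) ?undup_uniq//; last by move=> k /negbTE ->.
rewrite (@zsum_seq _ _ (s N)) ?undup_uniq//; last by move=> k /negbTE ->.
rewrite [RHS](perm_big (map -%R (s N)))/=; last first.
  apply: uniq_perm; first exact: undup_uniq.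
    by rewrite (map_inj_uniq oppr_inj) undup_uniq.
  by move=> k; rewrite -[k]opprK (mem_map oppr_inj) sN.
by rewrite big_map; apply: eq_bigr => k _; rewrite sN.
Unshelve. all: by end_near. Qed.

Lemma zsum_odd u C : zdom u C -> (forall k, u (- k) = - u k) -> zsum u = 0.
Proof.
move=> uC uN; have := zsum_opp uC; rewrite (zsum_ext uN) (zsumN uC) => /eqP.
by rewrite eq_sym -addr_eq0 -mulr2n -mulr_natl mulf_eq0 pnatr_eq0/= => /eqP.
Qed.

Lemma zsum0 : zsum (fun _ : Z => 0 : R) = 0.
Proof. by rewrite (@zsum_seq _ _ [::])// big_nil. Qed.

Lemma zsum_sum I (s : seq I) (u : I -> Z -> R) (C : I -> R) :
  (forall i, zdom (u i) (C i)) ->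
  zsum (fun k => \sum_(i <- s) u i k) = \sum_(i <- s) zsum (u i).
Proof.
move=> uC; suff [_ ->] : zdom (fun k => \sum_(i <- s) u i k) (\sum_(i <- s) C i) /\
  zsum (fun k => \sum_(i <- s) u i k) = \sum_(i <- s) zsum (u i) by [].
elim: s => [|i s [IHd IH]].
  rewrite !big_nil; split; last by rewrite -[RHS]zsum0; apply: zsum_ext => k; rewrite big_nil.
  by move=> k; rewrite big_nil normr0 mul0r.
rewrite !big_cons; split.
  by have := zdomD (uC i) IHd; move=> h k; rewrite big_cons; exact: h.
rewrite -IH -(zsumD (uC i) IHd); apply: zsum_ext => k; exact: big_cons.
Qed.

End zsum_more.

Lemma lipschitz1 (R : realType) (f f' : R -> R) (a b : R) :
  (forall x : R, is_derive x (1 : R) f (f' x)) -> (forall x, `|f' x| <= 1) ->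
  `|f a - f b| <= `|a - b|.
Proof.
move=> df f1; wlog ab : a b / a <= b.
  by move=> h; have [/h//|/ltW/h] := leP a b; rewrite distrC [leRHS]distrC.
rewrite distrC [leRHS]distrC.
have [|c _ ->] := @MVT_segment R f f' a b ab.
  by apply: derivable_within_continuous => x _; exact: (@ex_derive _ _ _ _ _ _ _ (df x)).
by rewrite normrM ler_piMl.
Qed.

Lemma sin_norm_le (R : realType) (x : R) : `|sin x| <= `|x|.
Proof.
by have := @lipschitz1 R sin cos x 0 (fun x => is_derive_sin x) (@cos_max R); rewrite sin0 !subr0.
Qed.

Lemma cosB1_norm_le (R : realType) (x : R) : `|cos x - 1| <= `|x|.
Proof.
have := @lipschitz1 R cos (fun x => - sin x) x 0 (fun x => is_derive_cos x).
by rewrite cos0 subr0; apply => y; rewrite normrN; exact: sin_max.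
Qed.

Section slopes.
Variables (R : realType) (c : R).

Lemma cos_slope : h^-1 * (cos (h * c) - 1) @[h --> 0^'] --> (0 : R).
Proof.
have dd : is_derive (0 : R) (1 : R) (fun h => cos (h * c)) 0.
  by apply: is_derive_eq; rewrite !(mul0r, sin0, oppr0, scale0r, scaler0).
have := @ex_derive _ _ _ _ _ _ _ dd; rewrite /derivable => dd'.
have := @derive_val _ _ _ _ _ _ _ dd; rewrite /derive => e0.
move/cvg_ex : dd' => [l hl]; move: (hl) => /cvg_lim; rewrite e0 => /(_ (@norm_hausdorff _ _)) l0.
rewrite -l0 in hl; apply: cvg_trans hl; apply: near_eq_cvg; near=> h.
by rewrite /= mul0r cos0 /GRing.scale/= addr0 mulr1.
Unshelve. all: by end_near. Qed.

Lemma sin_slope : h^-1 * sin (h * c) @[h --> 0^'] --> c.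
Proof.
have dd : is_derive (0 : R) (1 : R) (fun h => sin (h * c)) c.
  by apply: is_derive_eq; rewrite !(mul0r, cos0, oppr0, scale0r, scaler0, add0r, addr0, mulr1, scale1r) /GRing.scale/= ?mulr1 ?mul1r.
have := @ex_derive _ _ _ _ _ _ _ dd; rewrite /derivable => dd'.
have := @derive_val _ _ _ _ _ _ _ dd; rewrite /derive => e0.
move/cvg_ex : dd' => [l hl]; move: (hl) => /cvg_lim; rewrite e0 => /(_ (@norm_hausdorff _ _)) l0.
rewrite -l0 in hl; apply: cvg_trans hl; apply: near_eq_cvg; near=> h.
by rewrite /= mul0r sin0 subr0 /GRing.scale/= addr0 mulr1.
Unshelve. all: by end_near. Qed.

End slopes.

(** * Decay of the coefficients of a localised solution *)

Section regularity.
Context (R : realType) (n : nat).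
Local Notation Z := 'rV[int]_n.
Local Notation T := (torus R n).
Local Notation mu := (torus_measure (R := R) (n := n)).
Local Notation V := ((2 * pi : R) ^+ n).
Variables (v : T -> R) (D : R) (P : nat).
Hypothesis v1 : L1 v.
Hypothesis vD : forall k t, `|ft v k t| <= D / jp R k ^+ (2 * n + P).
Implicit Types (k nu : Z) (t th : R) (q : Z -> R).

(* On the frequency side these weights are the partial derivatives of [synth v]. *)
Inductive mono : nat -> (Z -> R) -> Prop :=
| mono1 : mono 0 (fun=> 1)
| monoM d q i : mono d q -> mono d.+1 (fun k => q k * (k 0 i)%:~R).

Lemma mono_le d q k : mono d q -> `|q k| <= jp R k ^+ d.
Proof.
elim=> [|{}d {}q i _ IH]; first by rewrite normr1 expr0.
by rewrite normrM exprSr ler_pM// coord_le_jp.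
Qed.

Let D0 : 0 <= D.
Proof. by have := vD 0 0; rewrite jp0 expr1n divr1; exact: le_trans. Qed.

(** The [P] spare powers in the decay of the coefficients absorb polynomial weights of degree up to
    [P]. *)
Lemma zdom_weight A e q (c : Z -> R) B : (forall k, `|q k| <= A * jp R k ^+ e) -> (e <= P)%N ->
  0 <= A -> 0 <= B -> (forall k, `|c k| <= B / jp R k ^+ (2 * n + P)) ->
  zdom (fun k => q k * c k) (A * B).
Proof.
move=> qA eP A0 B0 cB k; rewrite normrM.
apply: (@le_trans _ _ (A * jp R k ^+ P * (B / jp R k ^+ (2 * n + P)))).
  apply: ler_pM => //; apply: le_trans (qA k) _.
  by rewrite ler_wpM2l// ler_weXn2l// jp_ge1.
have jP : jp R k ^+ P != 0 by rewrite expf_neq0// gt_eqF// jp_gt0.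
have jn : jp R k ^+ (2 * n) != 0 by rewrite expf_neq0// gt_eqF// jp_gt0.
rewrite /wt exprD le_eqVlt; apply/orP; left; apply/eqP.
by move: jP jn; move: (_ ^+ P) (_ ^+ (2 * n)) => y z y0 z0; field; rewrite y0 z0.
Qed.

(** A derivative of [synth v] with all phases turned by [th]. Each differentiation shifts the phase
    by [pi / 2], so keeping [th] free treats even and odd orders alike. *)
Definition esum_at q th (x : 'rV[R]_n) : R :=
  zsum (fun k => q k * ft v k (- freq_dot k x - th)).

Lemma zdom_esum d q th x : mono d q -> (d <= P)%N ->
  zdom (fun k => q k * ft v k (- freq_dot k x - th)) (1 * D).
Proof.
move=> mq dP; apply: (zdom_weight (e := d)) => //.
by move=> k; rewrite mul1r; exact: mono_le.
Qed.

Lemma ft_shift k a b : ft v k (a - b) = cos b * ft v k a + sin b * ft v k (a - pi / 2).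
Proof.
rewrite (ftE _ (a - b))// (ftE _ a)// (ftE _ (a - pi / 2))//.
by rewrite cosB sinB cosBpihalf sinBpihalf; ring.
Qed.

(** Inside [U] the difference quotients vanish. Termwise they converge to the series with the extra
    factor [k_i] and the phase advanced by [pi / 2], and [d < P] leaves the power of [jp] needed to
    dominate them. *)
Lemma vanish_step (U : set 'rV[R]_n) d q i : open U -> mono d q -> (d < P)%N ->
  (forall x th, U x -> esum_at q th x = 0) ->
  forall x th, U x -> esum_at (fun k => q k * (k 0 i)%:~R) th x = 0.
Proof.
move=> oU mq dP E0 x th' Ux; pose th := th' - pi / 2.
pose e : 'rV[R]_n := delta_mx 0 i.
pose F (h : R) k := h^-1 * (q k * ft v k (- freq_dot k (x + h *: e) - th)
   - q k * ft v k (- freq_dot k x - th)).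
have FE h k : F h k = q k * (h^-1 * (cos (h * (k 0 i)%:~R) - 1) * ft v k (- freq_dot k x - th) +
     h^-1 * sin (h * (k 0 i)%:~R) * ft v k (- freq_dot k x - th - pi / 2)).
  rewrite /F freq_dotD freq_dotZ freq_dot_delta.
  rewrite (_ : - (_ + _) - th = (- freq_dot k x - th) - h * (k 0 i)%:~R); last by ring.
  by rewrite ft_shift; ring.
have cF k : F h k @[h --> 0^'] --> q k * (k 0 i)%:~R * ft v k (- freq_dot k x - th').
  under eq_fun do rewrite FE.
  rewrite -mulrA; apply: cvgMr.
  pose c : R := (k 0 i)%:~R; rewrite -/c.
  have dc := @cos_slope R c; have ds := @sin_slope R c.
  rewrite (_ : _ - th' = - freq_dot k x - th - pi / 2); last by rewrite /th; ring.
  rewrite -[X in _ --> X]add0r -[X in _ --> X + _](mul0r (ft v k (- freq_dot k x - th))).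
  by apply: cvgD; apply: cvgMl.
have dF : \forall h \near 0^', zdom (F h) (2 * D).
  near=> h; have h0 : h != 0 by near: h; exact: nbhs_dnbhs_neq.
  move=> k; rewrite FE.
  have hh (z : R) : `|z| <= `|h * (k 0 i)%:~R| -> `|h^-1 * z| <= jp R k.
    rewrite !normrM normfV => zh; rewrite mulrC ler_pdivrMr ?normr_gt0//.
    by apply: le_trans zh _; rewrite mulrC ler_wpM2r// coord_le_jp.
  have D2 : 0 <= 2 * D by rewrite mulr_ge0.
  have Dj j : 0 <= 2 * D / jp R j ^+ (2 * n + P) by rewrite divr_ge0 ?exprn_ge0 ?(ltW (jp_gt0 _ _)).
  have hz : zdom (fun k => jp R k ^+ d.+1 * (2 * D / jp R k ^+ (2 * n + P))) (1 * (2 * D)).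
    apply: (zdom_weight (e := d.+1)) => // j; last by rewrite ger0_norm.
    by rewrite mul1r ger0_norm// exprn_ge0// ltW// jp_gt0.
  rewrite -[2 * D]mul1r; apply: le_trans (hz k).
  rewrite normrM [leRHS]ger0_norm; last by rewrite mulr_ge0// exprn_ge0// ltW// jp_gt0.
  rewrite exprSr -[leRHS]mulrA ler_pM//; first exact: mono_le.
  apply: le_trans (ler_normD _ _) _.
  have -> : jp R k * (2 * D / jp R k ^+ (2 * n + P)) = jp R k * (D / jp R k ^+ (2 * n + P)) +
      jp R k * (D / jp R k ^+ (2 * n + P)) by ring.
  apply: lerD; rewrite normrM; apply: ler_pM => //.
    by apply: hh; exact: cosB1_norm_le.
  by apply: hh; exact: sin_norm_le.
have cz := @zsum_dominated_cvg R n _ _ (Proper_dnbhs_numFieldType (0 : R)) _ _ _ dF cF.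
rewrite /esum_at -(cvg_lim (@norm_hausdorff _ _) cz); apply: lim_near_cst => //.
have xU : \forall h \near (0 : R)^', U (x + h *: e).
  apply: nbhs_dnbhs; have : nbhs x U by exact: open_nbhs_nbhs.
  have : x + h *: e @[h --> (0 : R)] --> x.
    suff : x + h *: e @[h --> (0 : R)] --> x + 0 *: e by rewrite scale0r addr0.
    apply: (@cvgD _ _ _ (nbhs (0 : R))); first exact: cvg_cst.
    by apply: cvgZr_tmp; exact: cvg_id.
  by move=> /[apply].
near=> h; rewrite /F (zsumZ _ (zdomB (zdom_esum th (x + h *: e) mq (ltnW dP)) (zdom_esum th x mq (ltnW dP)))).
rewrite (zsumB (zdom_esum th (x + h *: e) mq (ltnW dP)) (zdom_esum th x mq (ltnW dP))).
rewrite -/(esum_at _ _ _) -/(esum_at _ _ _) !E0// ?subrr ?mulr0//.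
by near: h.
Unshelve. all: by end_near. Qed.

(** After expansion of the phase the sine part is odd in [k], so it disappears by [zsum_odd]. *)
Lemma esum_at1 th x : esum_at (fun=> 1) th x = cos th * V * synth v x.
Proof.
have d1 t := @zdom_esum 0 (fun=> 1) t x mono1 (leq0n P).
have E k : 1 * ft v k (- freq_dot k x - th) =
   cos th * (1 * ft v k (- freq_dot k x - 0)) + sin th * (1 * ft v k (- freq_dot k x - pi / 2)).
  by rewrite !mul1r subr0 ft_shift.
rewrite /esum_at (zsum_ext E) (zsumD (zdomZ _ (d1 _)) (zdomZ _ (d1 _))).
rewrite (zsumZ _ (d1 0)) (zsumZ _ (d1 (pi / 2))).
rewrite [zsum (fun k => 1 * ft v k (_ - pi / 2))](zsum_odd (d1 _)) ?mulr0 ?addr0; last first.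
  move=> k; rewrite !mul1r -[LHS]ftN opprK freq_dotNl opprK opprB.
  rewrite (_ : - freq_dot k x - pi / 2 = (pi / 2 - freq_dot k x) - pi); last by rewrite {3}(splitr pi); ring.
  by rewrite ftBpi// opprK.
rewrite -mulrA /synth; congr (_ * _); rewrite mulVKf ?gt_eqF ?volume_gt0//.
by apply: zsum_ext => k; rewrite mul1r subr0.
Qed.

Lemma decay_of_rate : decay v D.
Proof.
move=> k t; apply: le_trans (vD k t) _; rewrite ler_wpM2l//.
by rewrite lef_pV2 ?posrE ?exprn_gt0 ?jp_gt0// ler_weXn2l ?jp_ge1// leq_addr.
Qed.

Lemma L1_mul_synth f : L1 f -> L1 (fun X => f X * synth v (repr X)).
Proof.
move=> f1; apply: (L1_mul f1); last by move=> X; exact: synth_le decay_of_rate.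
apply: measurable_torus_continuous; apply: continuous_torus.
  exact: synth_continuous decay_of_rate.
exact: synth_periodic.
Qed.

Lemma vanish_mono (U : set 'rV[R]_n) d q : open U ->
  (forall x, U x -> synth v x = 0) -> mono d q -> (d <= P)%N ->
  forall x th, U x -> esum_at q th x = 0.
Proof.
move=> oU v0; elim=> [_ x th Ux|{}d {}q i mq IH dP]; first by rewrite esum_at1 v0// mulr0.
refine (@vanish_step U d q i oU mq dP (IH (ltnW dP))).
Qed.

(* The share of the frequency [k] of [v] in the Fourier coefficient of [f v] at [nu]. *)
Definition cross (f : T -> R) nu k t : R :=
  ft v k 0 * ft f (nu + k) t + ft v k (- (pi / 2)) * ft f (nu + k) (t - pi / 2).

Lemma cross_le f nu k t : L1 f ->
  `|cross f nu k t| <= 2 * D * tint (fun X => `|f X|) / jp R k ^+ (2 * n + P).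
Proof.
move=> f1; apply: le_trans (ler_normD _ _) _.
have -> : 2 * D * tint (fun X => `|f X|) / jp R k ^+ (2 * n + P) =
  D / jp R k ^+ (2 * n + P) * tint (fun X => `|f X|) + D / jp R k ^+ (2 * n + P) * tint (fun X => `|f X|) by ring.
by apply: lerD; rewrite normrM ler_pM// ft_le.
Qed.

Lemma esum_termE q nu t X k :
  q k * ft v k (- freq_dot k X - (freq_dot nu X + t)) =
  q k * (ft v k 0 * wave (nu + k) t X + ft v k (- (pi / 2)) * wave (nu + k) (t - pi / 2) X).
Proof.
congr (_ * _); rewrite -[- _ - _]add0r.
rewrite (_ : 0 + _ = 0 - (freq_dot (nu + k) X + t)); last by rewrite freq_dotDl; ring.
by rewrite ft_shift sub0r /wave addrA cosBpihalf; ring.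
Qed.

Lemma measurable_esum_term q nu t k : measurable_fun setT (fun X : T =>
  q k * ft v k (- freq_dot k (repr X) - (freq_dot nu (repr X) + t))).
Proof.
under eq_fun do rewrite esum_termE.
apply: measurable_funM; first exact: measurable_cst.
by apply: measurable_funD; apply: measurable_funM; try exact: measurable_cst; exact: (@measurable_wave R n).
Qed.

Lemma zsum_cross f d q nu t : L1 f -> mono d q -> (d <= P)%N ->
  zsum (fun k => q k * cross f nu k t) =
  tint (fun X => f X * esum_at q (freq_dot nu (repr X) + t) (repr X)).
Proof.
move=> f1 mq dP.
rewrite (@tint_zsum _ _ f _ (1 * D))//.
- apply: zsum_ext => k; rewrite /cross.
  have w1 s := ft_integrand (nu + k) s f1.
  rewrite -!tintZ// -tintD; [|exact: L1Z..]; rewrite -tintZ; last by apply: L1D; exact: L1Z.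
  by apply: eq_tint => X; rewrite esum_termE; ring.
- by move=> k; exact: measurable_esum_term.
- by move=> X; exact: zdom_esum mq dP.
Qed.

Variables (U : set 'rV[R]_n) (sigma : R).
Hypothesis oU : open U.
Hypothesis v0 : forall x, U x -> synth v x = 0.
Hypothesis sigma02 : 0 < sigma <= 2.

(* [(-Delta)^(sigma/2) f = h] vanishes on [~` U], the set on which [synth v] lives. *)
Definition frac_harmonic (f h : T -> R) : Prop :=
  [/\ L1 f, L1 h, forall k t, ft h k t = symb sigma k * ft f k t
    & {ae mu, forall X, h X = 0 \/ U (repr X)}].

(** Here the equation enters: inserting the symbol turns [cross f] into [cross h], and the sum
    becomes the integral of [h] against a derivative of [synth v], which vanishes wherever [h] may
    not. *)
Lemma zsum_symb_cross f h d q nu t : frac_harmonic f h -> mono d q -> (d <= P)%N ->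
  zsum (fun k => q k * (symb sigma (nu + k) * cross f nu k t)) = 0.
Proof.
move=> [f1 h1 hf hU] mq dP.
rewrite (zsum_ext (v := fun k => q k * cross h nu k t)); last first.
  by move=> k; rewrite /cross !hf; ring.
rewrite (zsum_cross _ _ h1 mq dP) -[RHS](mul0r V) -tint_cst; apply: eq_tint_ae.
- apply: measurable_funM; first exact: L1_measurable.
  apply: (@measurable_zsum _ _ _ (1 * D)) => [k|X]; first exact: measurable_esum_term.
  exact: zdom_esum mq dP.
- exact: measurable_cst.
- apply: filterS hU => X [->|UX]; first by rewrite mul0r.
  by rewrite (vanish_mono oU v0 mq dP)// mulr0.
Qed.

Lemma mono2 d q i : mono d q -> mono d.+2 (fun k => q k * (k 0 i)%:~R * (k 0 i)%:~R).
Proof. by move=> mq; do 2 apply: monoM. Qed.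

(** One factor [shift_ratio] is traded for two derivatives with coefficient [1 / |nu|^2] plus one
    derivative with a coefficient of order [1 / |nu|]. *)
Lemma shift_ratioS_sum q nu k j : q k * shift_ratio R nu k ^+ j.+1 =
  \sum_(i < n) - (sq R nu)^-1 * (q k * (k 0 i)%:~R * (k 0 i)%:~R * shift_ratio R nu k ^+ j) +
  \sum_(i < n) - (2 * (nu 0 i)%:~R / sq R nu) * (q k * (k 0 i)%:~R * shift_ratio R nu k ^+ j).
Proof.
rewrite exprS {1}/shift_ratio -big_split/=; move: (sq R nu) (shift_ratio R nu k ^+ j) => N w.
rewrite /sq /dotZ [2 * _]mulr_sumr -big_split/= mulNr mulr_suml -sumrN mulr_suml mulr_sumr.
by apply: eq_bigr => i _; ring.
Qed.

Lemma shift_weight_le d q nu k j : mono d q -> nu != 0 ->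
  `|q k * shift_ratio R nu k ^+ j| <= 3 ^+ j * jp R k ^+ (d + 2 * j).
Proof.
move=> mq nu0; rewrite normrM exprD mulrCA ler_pM ?mono_le// normrX exprM -exprMn.
rewrite lerXn2r ?nnegrE// ?mulr_ge0 ?exprn_ge0 ?(ltW (jp_gt0 _ _))//.
apply: le_trans (shift_ratio_le R k nu0) _; rewrite ler_pdivrMr; last first.
  exact: lt_le_trans ltr01 (freq_norm_ge1 R nu0).
by rewrite ler_peMr ?freq_norm_ge1// mulr_ge0// exprn_ge0// ltW// jp_gt0.
Qed.

Let M (f : T -> R) : R := tint (fun X => `|f X|).

Let M_ge0 f : 0 <= M f.
Proof. exact: tint_ge0. Qed.

Lemma zdom_shift f d q nu t j : L1 f -> mono d q -> nu != 0 -> (d + 2 * j <= P)%N ->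
  zdom (fun k => q k * shift_ratio R nu k ^+ j * cross f nu k t) (3 ^+ j * (2 * D * M f)).
Proof.
move=> f1 mq nu0 dP; apply: (zdom_weight (e := d + 2 * j)) => //.
- by move=> k; exact: shift_weight_le.
- by rewrite !mulr_ge0.
- by move=> k; exact: cross_le.
Qed.

(** [a] is the decay reached and [e] its cost in derivatives of [v]. All monomials are covered, so
    that an induction on [a] can differentiate further. *)
Definition cross_decay a e := forall d q, mono d q -> (d + e <= P)%N ->
  exists2 C, 0 <= C & forall f h nu t, frac_harmonic f h ->
  `|zsum (fun k => q k * cross f nu k t)| <= C * M f / jp R nu ^+ a.

Lemma inv_sq_le nu : nu != 0 -> (sq R nu)^-1 <= n.+1%:R ^+ 2 / jp R nu ^+ 2 :> R.
Proof.
move=> nu0; have N1 := freq_norm_ge1 R nu0; have N0 := lt_le_trans ltr01 N1.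
rewrite -freq_norm_sqr ler_pdivlMr ?exprn_gt0 ?jp_gt0// mulrC ler_pdivrMr ?exprn_gt0//.
by rewrite -exprMn lerXn2r ?nnegrE ?mulr_ge0 ?(ltW (jp_gt0 _ _)) ?(ltW N0)// jp_le_norm.
Qed.

Lemma coord_inv_sq_le nu i : nu != 0 ->
  `|2 * (nu 0 i)%:~R / sq R nu| <= 2 * n.+1%:R / jp R nu :> R.
Proof.
move=> nu0; have N1 := freq_norm_ge1 R nu0; have N0 := lt_le_trans ltr01 N1.
rewrite -mulrA -[leRHS]mulrA normrM ger0_norm// ler_wpM2l//.
rewrite normrM normfV -freq_norm_sqr normrX (ger0_norm (ltW N0)).
apply: (@le_trans _ _ (freq_norm R nu)^-1).
  by rewrite ler_pdivrMr ?exprn_gt0// expr2 mulKf ?gt_eqF// coord_le_norm.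
by rewrite ler_pdivlMr ?jp_gt0// mulrC ler_pdivrMr// jp_le_norm.
Qed.

(** By [shift_ratioS_sum] each power of [shift_ratio] costs at most two derivatives and gains one
    power of [jp nu]. *)
Lemma cross_decay_shift a e : cross_decay a e ->
  forall j d q, mono d q -> (d + 2 * j + e <= P)%N ->
  exists2 C, 0 <= C & forall f h nu t, frac_harmonic f h -> nu != 0 ->
  `|zsum (fun k => q k * shift_ratio R nu k ^+ j * cross f nu k t)| <=
  C * M f / jp R nu ^+ (a + j).
Proof.
move=> Ha; elim=> [|j IH] d q mq dP.
  have [|C C0 hC] := Ha _ _ mq; first by move: dP; rewrite muln0 addn0.
  exists C => // f h nu t fh _; rewrite addn0 (zsum_ext (v := fun k => q k * cross f nu k t)).
    exact: hC fh.
  by move=> k; rewrite expr0 mulr1.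
have I2 i : exists C, 0 <= C /\ forall f h nu t, frac_harmonic f h -> nu != 0 ->
    `|zsum (fun k => q k * (k 0 i)%:~R * (k 0 i)%:~R * shift_ratio R nu k ^+ j * cross f nu k t)| <=
    C * M f / jp R nu ^+ (a + j).
  have [|C C0 hC] := IH _ _ (mono2 i mq); first by apply: leq_trans dP; clear; lia.
  by exists C.
have I1 i : exists C, 0 <= C /\ forall f h nu t, frac_harmonic f h -> nu != 0 ->
    `|zsum (fun k => q k * (k 0 i)%:~R * shift_ratio R nu k ^+ j * cross f nu k t)| <=
    C * M f / jp R nu ^+ (a + j).
  have [|C C0 hC] := IH _ _ (monoM i mq); first by apply: leq_trans dP; clear; lia.
  by exists C.
have {I2} [C2 I2] := choice I2; have {I1} [C1 I1] := choice I1.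
exists (\sum_i (n.+1%:R ^+ 2 * C2 i) + \sum_i (2 * n.+1%:R * C1 i)).
  by apply: addr_ge0; apply: sumr_ge0 => i _; rewrite !mulr_ge0 ?exprn_ge0//; [case: (I2 i)|case: (I1 i)].
move=> f h nu t fh nu0; have f1 : L1 f by case: fh.
have dP1 : (d.+1 + 2 * j <= P)%N by apply: leq_trans dP; clear; lia.
have dP2 : (d.+2 + 2 * j <= P)%N by apply: leq_trans dP; clear; lia.
have z2 i := zdomZ (- (sq R nu)^-1) (zdom_shift t f1 (mono2 i mq) nu0 dP2).
have z1 i := zdomZ (- (2 * (nu 0 i)%:~R / sq R nu)) (zdom_shift t f1 (monoM i mq) nu0 dP1).
rewrite (zsum_ext (v := fun k =>
  \sum_i (- (sq R nu)^-1 * (q k * (k 0 i)%:~R * (k 0 i)%:~R * shift_ratio R nu k ^+ j * cross f nu k t) +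
          - (2 * (nu 0 i)%:~R / sq R nu) * (q k * (k 0 i)%:~R * shift_ratio R nu k ^+ j * cross f nu k t)))); last first.
  by move=> k; rewrite shift_ratioS_sum -big_split/= mulr_suml; apply: eq_bigr => i _; rewrite mulrDl -!mulrA.
rewrite (zsum_sum _ (fun i => zdomD (z2 i) (z1 i))) -big_split/= -mulrA mulr_suml.
apply: le_trans (ler_norm_sum _ _ _) _; apply: ler_sum => i _.
rewrite (zsumD (z2 i) (z1 i)) (zsumZ _ (zdom_shift t f1 (mono2 i mq) nu0 dP2)).
rewrite (zsumZ _ (zdom_shift t f1 (monoM i mq) nu0 dP1)).
have J0 := jp_gt0 R nu; have J1 := jp_ge1 R nu.
apply: le_trans (ler_normD _ _) _; rewrite [leRHS]mulrDl; apply: lerD; rewrite normrM normrN.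
  have := (I2 i).2 _ _ _ t fh nu0; have C20 := (I2 i).1.
  rewrite [ `|(sq R nu)^-1|]ger0_norm ?invr_ge0 ?sq_ge0// => hz.
  apply: le_trans (ler_pM _ _ (inv_sq_le nu0) hz) _; rewrite ?invr_ge0 ?sq_ge0//.
  have -> : n.+1%:R ^+ 2 / jp R nu ^+ 2 * (C2 i * M f / jp R nu ^+ (a + j)) =
     n.+1%:R ^+ 2 * C2 i * (M f / jp R nu ^+ (a + j.+2)).
    rewrite (_ : (a + j.+2 = 2 + (a + j))%N) ?exprD; last by clear; lia.
    by field; rewrite !expf_neq0// gt_eqF.
  rewrite ler_wpM2l ?mulr_ge0 ?exprn_ge0// ler_wpM2l ?M_ge0// lef_pV2 ?posrE ?exprn_gt0//.
  by rewrite ler_weXn2l// leq_add2l.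
have hz := (I1 i).2 _ _ _ t fh nu0; have C10 := (I1 i).1.
apply: le_trans (ler_pM _ _ (coord_inv_sq_le i nu0) hz) _ => //.
rewrite addnS exprS le_eqVlt; apply/orP; left; apply/eqP.
by field; rewrite expf_neq0 ?gt_eqF.
Qed.

(** In the vanishing sum of [zsum_symb_cross] the symbol is divided by its value at [nu] and
    expanded. The term [j = 0] is the sum to be bounded; the terms [1 <= j <= a] decay to order
    [a + j], and the remainder to order [a + 1], at the price of [4 (a + 1)] powers of [jp k]. *)
Lemma cross_decayS a e : cross_decay a e -> cross_decay a.+1 (e + 4 * a.+1).
Proof.
move=> Ha d q mq dP.
have [B B0 hB] := symb_remainder n a sigma02.
have IQ (j : 'I_a.+1) : exists C, 0 <= C /\ forall f h nu t, frac_harmonic f h -> nu != 0 ->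
    `|zsum (fun k => q k * shift_ratio R nu k ^+ j * cross f nu k t)| <=
    C * M f / jp R nu ^+ (a + j).
  have [|C C0 hC] := cross_decay_shift Ha mq (j := j); last by exists C.
  by apply: leq_trans dP; have := ltn_ord j; clear; lia.
have {IQ} [CQ IQ] := choice IQ.
pose S : R := \sum_(j < a.+1) `|bcoef (sigma / 2) j| * CQ j.
have S0 : 0 <= S by apply: sumr_ge0 => j _; rewrite mulr_ge0//; case: (IQ j).
exists (2 * D * 3 ^+ n + S + B * (2 * D) * 3 ^+ n).
  by rewrite !addr_ge0// !mulr_ge0 ?exprn_ge0.
move=> f h nu t fh; have f1 : L1 f by case: fh.
have J0 := jp_gt0 R nu; have J1 := jp_ge1 R nu.
have dP0 : (d <= P)%N by apply: leq_trans dP; clear; lia.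
have c2 k : `|cross f nu k t| <= 2 * D * M f / jp R k ^+ (2 * n + P) by exact: cross_le.
have DM : 0 <= 2 * D * M f by rewrite !mulr_ge0.
(* The expansion needs [nu != 0]; at 0 the trivial bound suffices because [jp 0 = 1]. *)
have [->|nu0] := eqVneq nu 0.
  rewrite jp0 expr1n divr1.
  have zd : zdom (fun k => q k * cross f 0 k t) (1 * (2 * D * M f)).
    apply: (zdom_weight (e := d)) => //; first by move=> k; rewrite mul1r mono_le.
    by move=> k; exact: cross_le.
  apply: le_trans (zsum_norm_le zd) _.
  rewrite mul1r -mulrA [M f * _]mulrC mulrA ler_wpM2r//.
  by rewrite -addrA lerDl addr_ge0// !mulr_ge0 ?exprn_ge0.
pose y := shift_ratio R nu : Z -> R; pose sg := symb sigma : Z -> R.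
have sg0 : 0 < sg nu.
  by rewrite powR_gt0// (lt_le_trans ltr01)// freq_norm_ge1.
pose rem k := (sg nu)^-1 * sg (nu + k) - bsum (sigma / 2) a (y k).
have remle k : `|q k * rem k| <= (B / jp R nu ^+ a.+1) * jp R k ^+ (d + 4 * a.+1).
  rewrite normrM exprD mulrCA ler_pM// ?mono_le//.
  rewrite (_ : rem k = (sg nu)^-1 * (sg (nu + k) - sg nu * bsum (sigma / 2) a (y k))); last first.
    by rewrite /rem mulrBr mulKf ?gt_eqF.
  rewrite normrM gtr0_norm ?invr_gt0// ler_pdivrMl// [B / _ * _]mulrAC.
  exact: hB nu0.
have zr : zdom (fun k => q k * rem k * cross f nu k t) (B / jp R nu ^+ a.+1 * (2 * D * M f)).
  apply: (zdom_weight (e := d + 4 * a.+1)) => //; last by rewrite divr_ge0// exprn_ge0// ltW.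
  by apply: leq_trans dP; clear; lia.
have zj (j : 'I_a.+1) : zdom (fun k => q k * y k ^+ j * cross f nu k t) (3 ^+ j * (2 * D * M f)).
  apply: (zdom_shift t f1 mq nu0); apply: leq_trans dP; have := ltn_ord j; clear; lia.
have zjb (j : 'I_a.+1) := zdomZ (bcoef (sigma / 2) j) (zj j).
have zdom_bsum : zdom (fun k => \sum_(j < a.+1) bcoef (sigma / 2) j * (q k * y k ^+ j * cross f nu k t))
    (\sum_(j < a.+1) `|bcoef (sigma / 2) j| * (3 ^+ j * (2 * D * M f))).
  by move=> k; rewrite mulr_suml; apply: le_trans (ler_norm_sum _ _ _) _; apply: ler_sum => j _; exact: zjb.
have key : zsum (fun k => q k * cross f nu k t) +
   \sum_(j < a) bcoef (sigma / 2) (lift ord0 j) *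
     zsum (fun k => q k * y k ^+ (lift ord0 j) * cross f nu k t) +
   zsum (fun k => q k * rem k * cross f nu k t) = 0.
  have e0 : (sg nu)^-1 * zsum (fun k => q k * (sg (nu + k) * cross f nu k t)) = 0.
    by rewrite (zsum_symb_cross nu t fh mq dP0) mulr0.
  rewrite -[RHS]e0.
  have -> : zsum (fun k => q k * (sg (nu + k) * cross f nu k t)) =
     sg nu * (zsum (fun k => \sum_(j < a.+1) bcoef (sigma / 2) j * (q k * y k ^+ j * cross f nu k t)) +
       zsum (fun k => q k * rem k * cross f nu k t)).
    rewrite -(zsumD (zdom_bsum) zr) -(zsumZ _ (zdomD zdom_bsum zr)); apply: zsum_ext => k.
    rewrite (eq_bigr (fun j : 'I_a.+1 => q k * (bcoef (sigma / 2) j * y k ^+ j * cross f nu k t))); last first.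
      by move=> j _; ring.
    rewrite -mulr_sumr -mulr_suml -/(bsum _ _ _) /rem; field; exact: lt0r_neq0.
  rewrite mulKf ?gt_eqF//; congr (_ + _).
  rewrite (zsum_sum _ zjb) big_ord_recl (zsumZ _ (zj ord0)) mul1r; congr (_ + _).
    by apply: zsum_ext => k; rewrite expr0 mulr1.
  by apply: eq_bigr => j _; rewrite (zsumZ _ (zj _)).
have S1 : `|\sum_(j < a) bcoef (sigma / 2) (lift ord0 j) *
     zsum (fun k => q k * y k ^+ (lift ord0 j) * cross f nu k t)| <= S * (M f / jp R nu ^+ a.+1).
  apply: le_trans (ler_norm_sum _ _ _) _; rewrite /S big_ord_recl mulrDl.
  apply: ler_wpDl; first by rewrite !mulr_ge0 ?invr_ge0 ?exprn_ge0 ?(ltW J0)//; case: (IQ ord0).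
  rewrite mulr_suml; apply: ler_sum => j _; rewrite normrM -[leRHS]mulrA ler_wpM2l//.
  apply: le_trans ((IQ (lift ord0 j)).2 _ _ _ t fh nu0) _; rewrite -mulrA ler_wpM2l//.
    by case: (IQ (lift ord0 j)).
  rewrite ler_wpM2l ?M_ge0// lef_pV2 ?posrE ?exprn_gt0// ler_weXn2l//.
  by rewrite /= /bump /= -[X in (X <= _)%N]addn1 leq_add2l.
have S2 := zsum_norm_le zr.
move: key => /eqP; rewrite -addrA addr_eq0 => /eqP ->; rewrite normrN.
apply: le_trans (ler_normD _ _) _; rewrite -mulrA mulrDl; apply: lerD.
  apply: le_trans S1 _; rewrite ler_wpM2r ?mulr_ge0 ?invr_ge0 ?exprn_ge0 ?(ltW J0)//.
  by rewrite lerDr !mulr_ge0 ?exprn_ge0.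
apply: le_trans S2 _; rewrite le_eqVlt; apply/orP; left; apply/eqP; ring.
Qed.

Lemma cross_decay0 : cross_decay 0 0.
Proof.
move=> d q mq dP; exists (2 * D * 3 ^+ n); first by rewrite !mulr_ge0 ?exprn_ge0.
move=> f h nu t [f1 _ _ _]; rewrite expr0 divr1.
have zd : zdom (fun k => q k * cross f nu k t) (1 * (2 * D * M f)).
  apply: (zdom_weight (e := d)) => //.
  - by move=> k; rewrite mul1r mono_le.
  - by move: dP; rewrite addn0.
  - by rewrite !mulr_ge0.
  - by move=> k; exact: cross_le.
apply: le_trans (zsum_norm_le zd) _; rewrite le_eqVlt; apply/orP; left; apply/eqP; ring.
Qed.

(** The total cost is [4 (1 + ... + a)]. *)
Lemma cross_decay_all a : cross_decay a (2 * a * a.+1).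
Proof.
elim: a => [|a IH]; first exact: cross_decay0.
by rewrite (_ : (2 * a.+1 * a.+2 = 2 * a * a.+1 + 4 * a.+1)%N); [exact: cross_decayS|clear; lia].
Qed.

Lemma regularity a : (2 * a * a.+1 <= P)%N -> exists2 C, 0 <= C &
  forall f h nu t, frac_harmonic f h ->
  `|ft (fun X => f X * synth v (repr X)) nu t| <= C * M f / jp R nu ^+ a.
Proof.
move=> aP; have [C C0 hC] := cross_decay_all mono1 aP.
have V0 := volume_gt0 R n.
exists (V^-1 * C) => [|f h nu t fh]; first by rewrite mulr_ge0// invr_ge0 ltW.
have f1 : L1 f by case: fh.
have := hC _ _ nu t fh; rewrite (zsum_cross nu t f1 mono1 (leq0n P)).
rewrite (_ : tint _ = V * ft (fun X => f X * synth v (repr X)) nu t); last first.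
  rewrite /ft -tintZ; last by apply: ft_integrand; exact: L1_mul_synth.
  by apply: eq_tint => X; rewrite esum_at1 /wave; ring.
by rewrite normrM gtr0_norm// => hh; rewrite -!mulrA ler_pdivlMl// !mulrA.
Qed.

End regularity.

(** * The symbol of the fractional Laplacian *)

Lemma sum_delta_seq (R : nmodType) (I : eqType) (s : seq I) (l : I) (c : R) :
  uniq s -> l \in s -> \sum_(k <- s) (if k == l then c else 0) = c.
Proof.
move=> us ls; rewrite (bigD1_seq l)//= eqxx big1 ?addr0// => k /negbTE ->.
by [].
Qed.

Lemma delta_algebra (R : numFieldType) (sk sl x W : R) (a b : bool) : W != 0 ->
  (a -> sk = sl) -> (b -> sk = sl) ->
  sk * (W^-1 * (W / 2 * x * (a%:R + b%:R))) =
  (if a then sl * (2^-1 * x) else 0) + (if b then sl * (2^-1 * x) else 0).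
Proof.
move=> W0 + +; case: a; case: b => /=.
- by move=> h _; rewrite (h isT); field.
- by move=> h _; rewrite (h isT); field.
- by move=> _ h; rewrite (h isT); field.
- by move=> _ _; field.
Qed.

Section frac_laplacian_ft.
Context (R : realType) (n : nat).
Local Notation Z := 'rV[int]_n.
Local Notation T := (torus R n).
Local Notation mu := (torus_measure (R := R) (n := n)).
Local Notation V := ((2 * pi : R) ^+ n).
Local Open Scope complex_scope.

(** Cauchy-Schwarz against the constant 1; through it, convergence in [L^2] gives convergence of
    every Fourier coefficient. *)
Lemma integral_le_Lnorm2 (g : T -> R) : measurable_fun setT g ->
  (\int[mu]_X `|g X|%:E <= Lnorm mu 2%:E (EFin \o g) * (V `^ 2^-1)%:E)%E.
Proof.
move=> mg; have V0 := volume_gt0 R n.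
have two0 : 0 < 2 :> R by [].
have := @hoelder _ _ _ mu g (cst 1) 2 2 mg (measurable_cst _) two0 two0.
have half : 2^-1 + 2^-1 = 1 :> R by lra.
move=> /(_ half); rewrite Lnorm1.
rewrite (_ : Lnorm mu 2%:E (EFin \o cst 1) = (V `^ 2^-1)%:E).
  apply: le_trans; rewrite le_eqVlt; apply/orP; left; apply/eqP.
  by apply: eq_integral => X _; rewrite /= mulr1.
rewrite unlock (_ : (fun X : T => _) = cst 1%E); last first.
  by apply/funext => X; rewrite /= normr1 powR1.
by rewrite integral_cst//= mul1e torus_measureT.
Qed.

Lemma L1_Lfun2 (f : T -> R) : f \in Lfun mu 2%:E -> L1 f.
Proof.
move=> f2; have mf : measurable_fun setT f := set_mem (sub_Lfun_mfun f2).
have ff : (Lnorm mu 2%:E (EFin \o f) < +oo)%E := set_mem (sub_Lfun_finLfun f2).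
apply/integrableP; split.
  exact/measurable_EFinP.
apply: le_lt_trans (integral_le_Lnorm2 mf) _.
by rewrite muleC lte_mul_pinfty// lee_fin powR_ge0.
Qed.

Lemma ReM_real (x : R) (z : R[i]) : complex.Re (x%:C * z) = x * complex.Re z.
Proof. by case: z => a b; rewrite /= mul0r subr0. Qed.

Lemma ImM_real (x : R) (z : R[i]) : complex.Im (x%:C * z) = x * complex.Im z.
Proof. by case: z => a b; rewrite /= mul0r addr0. Qed.

Variables (sigma : R) (f : T -> R).
Hypothesis f1 : L1 f.

Lemma torus_charE k (X : T) :
  torus_char k X = wave k 0 (repr X) +i* wave k (- (pi / 2)) (repr X).
Proof. by rewrite /torus_char /wave addr0 cosBpihalf. Qed.

Lemma fourier_coefE k : fourier_coef f k =
  (V^-1 * ft f k 0) +i* (- (V^-1 * ft f k (- (pi / 2)))).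
Proof.
have realM (x a b : R) : x%:C * (a +i* b) = (x * a) +i* (x * b).
  by apply/eqP; rewrite eq_complex/= !mul0r subr0 addr0 !eqxx.
rewrite /fourier_coef /torus_integralC realM; congr (_ * _ +i* _).
  apply: eq_Rintegral => X _; rewrite ReM_real torus_charE//=.
rewrite -mulrN; congr (_ * _); rewrite /ft -mulN1r -tintZ; last exact: ft_integrand.
apply: eq_Rintegral => X _; rewrite ImM_real torus_charE/=; ring.
Qed.

Lemma frac_term_ReE k (X : T) :
  complex.Re ((freq_norm R k `^ sigma)%:C * fourier_coef f k * torus_char k X) =
  symb sigma k * (V^-1 * dwave f k (repr X)).
Proof.
by rewrite -mulrA ReM_real fourier_coefE torus_charE dwaveE//= /symb; ring.
Qed.

Lemma frac_term_ImE k (X : T) :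
  complex.Im ((freq_norm R k `^ sigma)%:C * fourier_coef f k * torus_char k X) =
  symb sigma k * (V^-1 * (ft f k 0 * wave k (- (pi / 2)) (repr X) -
                          ft f k (- (pi / 2)) * wave k 0 (repr X))).
Proof.
by rewrite -mulrA ImM_real fourier_coefE torus_charE/= /symb; ring.
Qed.

Lemma Re_sum (F : seq Z) (z : Z -> R[i]) :
  complex.Re (\sum_(k <- F) z k) = \sum_(k <- F) complex.Re (z k).
Proof. by rewrite raddf_sum. Qed.

Lemma Im_sum (F : seq Z) (z : Z -> R[i]) :
  complex.Im (\sum_(k <- F) z k) = \sum_(k <- F) complex.Im (z k).
Proof. by rewrite raddf_sum. Qed.

Let S (F : {fset Z}) (X : T) : R := complex.Re (frac_Laplacian_sum sigma f F X).

Let SE F X : S F X = \sum_(k <- F) symb sigma k * (V^-1 * dwave f k (repr X)).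
Proof. by rewrite /S Re_sum; apply: eq_bigr => k _; exact: frac_term_ReE. Qed.

Let L1_term k : L1 (fun X => V^-1 * dwave f k (repr X)).
Proof.
apply: L1Z; apply: (L1_bounded (C := tint (fun X => `|f X|))).
  exact: measurable_dwave.
by move=> X; exact: dwave_le.
Qed.

Let L1_S F : L1 (S F).
Proof.
rewrite (_ : S F = fun X => \sum_(k <- F) symb sigma k * (V^-1 * dwave f k (repr X))).
  by apply: L1_sum => k; exact: L1Z.
by apply/funext => X; exact: SE.
Qed.

(** The real wave at [l] is fed by the characters of both [l] and [- l], so both must belong to the
    set. *)
Lemma ft_frac_sum (F : {fset Z}) l t : l \in F -> - l \in F ->
  ft (S F) l t = symb sigma l * ft f l t.
Proof.
move=> lF nlF; have V0 := volume_gt0 R n.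
have -> : ft (S F) l t = \sum_(k <- F) symb sigma k * (V^-1 * (V / 2 * ft f l t * ((k == l)%:R + (k == - l)%:R))).
  rewrite /ft (eq_tint (g := fun X => \sum_(k <- F) symb sigma k * (V^-1 * (dwave f k (repr X) * wave l t (repr X))))).
    have L1k k : L1 (fun X => V^-1 * (dwave f k (repr X) * wave l t (repr X))).
      have := ft_integrand l t (L1_term k).
      by congr L1; apply/funext => X; rewrite mulrA.
    rewrite tint_sum => [|k]; last exact: L1Z.
    apply: eq_bigr => k _; rewrite tintZ//; congr (_ * _).
    rewrite tintZ; first by rewrite -(ft_dwave k l t f1).
    exact: ft_integrand (L1_bounded (measurable_dwave _ f1) (fun X => dwave_le _ _ f1)).
  by move=> X; rewrite SE mulr_suml; apply: eq_bigr => k _; ring.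
rewrite (eq_bigr (fun k => (if k == l then symb sigma l * (2^-1 * ft f l t) else 0) +
   (if k == - l then symb sigma l * (2^-1 * ft f l t) else 0))); last first.
  move=> k _; have sN : symb sigma (- l) = symb sigma l by rewrite !symbE sqN.
  apply: delta_algebra; first exact: lt0r_neq0.
    by move/eqP->.
  by move/eqP->.
rewrite big_split/= !sum_delta_seq ?fset_uniq// -mulrDr -mulrDl; congr (_ * _).
by rewrite (_ : 2^-1 + 2^-1 = 1) ?mul1r//; lra.
Qed.

Lemma measurable_frac_sum F (h : T -> R) : measurable_fun setT h ->
  measurable_fun setT (fun X => Normc.normc (frac_Laplacian_sum sigma f F X - (h X)%:C)).
Proof.
move=> mh.
rewrite (_ : (fun X => _) = fun X => Num.sqrt ((S F X - h X) ^+ 2 +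
  (\sum_(k <- F) symb sigma k * (V^-1 * (ft f k 0 * wave k (- (pi / 2)) (repr X) -
                          ft f k (- (pi / 2)) * wave k 0 (repr X)))) ^+ 2)); last first.
  apply/funext => X.
  rewrite -(eq_bigr _ (fun k _ => frac_term_ImE k X)) -Im_sum -/(frac_Laplacian_sum sigma f F X) /S.
  by case: (frac_Laplacian_sum _ _ _ _) => a b /=; rewrite subr0.
apply: (@measurableT_comp _ _ _ _ _ _ (@Num.sqrt R)).
  by apply: continuous_measurable_fun; exact: sqrt_continuous.
apply: measurable_funD; apply: measurable_funX.
  by apply: measurable_funB => //; exact: L1_measurable (L1_S F).
apply: measurable_sum => k.
apply: measurable_funM; first exact: measurable_cst.
apply: measurable_funM; first exact: measurable_cst.
by apply: measurable_funB; apply: measurable_funM; try exact: measurable_cst; exact: (@measurable_wave R n).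
Qed.

(** Once a finite set contains [l] and [- l], the coefficient of the partial sum at [l] no longer
    depends on the set, while its distance to that of [h] is arbitrarily small. *)
Lemma ft_frac_Laplacian h : is_frac_Laplacian sigma f h ->
  forall l t, ft h l t = symb sigma l * ft f l t.
Proof.
move=> [h2 hc] l t; have h1 := L1_Lfun2 h2; have mh := L1_measurable h1.
have V0 := volume_gt0 R n.
apply/eqP; rewrite -subr_eq0 -normr_le0; apply/ler_addgt0Pr => e e0; rewrite add0r.
have e1 : 0 < e / (V `^ 2^-1) by rewrite divr_gt0// powR_gt0.
have nb : nbhs (0%E : \bar R) [set y : \bar R | (y < (e / (V `^ 2^-1))%:E)%E].
  by apply: open_nbhs_nbhs; split; [exact: open_ereal_lt_ereal|rewrite /= lte_fin].
have [F0 _ hF] := hc _ nb; pose F := (F0 `|` [fset l; - l])%fset.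
have {hF} /= FF := hF F (fsubsetUl _ _).
have lF : l \in F by rewrite !inE eqxx ?orbT.
have nlF : - l \in F by rewrite !inE eqxx ?orbT.
rewrite -(ft_frac_sum t lF nlF) -ftB//.
have L1d : L1 (fun X => h X - S F X) by exact: L1B.
apply: le_trans (ft_le _ _ L1d) _.
have mG := measurable_frac_sum F mh.
set G := (fun X => Normc.normc _) in mG FF.
have -> : tint (fun X => `|h X - S F X|) = fine (\int[mu]_X `|h X - S F X|%:E)%E by [].
rewrite -lee_fin fineK; last by apply: integrable_fin_num => //; exact: L1_norm.
apply: (@le_trans _ _ (\int[mu]_X `|G X|%:E)%E).
  apply: ge0_le_integral => //.
  - by apply/measurable_EFinP; exact: (L1_measurable (L1_norm L1d)).
  - by apply/measurable_EFinP; exact: measurableT_comp.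
  move=> X _; rewrite lee_fin; apply: le_trans (ler_norm _); rewrite /G /S.
  case: (frac_Laplacian_sum _ _ _ _) => a b /=; rewrite subr0 distrC -sqrtr_sqr.
  by rewrite ler_sqrt ?addr_ge0 ?sqr_ge0// lerDl sqr_ge0.
apply: le_trans (integral_le_Lnorm2 mG) _.
apply: (@le_trans _ _ ((e / (V `^ 2^-1))%:E * (V `^ 2^-1)%:E)%E).
  by rewrite lee_wpmul2r ?lee_fin ?powR_ge0//; exact: ltW FF.
by rewrite -EFinM divfK// gt_eqF// powR_gt0.
Qed.

End frac_laplacian_ft.

(** * A quantitative minimum principle *)

(** Young's inequality for [(1 - x)^s] and 1, with exponents [1 / s] and [1 / (1 - s)]. *)
Lemma bernoulli_powR (R : realType) (s x : R) : 0 < s < 1 -> 0 <= x <= 1 ->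
  (1 - x) `^ s <= 1 - s * x.
Proof.
move=> /andP[s0 s1] /andP[x0 x1].
have s1' : 0 < 1 - s by rewrite subr_gt0.
have := @conjugate_powR R ((1 - x) `^ s) 1 s^-1 (1 - s)^-1 (powR_ge0 _ _) ler01.
rewrite !invr_gt0 !invrK => /(_ s0 s1').
rewrite (_ : s + (1 - s) = 1) => [/(_ erefl)|]; last by ring.
rewrite mulr1 -powRrM mulfV ?gt_eqF// powRr1 ?subr_ge0// powR1 mul1r.
by move/le_trans; apply; lra.
Qed.

(** Differentiability gives continuity only at positive limits; the limit 0 is handled directly. *)
Lemma cvg_powR_seq (R : realType) (s l : R) (y : nat -> R) : 0 < s ->
  (forall q, 0 <= y q) -> y q @[q --> \oo] --> l -> y q `^ s @[q --> \oo] --> l `^ s.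
Proof.
move=> s0 y0 yl; have l0 : 0 <= l.
  by have := cvg_lim (@norm_hausdorff _ _) yl => <-; apply: limr_ge; [apply/cvg_ex; exists l|near=> q].
move: l0; rewrite le_eqVlt => /orP[/eqP l0|l0]; last first.
  have dd := is_derive1_powR s l0.
  have cc : {for l, continuous (fun z : R => z `^ s)}.
    apply: differentiable_continuous; apply/derivable1_diffP; exact: (@ex_derive _ _ _ _ _ _ _ dd).
  exact: (@cvg_comp _ _ _ y (fun z => z `^ s) _ _ _ yl cc).
rewrite -l0 powR0 ?gt_eqF//; apply/cvgrPdist_le => e e0.
have e1 : 0 < e `^ s^-1 by rewrite powR_gt0.
move: yl; rewrite -l0 => /cvgrPdist_le/(_ _ e1); apply: filterS => q.
rewrite !sub0r !normrN ger0_norm// => hy; rewrite ger0_norm ?powR_ge0//.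
have -> : e = (e `^ s^-1) `^ s by rewrite -powRrM mulVf ?gt_eqF// powRr1// ltW.
by rewrite ge0_ler_powR ?nnegrE// ?(ltW s0)// ltW.
Unshelve. all: by end_near. Qed.

Section bcoef_bounds.
Context (R : realType) (s : R).
Hypothesis s01 : 0 < s < 1.

Lemma bcoef_le0 j : bcoef s j.+1 <= 0.
Proof.
have /andP[s0 s1] := s01; elim: j => [|j IH].
  by rewrite /bcoef /= mul1r sub0r divr1 oppr_le0 ltW.
rewrite -(ler_pM2r (_ : 0 < j.+2%:R)) ?ltr0n// bcoefS mul0r mulr_le0_ge0//.
by rewrite subr_ge0 (le_trans (ltW s1))// ler1n.
Qed.

Lemma bcoef_le1 j : `|bcoef s j| <= 1.
Proof.
have /andP[s0 s1] := s01; elim: j => [|j IH]; first by rewrite normr1.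
have j1 : 0 < j.+1%:R :> R by rewrite ltr0n.
rewrite -(ler_pM2r j1) mul1r -[X in _ * X](gtr0_norm j1) -normrM bcoefS normrM.
rewrite -[leRHS]mul1r; apply: ler_pM => //; rewrite ler_norml -natr1; apply/andP; split.
  by have : 0 <= j%:R :> R by []; move: (j%:R : R) s1 => z; clear; lra.
by move: (j%:R : R) s0 => z; clear; lra.
Qed.

(** From one index to the next the right side is multiplied by [1 - s / (j + 1)], which is at least
    [(j / (j + 1))^s] by [bernoulli_powR]. Hence [- bcoef s j] is at least of order [j^(-1 - s)]. *)
Lemma bcoef_lower j : (0 < j)%N -> s * (1 - s) * j%:R `^ (- s) <= - bcoef s j.+1 * j.+1%:R.
Proof.
have /andP[s0 s1] := s01; case: j => // j _; elim: j => [|j IH].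
  rewrite powR1 mulr1 mulNr bcoefS (_ : bcoef s 1 = - s).
    by rewrite mulNr opprK lexx.
  by rewrite /bcoef/= mul1r sub0r divr1.
have j1 : 0 < j.+1%:R :> R by rewrite ltr0n.
have j2 : 0 < j.+2%:R :> R by rewrite ltr0n.
rewrite mulNr bcoefS.
have -> : - (bcoef s j.+2 * (j.+2%:R - s)) = (- bcoef s j.+2 * j.+2%:R) * (1 - s / j.+2%:R).
  by move: j2; move: (j.+2%:R : R) (bcoef s j.+2) => z b z0; field; exact: lt0r_neq0.
have b : (1 - j.+2%:R^-1 : R) `^ s <= 1 - s / j.+2%:R.
  apply: bernoulli_powR => //; rewrite invr_ge0 ltW//= invf_le1// ler1n//.
have e : (1 - j.+2%:R^-1 : R) = j.+1%:R / j.+2%:R.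
  by rewrite -[j.+2%:R]natr1; move: j1; move: (j.+1%:R : R) => z z0; field; rewrite gt_eqF// addr_gt0.
apply: le_trans (ler_pM _ _ IH b); rewrite ?mulr_ge0 ?subr_ge0 ?powR_ge0 ?(ltW s0) ?(ltW s1)//.
rewrite -[leRHS]mulrA ler_wpM2l ?mulr_ge0 ?subr_ge0 ?(ltW s0) ?(ltW s1)//.
rewrite e powRM ?invr_ge0 ?(ltW j1) ?(ltW j2)// mulrA -powRD; last by apply/implyP => _; rewrite gt_eqF.
by rewrite addNr powRr0 mul1r -powR_inv1 ?(ltW j2)// -powRrM mulN1r.
Qed.

End bcoef_bounds.

Lemma dist_natr_le (R : realFieldType) (s : R) K : 0 < s < 1 -> `|s - K%:R| <= K.+1%:R.
Proof.
move=> /andP[s0 s1]; rewrite ler_norml -natr1; have : 0 <= K%:R :> R by [].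
by move: (K%:R : R) => z; lra.
Qed.

Lemma half_le (R : realFieldType) (x y : R) : `|x - y| <= x / 2 -> x / 2 <= y.
Proof. by rewrite ler_norml; lra. Qed.

Lemma powR_le1D (R : realType) (s y : R) : 0 < s < 1 -> 0 <= y -> y `^ s <= 1 + y.
Proof.
move=> /andP[s0 s1] y0; have [y1|y1] := leP y 1.
  apply: (@le_trans _ _ (1 `^ s)); first by rewrite ge0_ler_powR ?nnegrE ?(ltW s0).
  by rewrite powR1 lerDl.
by apply: le_trans (ler1_powR (ltW y1) (ltW s1)) _; rewrite lerDr.
Qed.

Section min_principle.
Context (R : realType) (n : nat).
Local Notation Z := 'rV[int]_n.
Implicit Types (k : Z) (x : 'rV[R]_n) (a r : R).
Hypothesis n0 : (0 < n)%N.

(* The symbol of the average over the [2 * n] neighbours at distance [a]. *)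
Definition cos_avg a k : R := n%:R^-1 * \sum_(i < n) cos (a * (k 0 i)%:~R).

Let nR : 0 < n%:R :> R. Proof. by rewrite ltr0n. Qed.

Lemma cos_avg_le1 a k : `|cos_avg a k| <= 1.
Proof.
rewrite /cos_avg normrM normfV (gtr0_norm nR) ler_pdivrMl// mulr1.
apply: le_trans (ler_norm_sum _ _ _) _.
apply: le_trans (_ : \sum_(i < n) (1 : R) <= _); last by rewrite sumr_const card_ord.
by apply: ler_sum => i _; exact: cos_max.
Qed.

(** The symbol of minus the discrete Laplacian of mesh [a]; it lies below [|k|^2] and tends to
    it. *)
Definition cos_gap a k : R := \sum_(i < n) 2 * (1 - cos (a * (k 0 i)%:~R)) / a ^+ 2.

Lemma cos_avg_gap a k : a != 0 -> cos_avg a k = 1 - a ^+ 2 * cos_gap a k / (2 * n%:R).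
Proof.
move=> a0; rewrite /cos_gap -mulr_suml -mulr_sumr sumrB sumr_const card_ord /cos_avg.
by move: (\sum_(i < n) _) => S; rewrite -[1 *+ n]/(n%:R : R); field; rewrite gt_eqF//= a0.
Qed.

Lemma cos1B (y : R) : 1 - cos y = 2 * sin (y / 2) ^+ 2.
Proof.
have -> : cos y = cos (y / 2) ^+ 2 *+ 2 - 1 by rewrite -cos_mulr2n; congr cos; rewrite -[RHS]mulr_natr divfK.
by rewrite cos2sin2 -mulr_natr; ring.
Qed.

Lemma cos_gap_ge0 a k : 0 <= cos_gap a k.
Proof.
apply: sumr_ge0 => i _; rewrite divr_ge0 ?sqr_ge0// mulr_ge0// subr_ge0; exact: cos_le1.
Qed.

Lemma cos_gap_le a k : a != 0 -> cos_gap a k <= sq R k.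
Proof.
move=> a0; apply: ler_sum => i _; rewrite ler_pdivrMr ?exprn_even_gt0//= cos1B mulrA -natrM.
have := sin_norm_le (a * (k 0 i)%:~R / 2); rewrite -(@ler_pXn2r _ 2)// ?nnegrE//.
rewrite !real_normK ?num_real// => h.
apply: le_trans (_ : 4 * (a * (k 0 i)%:~R / 2) ^+ 2 <= _); first by rewrite ler_wpM2l.
by rewrite le_eqVlt; apply/orP; left; apply/eqP; field.
Qed.

Lemma cos_gap_cvg k : cos_gap a k @[a --> 0^'] --> sq R k.
Proof.
apply: cvg_big; first exact: add_continuous.
move=> i _; pose c : R := (k 0 i)%:~R / 2.
have -> : (k 0 i)%:~R ^+ 2 = 2 ^+ 2 * (c ^+ 2) by rewrite /c; field.
have -> : (fun a : R => 2 * (1 - cos (a * (k 0 i)%:~R)) / a ^+ 2) =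
    (fun a => 2 ^+ 2 * (a^-1 * sin (a * c)) ^+ 2).
  by apply/funext => a; rewrite cos1B exprMn exprVn /c [a * (_ / 2)]mulrA; ring.
apply: cvgMr; rewrite expr2; under eq_fun do rewrite expr2.
by apply: cvgM; exact: sin_slope.
Qed.

(** [om k] plays the frequency [k] part of a nonnegative function. The identity [om_wave] is what
    makes an average over neighbours act as multiplication by [cos_avg]. *)
Variables (om : Z -> 'rV[R]_n -> R) (D : R).
Hypothesis om_le : forall k x, `|om k x| <= D / jp R k ^+ (2 * n + 2).
Hypothesis om_wave : forall k x d,
  om k (x + d) + om k (x - d) = 2 * cos (freq_dot k d) * om k x.
Hypothesis om_ge0 : forall x, 0 <= zsum (om ^~ x).

Let D0 : 0 <= D.
Proof. by have := om_le 0 0; rewrite jp0 expr1n divr1; exact: le_trans. Qed.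

Lemma zdom_om2 x A (w : Z -> R) : (forall k, `|w k| <= A * jp R k ^+ 2) ->
  zdom (fun k => om k x * w k) (D * A).
Proof.
move=> wA k; rewrite normrM; apply: le_trans (ler_pM _ _ (om_le k x) (wA k)) _ => //.
rewrite exprD /wt le_eqVlt; apply/orP; left; apply/eqP; field.
by rewrite !expf_neq0// gt_eqF// jp_gt0.
Qed.

Lemma zdom_om1 x A (w : Z -> R) : (forall k, `|w k| <= A) -> zdom (fun k => om k x * w k) (D * A).
Proof.
move=> wA; apply: zdom_om2 => k; apply: le_trans (wA k) _.
by rewrite ler_peMr ?exprn_ege1 ?jp_ge1//; exact: le_trans (wA k).
Qed.

Lemma cos_avg_pow_le1 a k j : `|cos_avg a k ^+ j| <= 1.
Proof. by rewrite normrX exprn_ile1// cos_avg_le1. Qed.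

Let zpow a x j := zdom_om1 x (fun k => cos_avg_pow_le1 a k j).

(** The sum is the [j]-fold neighbour average at [x] of a nonnegative function; averaging moves the
    point, so [x] varies in the induction. *)
Lemma zsum_avg_ge0 a j x : 0 <= zsum (fun k => om k x * cos_avg a k ^+ j).
Proof.
elim: j x => [|j IH] x; first by rewrite (zsum_ext (v := om ^~ x))// => k; rewrite expr0 mulr1.
pose e i : 'rV[R]_n := a *: delta_mx 0 i.
have -> : zsum (fun k => om k x * cos_avg a k ^+ j.+1) = \sum_(i < n) (2 * n%:R)^-1 *
    (zsum (fun k => om k (x + e i) * cos_avg a k ^+ j) + zsum (fun k => om k (x - e i) * cos_avg a k ^+ j)).
  have zi i := zdomZ (2 * n%:R)^-1 (zdomD (zpow a (x + e i) j) (zpow a (x - e i) j)).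
  transitivity (zsum (fun k => \sum_(i < n) (2 * n%:R)^-1 *
      (om k (x + e i) * cos_avg a k ^+ j + om k (x - e i) * cos_avg a k ^+ j))).
    apply: zsum_ext => k; rewrite -mulr_sumr.
    under eq_bigr do rewrite -mulrDl om_wave freq_dotZ freq_dot_delta.
    rewrite -!mulr_suml -mulr_sumr exprS {1}/cos_avg.
    by move: (\sum_(i < n) _) => S; field; exact: lt0r_neq0.
  rewrite (zsum_sum _ zi); apply: eq_bigr => i _.
  by rewrite (zsumZ _ (zdomD (zpow a (x + e i) j) (zpow a (x - e i) j))) (zsumD (zpow a (x + e i) j) (zpow a (x - e i) j)).
by apply: sumr_ge0 => i _; rewrite mulr_ge0 ?invr_ge0 ?mulr_ge0 ?(ltW nR)// addr_ge0.
Qed.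

Variable s : R.
Hypothesis s01 : 0 < s < 1.
Variable x0 : 'rV[R]_n.
Hypothesis om0 : zsum (om ^~ x0) = 0.

Lemma geometric_cvg0 (r : R) : 0 <= r < 1 -> K.+1%:R * r ^+ K @[K --> \oo] --> (0 : R).
Proof.
move=> r01; have /andP[r0 r1] := r01.
rewrite (_ : (fun K => _) = fun K => K%:R * r ^+ K + r ^+ K); last first.
  by apply/funext => K; rewrite -natr1 mulrDl mul1r.
rewrite -[X in _ --> X]addr0; apply: cvgD; first exact: cvg_natr_geometric.
by apply: cvg_expr; rewrite ger0_norm.
Qed.

Lemma bsum_cvg (y r : R) : `|y| <= r -> r < 1 -> bsum s K y @[K --> \oo] --> ((1 - y) `^ s : R).
Proof.
move=> yr r1; have r0 : 0 <= r by exact: le_trans yr.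
have /andP[s0 s1] := s01.
have g0 := geometric_cvg0 (introT andP (conj r0 r1)).
pose C := 2 `^ s * (1 - r) `^ (- s - 1).
have : C * (K.+1%:R * r ^+ K) @[K --> \oo] --> (0 : R).
  by rewrite -(mulr0 C); exact: cvgMr.
move=> /cvgrPdist_le hh; apply/cvgrPdist_le => e /hh; apply: filterS => K.
rewrite sub0r normrN distrC => hK; apply: le_trans (bsum_remainder s0 K yr r1) _.
apply: le_trans hK; apply: le_trans (ler_norm _).
rewrite /C -[leRHS]mulrA ler_wpM2l ?powR_ge0//.
have sK : `|s - K%:R| <= K.+1%:R by exact: dist_natr_le.
have yr1 : `|y| <= 1 by rewrite (le_trans yr)// ltW.
rewrite -[leRHS]mulr1; apply: ler_pM => //; rewrite ?mulr_ge0 ?exprn_ge0 ?powR_ge0//.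
rewrite [leRHS]mulrC ler_wpM2r ?powR_ge0// ler_wpM2r ?exprn_ge0//.
by rewrite -[leRHS]mulr1 ler_pM// bcoef_le1.
Qed.

(** The term of order 0 is the value 0 at [x0] and the others are nonpositive, so any block of them
    may be kept alone. The factor [r < 1] makes the series converge at every frequency with a bound
    independent of [k]. *)
Lemma frac_power_le a r N : 0 <= r < 1 -> (0 < N)%N ->
  zsum (fun k => om k x0 * (1 - r * cos_avg a k) `^ s) <=
  - \sum_(N <= j < N.*2) (- bcoef s j) * r ^+ j * zsum (fun k => om k x0 * cos_avg a k ^+ j).
Proof.
move=> /andP[r0 r1] N0; pose P j := zsum (fun k => om k x0 * cos_avg a k ^+ j).
have rX k : `|r * cos_avg a k| <= r by rewrite normrM ger0_norm// ler_piMr// cos_avg_le1.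
have bK K k : `|bsum s K (r * cos_avg a k)| <= (1 - r)^-1.
  apply: le_trans (ler_norm_sum _ _ _) _.
  apply: le_trans (_ : \sum_(j < K.+1) r ^+ j <= _).
    apply: ler_sum => j _; rewrite normrM -[leRHS]mul1r ler_pM ?bcoef_le1//.
    by rewrite normrX lerXn2r ?nnegrE.
  rewrite -[leRHS]mul1r ler_pdivlMr ?subr_gt0// mulrC.
  by rewrite -opprB mulNr -subrX1 opprB lerBlDr lerDl exprn_ge0.
have cv : zsum (fun k => om k x0 * bsum s K (r * cos_avg a k)) @[K --> \oo] -->
    zsum (fun k => om k x0 * (1 - r * cos_avg a k) `^ s).
  apply: (@zsum_dominated_cvg _ _ _ _ _ _ _ (D * (1 - r)^-1)).
    by near=> K; exact: zdom_om1.
  by move=> k; apply: cvgMr; exact: bsum_cvg (rX k) r1.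
have PE K : zsum (fun k => om k x0 * bsum s K (r * cos_avg a k)) =
    \sum_(0 <= j < K.+1) bcoef s j * r ^+ j * P j.
  rewrite big_mkord; have zj (j : 'I_K.+1) := zdomZ (bcoef s j * r ^+ j) (zpow a x0 j).
  rewrite (zsum_ext (v := fun k => \sum_(j < K.+1) bcoef s j * r ^+ j * (om k x0 * cos_avg a k ^+ j))).
    by rewrite (zsum_sum _ zj); apply: eq_bigr => j _; rewrite (zsumZ _ (zpow a x0 j)).
  by move=> k; rewrite /bsum mulr_sumr; apply: eq_bigr => j _; rewrite exprMn; ring.
have t0 j : bcoef s j * r ^+ j * P j <= 0.
  case: j => [|j].
    rewrite /P (zsum_ext (v := om ^~ x0)) ?om0 ?mulr0// => k; by rewrite expr0 mulr1.
  by rewrite mulr_le0_ge0 ?zsum_avg_ge0// mulr_le0_ge0 ?exprn_ge0 ?bcoef_le0.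
rewrite -(cvg_lim (@norm_hausdorff _ _) cv); apply: limr_le; first by apply/cvg_ex; exists (zsum (fun k => om k x0 * (1 - r * cos_avg a k) `^ s)).
near=> K; rewrite PE.
have K2 : (N.*2 <= K.+1)%N by near: K; exists N.*2 => // m /=; clear; lia.
rewrite (big_cat_nat (n := N.*2))//= (big_cat_nat (n := N) (p := N.*2))//=; last by rewrite -addnn leq_addr.
rewrite -sumrN; under [leRHS]eq_bigr do rewrite !mulNr opprK.
rewrite -/P; have A : \sum_(0 <= j < N) bcoef s j * r ^+ j * P j <= 0 by apply: sumr_le0.
have B : \sum_(N.*2 <= j < K.+1) bcoef s j * r ^+ j * P j <= 0 by apply: sumr_le0.
move: A B; move: (\sum_(0 <= j < N) _) (\sum_(N.*2 <= j < K.+1) _) (\sum_(N <= j < N.*2) _).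
move=> u v w u0 v0; rewrite -[leRHS]add0r -[leRHS]addr0.
by apply: lerD => //; rewrite lerD2r.
Unshelve. all: by end_near. Qed.

(** The block has [N] terms, each at least [s (1 - s) (2 N)^(- s) / (2 N)] times [1 / 2] times
    [c0]. *)
Lemma frac_power_le_N a r N c0 : 0 <= r < 1 -> (1 < N)%N ->
  (forall j, (N <= j < N.*2)%N -> 2^-1 <= r ^+ j) ->
  0 <= c0 -> (forall j, (N <= j)%N -> c0 <= zsum (fun k => om k x0 * cos_avg a k ^+ j)) ->
  zsum (fun k => om k x0 * (1 - r * cos_avg a k) `^ s) <=
  - (s * (1 - s) / 4 * N.*2%:R `^ (- s) * c0).
Proof.
move=> r01 N1 rN c00 Pc; have /andP[s0 s1] := s01.
have N0 : (0 < N)%N by exact: ltnW.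
apply: le_trans (frac_power_le a r01 N0) _; rewrite lerN2.
have N20 : 0 < N.*2%:R :> R by rewrite ltr0n double_gt0.
pose w := s * (1 - s) * N.*2%:R `^ (- s) / N.*2%:R.
have w0 : 0 <= w by rewrite !mulr_ge0 ?subr_ge0 ?powR_ge0 ?invr_ge0 ?(ltW s0) ?(ltW s1) ?(ltW N20).
have bj j : (N <= j < N.*2)%N -> w <= - bcoef s j.
  move=> /andP[Nj jN]; case: j Nj jN => [|[|j]]; [by clear -N1; lia|by clear -N1; lia|].
  move=> Nj jN; have := bcoef_lower s01 (ltn0Sn j); rewrite /w => hb.
  have j20 : 0 < j.+2%:R :> R by rewrite ltr0n.
  rewrite ler_pdivrMr//; apply: (@le_trans _ _ (s * (1 - s) * j.+1%:R `^ (- s))).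
    rewrite ler_wpM2l ?mulr_ge0 ?subr_ge0 ?(ltW s0) ?(ltW s1)// !powRN lef_pV2 ?posrE ?powR_gt0//.
    rewrite ge0_ler_powR ?nnegrE ?(ltW s0)// ler_nat; exact: leq_trans (leqnSn _) (ltnW jN).
  apply: le_trans hb _; rewrite ler_wpM2l ?oppr_ge0 ?bcoef_le0// ler_nat; exact: ltnW.
apply: (@le_trans _ _ (\sum_(N <= j < N.*2) (w * 2^-1 * c0))).
  rewrite sumr_const_nat -addnn addnK -[leRHS]mulr_natr /w -addnn natrD.
  rewrite le_eqVlt; apply/orP; left; apply/eqP.
  have : 0 < N%:R :> R by rewrite ltr0n.
  move: (s * (1 - s)) ((N%:R + N%:R) `^ (- s)) (N%:R : R) => u v z z0; field; rewrite ?gt_eqF ?addr_gt0//.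
rewrite big_nat [leRHS]big_nat; apply: ler_sum => j jN; have Nj : (N <= j)%N by case/andP: jN.
have wb := ler_pM w0 (_ : 0 <= 2^-1) (bj _ jN) (rN _ jN).
apply: (ler_pM _ c00 (wb _) (Pc _ Nj)); last by rewrite invr_ge0.
by rewrite divr_ge0.
Qed.

Lemma cos_avg0 a : cos_avg a 0 = 1.
Proof.
rewrite /cos_avg (eq_bigr (fun=> 1)) => [|i _]; last by rewrite mxE mulr0 cos0.
by rewrite sumr_const card_ord mulVf// gt_eqF.
Qed.

Definition off_mass a N : R :=
  zsum (fun k => if k == 0 then 0 else `|om k x0| * `|cos_avg a k| ^+ N).

Let zdom_off a N : zdom (fun k => if k == 0 then 0 else `|om k x0| * `|cos_avg a k| ^+ N) D.
Proof.
move=> k; case: ifP => _; first by rewrite normr0 mulr_ge0// ltW// wt_gt0.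
have := zpow a x0 N k; rewrite mulr1 normrM normrX => h.
by rewrite normrM normr_id normrX normr_id.
Qed.

(** Averaging preserves the frequency 0, and from step [N] on it damps the others at least as much
    as at step [N]. *)
Lemma zsum_avg_lower a N j : (N <= j)%N ->
  om 0 x0 - off_mass a N <= zsum (fun k => om k x0 * cos_avg a k ^+ j).
Proof.
move=> Nj; rewrite -(zsum_delta 0 (om ^~ x0)).
have zd := zdom_delta 0 (om ^~ x0).
rewrite /off_mass -(zsumB zd (zdom_off a N)); apply: (ler_zsum (zdomB zd (zdom_off a N)) (zpow a x0 j)) => k.
case: eqP => [->|_]; first by rewrite cos_avg0 expr1n mulr1 subr0.
rewrite sub0r; apply: le_trans (_ : - `|om k x0 * cos_avg a k ^+ j| <= _).
  rewrite lerN2 normrM ler_wpM2l// normrX ler_wiXn2l// cos_avg_le1//.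
by rewrite lerNl -normrN ler_norm.
Qed.

Variable T : R.
Hypothesis T0 : 0 < T.

(** With [mesh] this is a walk of [stp q] steps run for the fixed time [T = stp q * mesh q ^+ 2].
    Being a multiple of [n] makes its powers [n]-th powers, to be matched with [wt]; [q.+4] keeps it
    above 3, as required for the powers of [r] to stay above [1 / 2]. *)
Definition stp q : nat := (n * q.+4)%N.
Definition mesh q : R := Num.sqrt (T / (stp q)%:R).

Let stp0 q : 0 < (stp q)%:R :> R.
Proof. by rewrite ltr0n muln_gt0 n0. Qed.

Lemma mesh_sqr q : mesh q ^+ 2 = T / (stp q)%:R.
Proof. by rewrite sqr_sqrtr// divr_ge0// ltW. Qed.

Lemma mesh_gt0 q : 0 < mesh q.
Proof. by rewrite sqrtr_gt0 divr_gt0. Qed.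

Lemma inv_stp_cvg0 : (stp q)%:R^-1 @[q --> \oo] --> (0 : R).
Proof.
apply/cvgrPdist_le => e e0; near=> q.
rewrite sub0r normrN gtr0_norm ?invr_gt0// -[e]invrK lef_pV2 ?posrE ?invr_gt0//.
apply: (@le_trans _ _ (q.+4%:R)); last by rewrite ler_nat /stp leq_pmull.
apply: (@le_trans _ _ (q%:R)); last by rewrite ler_nat; clear; lia.
by near: q; exact: nbhs_infty_ger.
Unshelve. all: by end_near. Qed.

Lemma mesh_sqr_cvg0 : mesh q ^+ 2 @[q --> \oo] --> (0 : R).
Proof.
under eq_fun do rewrite mesh_sqr; rewrite -(mulr0 T); apply: cvgMr; exact: inv_stp_cvg0.
Qed.

Lemma mesh_cvg0 : mesh q @[q --> \oo] --> (0 : R)^'.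
Proof.
move=> A [e /= e0 eA]; have := mesh_sqr_cvg0 => /cvgrPdist_lt/(_ (e ^+ 2)).
rewrite exprn_gt0// => /(_ isT); apply: filterS => q; rewrite sub0r normrN.
rewrite ger0_norm ?sqr_ge0// => h; apply: eA; last by rewrite gt_eqF// mesh_gt0.
rewrite /ball/= sub0r normrN ger0_norm ?(ltW (mesh_gt0 q))//.
by rewrite -(@ltr_pXn2r _ 2)// nnegrE ltW// mesh_gt0.
Qed.

Lemma gap_cvg k : cos_gap (mesh q) k @[q --> \oo] --> sq R k.
Proof. exact: (@cvg_comp _ _ _ mesh (cos_gap ^~ k) _ _ _ mesh_cvg0 (@cos_gap_cvg k)). Qed.

Let beta : R := (4 * n%:R ^+ 2 * n.+1%:R ^+ 2 / T) ^+ n.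

(** With [cos_avg = 1 - d] and [m = q.+4], [(1 - d)^m <= 1 / (1 + m d)] is of order [1 / |k|^2], and
    its [n]-th power is a multiple of [wt]. The threshold on [q] depends on [k]. *)
Lemma cos_avg_pow_small k : k != 0 ->
  \forall q \near \oo, `|cos_avg (mesh q) k| ^+ stp q <= beta * wt R k.
Proof.
move=> k0; have N1 := freq_norm_ge1 R k0; have N0 := lt_le_trans ltr01 N1.
have s0 : 0 < sq R k by rewrite -freq_norm_sqr exprn_gt0.
have h2 : 0 < sq R k / 2 by rewrite divr_gt0.
have e1 : 0 < (sq R k)^-1 by rewrite invr_gt0.
near=> q.
have g1 : sq R k / 2 <= cos_gap (mesh q) k.
  have : `|sq R k - cos_gap (mesh q) k| <= sq R k / 2.
    by near: q; move/cvgrPdist_le : (@gap_cvg k); exact.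
  exact: half_le.
have g2 : mesh q ^+ 2 * sq R k <= 1.
  have : `|0 - mesh q ^+ 2| <= (sq R k)^-1.
    by near: q; move/cvgrPdist_le : mesh_sqr_cvg0; exact.
  rewrite sub0r normrN ger0_norm ?sqr_ge0// => h.
  by apply: le_trans (ler_wpM2r (ltW s0) h) _; rewrite mulVf ?gt_eqF.
have a0 : mesh q != 0 by rewrite gt_eqF// mesh_gt0.
pose d := mesh q ^+ 2 * cos_gap (mesh q) k / (2 * n%:R).
have n1 : 1 <= n%:R :> R by rewrite ler1n.
have d0 : 0 <= d.
  by apply: divr_ge0; [apply: mulr_ge0; [exact: sqr_ge0|exact: cos_gap_ge0]|rewrite mulr_ge0].
have d1 : d <= 1.
  rewrite ler_pdivrMr ?mulr_gt0// mul1r; apply: (@le_trans _ _ (mesh q ^+ 2 * sq R k)).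
    by rewrite ler_wpM2l ?sqr_ge0// cos_gap_le.
  by apply: le_trans g2 _; rewrite -[leLHS]mul1r ler_pM// ler1n.
rewrite cos_avg_gap// -/d ger0_norm ?subr_ge0// /stp mulnC exprM.
have -> : beta * wt R k = (4 * n%:R ^+ 2 * n.+1%:R ^+ 2 / T / jp R k ^+ 2) ^+ n.
  by rewrite /beta /wt exprM -exprVn -exprMn.
have J0 := jp_gt0 R k.
rewrite lerXn2r ?nnegrE ?exprn_ge0 ?subr_ge0//.
  by rewrite !mulr_ge0 ?invr_ge0 ?exprn_ge0 ?(ltW T0) ?(ltW nR) ?(ltW J0).
set m := q.+4.
have md : T * sq R k / (4 * n%:R ^+ 2) <= 1 + m%:R * d.
  apply: (@le_trans _ _ (m%:R * d)); last by rewrite lerDr.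
  rewrite /d mesh_sqr /stp natrM -/m.
  have m0 : 0 < m%:R :> R by rewrite ltr0n.
  have -> : m%:R * (T / (n%:R * m%:R) * cos_gap (mesh q) k / (2 * n%:R)) =
    (T / (2 * n%:R ^+ 2)) * cos_gap (mesh q) k.
    by move: nR m0; move: (n%:R : R) (m%:R : R) => u w u0 w0; field; rewrite !gt_eqF.
  have -> : T * sq R k / (4 * n%:R ^+ 2) = (T / (2 * n%:R ^+ 2)) * (sq R k / 2).
    by move: nR; move: (n%:R : R) => u u0; field; rewrite gt_eqF.
  by rewrite ler_wpM2l// divr_ge0 ?mulr_ge0 ?exprn_ge0 ?(ltW T0) ?(ltW nR).
have W0 : 0 < T * sq R k / (4 * n%:R ^+ 2) by rewrite divr_gt0 ?mulr_gt0 ?exprn_gt0.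
apply: (@le_trans _ _ (T * sq R k / (4 * n%:R ^+ 2))^-1).
  rewrite -[leRHS]mul1r ler_pdivlMr//; apply: (@le_trans _ _ ((1 - d) ^+ m * (1 + d) ^+ m)).
    by rewrite ler_wpM2l ?exprn_ge0 ?subr_ge0// (le_trans md)// bernoulli_ge.
  by rewrite -exprMn exprn_ile1// -subr_sqr expr1n ?subr_ge0 ?gerBl ?sqr_ge0// exprn_ile1.
have jn := jp_le_norm R k0.
rewrite -freq_norm_sqr invf_div.
rewrite ler_pdivrMr ?mulr_gt0 ?exprn_gt0//.
have -> : 4 * n%:R ^+ 2 * n.+1%:R ^+ 2 / T / jp R k ^+ 2 * (T * freq_norm R k ^+ 2) =
   4 * n%:R ^+ 2 * ((n.+1%:R * freq_norm R k) ^+ 2 / jp R k ^+ 2).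
  by move: T0 J0; move: (n.+1%:R : R) (jp R k) => w z w0 z0; field; rewrite !gt_eqF.
rewrite ler_peMr ?mulr_ge0 ?exprn_ge0 ?(ltW nR)// ler_pdivlMr ?exprn_gt0// mul1r.
by rewrite lerXn2r ?nnegrE ?mulr_ge0 ?(ltW J0) ?(ltW N0).
Unshelve. all: by end_near. Qed.

Variable C0 : R.
Hypothesis C0_gt0 : 0 < C0.
Hypothesis om_dom : forall k, `|om k x0| <= C0 * om 0 x0.
Hypothesis betaC : beta * 3 ^+ n * C0 <= 4^-1.

Let W0 : 0 <= om 0 x0.
Proof. by rewrite -(pmulr_rge0 _ C0_gt0); exact: le_trans (om_dom 0). Qed.

Let beta_ge0 : 0 <= beta.
Proof. by rewrite exprn_ge0// !mulr_ge0 ?invr_ge0 ?exprn_ge0 ?(ltW T0) ?(ltW nR). Qed.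

(** As [cos_avg_pow_small] is not uniform in [k], the mass is split into its bound [b], whose sum is
    at most [om 0 x0 / 4] by [betaC], and the excess [ex], which vanishes eventually at each [k] and
    is dominated. *)
Lemma off_mass_small : 0 < om 0 x0 ->
  \forall q \near \oo, off_mass (mesh q) (stp q) <= om 0 x0 / 2.
Proof.
move=> W1.
pose u q k := if k == 0 then 0 else `|om k x0| * `|cos_avg (mesh q) k| ^+ stp q.
pose b k := C0 * om 0 x0 * beta * wt R k.
have zb : zdom b (C0 * om 0 x0 * beta).
  by move=> k; rewrite ger0_norm// !mulr_ge0 ?(ltW C0_gt0) ?(ltW (wt_gt0 _ _)).
pose ex q k := Num.max 0 (u q k - b k).
have zex q : zdom (ex q) D.
  move=> k; rewrite ger0_norm ?le_max ?lexx// ge_max.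
  have b0 : 0 <= b k by rewrite !mulr_ge0 ?(ltW C0_gt0) ?(ltW (wt_gt0 _ _)).
  rewrite mulr_ge0 ?(ltW (wt_gt0 _ _))//=.
  have := zdom_off (mesh q) (stp q) k; rewrite -/(u q k) => h.
  by apply: le_trans h; apply: le_trans (ler_norm _); rewrite lerBlDr lerDl.
have cex : zsum (ex q) @[q --> \oo] --> zsum (fun _ : Z => 0 : R).
  apply: (@zsum_dominated_cvg _ _ _ _ _ _ _ D); first by near=> q.
  move=> k; apply: cvg_near_cst.
  have [k0|k0] := eqVneq k 0.
    near=> q; rewrite /ex /u k0 eqxx sub0r; apply/max_idPl.
    by rewrite oppr_le0 !mulr_ge0 ?(ltW C0_gt0) ?(ltW (wt_gt0 _ _)).
  near=> q; apply/max_idPl; rewrite subr_le0 /u (negbTE k0) /b.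
  rewrite -[leRHS]mulrA; apply: ler_pM => //.
  by near: q; exact: cos_avg_pow_small.
have e4 : 0 < om 0 x0 / 4 by rewrite divr_gt0.
near=> q.
apply: (@le_trans _ _ (zsum (fun k => b k + ex q k))).
  apply: (ler_zsum (zdom_off _ _) (zdomD zb (zex q))) => k.
  by rewrite -/(u q k) -lerBlDl le_max lexx orbT.
rewrite (zsumD zb (zex q)).
have h1 : zsum b <= om 0 x0 / 4.
  apply: le_trans (ler_norm _) _; apply: le_trans (zsum_norm_le zb) _.
  rewrite (_ : _ * _ * _ * _ = om 0 x0 * (beta * 3 ^+ n * C0)); last by ring.
  by rewrite ler_wpM2l.
have h2 : zsum (ex q) <= om 0 x0 / 4.
  apply: le_trans (ler_norm _) _; have : `|zsum (fun _ : Z => 0 : R) - zsum (ex q)| <= om 0 x0 / 4.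
    by near: q; move/cvgrPdist_le : cex; exact.
  by rewrite zsum0 sub0r normrN.
apply: le_trans (lerD h1 h2) _; rewrite le_eqVlt; apply/orP; left; apply/eqP; field.
Unshelve. all: by end_near. Qed.

(** [base q k] equals [sc q (1 - r q X)] and tends to [|k|^2]. The loss [(2 N)^(- s)] of the block,
    with [N = stp q], is compensated by [sc^s], since [sc / (2 N) = n / T] for every [q]. *)
Lemma zsum_power_le : zsum (fun k => om k x0 * sq R k `^ s) <=
  - (s * (1 - s) / 8 * (n%:R / T) `^ s * om 0 x0).
Proof.
have /andP[s0 s1] := s01.
move: W0; rewrite le_eqVlt => /orP[/eqP W|W1].
  rewrite -W mulr0 oppr0 (zsum_ext (v := fun=> 0)) ?zsum0// => k.
  by have := om_dom k; rewrite -W mulr0 normr_le0 => /eqP ->; rewrite mul0r.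
(* Close enough to 1 that [r^j >= 1 / 2] up to [j = 2 N], and that the perturbation [sc * N^(-2)] of
   [base] tends to 0. *)
pose r q : R := 1 - (stp q)%:R ^- 2.
pose base q k := cos_gap (mesh q) k + 2 * n%:R / T * ((stp q)%:R^-1 * cos_avg (mesh q) k).
have stp1 q : 1 <= (stp q)%:R :> R by rewrite ler1n muln_gt0 n0.
have i1 q : (stp q)%:R^-1 <= 1 :> R by rewrite invf_le1.
have i2 q : 0 < ((stp q)%:R ^- 2 : R) <= 1.
  by rewrite invr_gt0 exprn_gt0//= invf_le1 ?exprn_gt0// exprn_ege1.
have r01 q : 0 <= r q < 1.
  by rewrite /r subr_ge0 gtrBl; have /andP[-> ->] := i2 q.
pose sc q := 2 * n%:R / mesh q ^+ 2.
have sc0 q : 0 < sc q by rewrite divr_gt0 ?mulr_gt0 ?exprn_gt0 ?mesh_gt0.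
have om1 q k : 0 <= 1 - r q * cos_avg (mesh q) k.
  rewrite subr_ge0; apply: le_trans (ler_norm _) _; rewrite normrM.
  have /andP[r0 /ltW r1] := r01 q.
  by rewrite -[leRHS]mul1r ler_pM ?cos_avg_le1// ger0_norm.
have baseE q k : base q k = sc q * (1 - r q * cos_avg (mesh q) k).
  have -> : 1 - r q * cos_avg (mesh q) k = (1 - cos_avg (mesh q) k) + (stp q)%:R ^- 2 * cos_avg (mesh q) k.
    by rewrite /r; ring.
  rewrite mulrDr; congr (_ + _).
    rewrite {1}cos_avg_gap ?gt_eqF ?mesh_gt0// /sc.
    move: (mesh_gt0 q) nR; move: (mesh q) (n%:R : R) (cos_gap _ _) => a u g a0 u0.
    by field; rewrite !gt_eqF.
  rewrite /sc mesh_sqr; move: (stp0 q); move: ((stp q)%:R : R) (cos_avg _ _) => z g z0.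
  by move: T0; move: (T) (n%:R : R) => t u t0; field; rewrite !gt_eqF.
have base0 q k : 0 <= base q k by rewrite baseE mulr_ge0// ltW.
have cb k : base q k @[q --> \oo] --> sq R k.
  rewrite -[X in _ --> X]addr0; apply: cvgD; first exact: gap_cvg.
  rewrite -(mulr0 (2 * n%:R / T)); apply: cvgMr.
  apply: (@squeeze_cvgr _ _ _ _ (fun q => - (stp q)%:R^-1) (fun q => (stp q)%:R^-1)).
  - near=> q; rewrite -ler_norml normrM gtr0_norm ?invr_gt0//.
    by rewrite ler_piMr ?cos_avg_le1// invr_ge0 ltW.
  - by rewrite -oppr0; apply: cvgN; exact: inv_stp_cvg0.
  - exact: inv_stp_cvg0.
have bb q k : `|base q k `^ s| <= (2 + 2 * n%:R / T) * jp R k ^+ 2.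
  have J1 : 1 <= jp R k ^+ 2 by rewrite exprn_ege1// jp_ge1.
  have u0 : 0 <= 2 * n%:R / T by rewrite divr_ge0 ?mulr_ge0// ltW.
  rewrite ger0_norm ?powR_ge0//; apply: le_trans (powR_le1D s01 (base0 q k)) _.
  have b1 : base q k <= jp R k ^+ 2 + 2 * n%:R / T.
    apply: lerD; last first.
      rewrite ler_piMr//; apply: le_trans (ler_norm _) _; rewrite normrM gtr0_norm ?invr_gt0//.
      by rewrite -[leRHS]mul1r ler_pM ?cos_avg_le1// invr_ge0 ltW.
    by apply: le_trans (cos_gap_le k _) (sq_le_jp R k); rewrite gt_eqF// mesh_gt0.
  rewrite mulrDl (_ : 2 * jp R k ^+ 2 = jp R k ^+ 2 + jp R k ^+ 2); last by ring.
  rewrite -addrA; apply: lerD => //; apply: le_trans b1 _.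
  by rewrite lerD2l ler_peMr.
have cz : zsum (fun k => om k x0 * base q k `^ s) @[q --> \oo] --> zsum (fun k => om k x0 * sq R k `^ s).
  apply: (@zsum_dominated_cvg _ _ _ _ _ _ _ (D * (2 + 2 * n%:R / T))).
    by near=> q; exact: zdom_om2 (bb q).
  by move=> k; apply: cvgMr; apply: (cvg_powR_seq s0 _ (cb k)) => q; exact: base0.
rewrite -(cvg_lim (@norm_hausdorff _ _) cz).
apply: limr_le; first by apply/cvg_ex; eexists; exact: cz.
near=> q.
have off : off_mass (mesh q) (stp q) <= om 0 x0 / 2 by near: q; exact: off_mass_small.
have Nq : (3 < stp q)%N by rewrite /stp (leq_trans _ (leq_pmull _ n0)).
have half : om 0 x0 / 2 = om 0 x0 - om 0 x0 / 2 by field.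
have rN j : (stp q <= j < (stp q).*2)%N -> 2^-1 <= r q ^+ j.
  move=> /andP[_ jN]; apply: le_trans (bernoulli_le j _); last first.
    by have /andP[/ltW -> ->] := i2 q.
  rewrite lerBrDr -lerBrDl; apply: (@le_trans _ _ ((stp q).*2%:R * (stp q)%:R ^- 2)).
    by rewrite ler_wpM2r ?ler_nat ?(ltnW jN)//; have /andP[/ltW] := i2 q.
  rewrite -muln2 natrM (_ : _ * _ * _ = 2 / (stp q)%:R :> R); last first.
    by move: (stp0 q); move: ((stp q)%:R : R) => z z0; field; rewrite gt_eqF.
  rewrite (_ : 1 - 2^-1 = 2 / 4 :> R); last by field.
  by rewrite ler_wpM2l// lef_pV2 ?posrE// ler_nat.
have Pc j : (stp q <= j)%N -> om 0 x0 / 2 <= zsum (fun k => om k x0 * cos_avg (mesh q) k ^+ j).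
  by move=> qj; apply: le_trans (zsum_avg_lower (mesh q) qj); rewrite half lerD2l lerN2.
have N1 : (1 < stp q)%N by exact: leq_trans Nq.
have c00 : 0 <= om 0 x0 / 2 by rewrite divr_ge0.
have main := frac_power_le_N (r01 q) N1 rN c00 Pc.
rewrite (zsum_ext (v := fun k => sc q `^ s * (om k x0 * (1 - r q * cos_avg (mesh q) k) `^ s))); last first.
  by move=> k; rewrite baseE powRM ?(ltW (sc0 q))// mulrCA.
have zd : zdom (fun k => om k x0 * (1 - r q * cos_avg (mesh q) k) `^ s) (D * ((sc q `^ s)^-1 * (2 + 2 * n%:R / T))).
  apply: zdom_om2 => k; have := bb q k; rewrite baseE powRM ?(ltW (sc0 q))// normrM.
  rewrite [ `|sc q `^ s|]ger0_norm ?powR_ge0// => h.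
  by rewrite -[leRHS]mulrA ler_pdivlMl ?powR_gt0.
rewrite (zsumZ _ zd); apply: le_trans (ler_wpM2l (powR_ge0 (sc q) s) main) _.
rewrite mulrN lerN2 le_eqVlt; apply/orP; left; apply/eqP.
have -> : n%:R / T = sc q / (stp q).*2%:R.
  rewrite /sc mesh_sqr -muln2 natrM; move: (stp0 q); move: ((stp q)%:R : R) => z z0.
  by move: T0; move: (T) (n%:R : R) => t u t0; field; rewrite !gt_eqF.
have N20 : 0 < (stp q).*2%:R :> R by rewrite ltr0n double_gt0 muln_gt0 n0.
have pN : (stp q).*2%:R^-1 `^ s = (stp q).*2%:R `^ (- s) :> R.
  by rewrite -powR_inv1 ?(ltW N20)// -powRrM mulN1r.
rewrite powRM ?invr_ge0 ?(ltW (sc0 q)) ?(ltW N20)// pN.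
by move: (sc q `^ s) ((stp q).*2%:R `^ (- s)) => A B; field.
Unshelve. all: by end_near. Qed.

End min_principle.

Lemma symb_min_principle (R : realType) (n : nat) (sigma C0 : R) :
  (0 < n)%N -> 0 < sigma < 2 -> 0 < C0 ->
  exists2 c, 0 < c & forall (om : 'rV[int]_n -> 'rV[R]_n -> R) D x0,
    (forall k x, `|om k x| <= D / jp R k ^+ (2 * n + 2)) ->
    (forall k x d, om k (x + d) + om k (x - d) = 2 * cos (freq_dot k d) * om k x) ->
    (forall x, 0 <= zsum (om ^~ x)) -> zsum (om ^~ x0) = 0 ->
    (forall k, `|om k x0| <= C0 * om 0 x0) ->
    zsum (fun k => om k x0 * symb sigma k) <= - (c * om 0 x0).
Proof.
move=> n0 /andP[sg0 sg2] C00; have nR : 0 < n%:R :> R by rewrite ltr0n.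
have C1 : 0 < 1 + C0 by rewrite addr_gt0.
(* This makes [beta] equal to [(12 (1 + C0))^(-n)], so that [beta * 3^n * C0 <= C0 / (4 (1 + C0)) <=
   1 / 4]. *)
pose T : R := 4 * n%:R ^+ 2 * n.+1%:R ^+ 2 * (12 * (1 + C0)).
have T0 : 0 < T by rewrite !mulr_gt0 ?exprn_gt0.
have s01 : 0 < sigma / 2 < 1 by rewrite divr_gt0//= ltr_pdivrMr// mul1r.
have /andP[s0 s1] := s01.
exists (sigma / 2 * (1 - sigma / 2) / 8 * (n%:R / T) `^ (sigma / 2)).
  by rewrite !mulr_gt0 ?powR_gt0 ?divr_gt0 ?subr_gt0.
move=> om D x0 om_le om_wave om_ge0 om0 om_dom.
rewrite (zsum_ext (v := fun k => om k x0 * sq R k `^ (sigma / 2))); last by move=> k; rewrite symbE.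
apply: (zsum_power_le n0 om_le om_wave om_ge0 s01 om0 T0 C00 om_dom).
have -> : 4 * n%:R ^+ 2 * n.+1%:R ^+ 2 / T = (12 * (1 + C0))^-1.
  rewrite /T; move: nR C1; move: (n%:R : R) (n.+1%:R : R) (ltr0Sn R n) (1 + C0) => u v v0 w u0 w0.
  by field; rewrite !gt_eqF.
rewrite -exprMn; apply: (@le_trans _ _ ((4 * (1 + C0))^-1 * C0)).
  have -> : (12 * (1 + C0))^-1 * 3 = (4 * (1 + C0))^-1 by field; rewrite gt_eqF.
  rewrite ler_wpM2r ?(ltW C00)// -[leRHS]expr1 ler_wiXn2l// ?invr_ge0 ?mulr_ge0 ?(ltW C1)//.
  by rewrite invf_le1 ?mulr_gt0//; move: C00; clear; lra.
by rewrite invfM -mulrA ler_piMr ?invr_ge0// ler_pdivrMl// mulr1 lerDr.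
Qed.

(** * Mollification *)

Section torus_tools.
Context (R : realType) (n : nat).
Local Notation Z := 'rV[int]_n.
Local Notation T := (torus R n).
Local Notation W := 'rV[R]_n.
Local Notation mu := (torus_measure (R := R) (n := n)).
Local Notation V := ((2 * pi : R) ^+ n).
Implicit Types (v w : T -> R) (x y d : W) (k : Z) (t : R).

Lemma ft_cosine w k a b : L1 w -> ft w k (a + b) + ft w k (a - b) = 2 * cos b * ft w k a.
Proof.
by move=> w1; rewrite -[X in ft w k (a + X)]opprK (ft_shift w1 k a (- b)) (ft_shift w1 k a b) cosN sinN; ring.
Qed.

Lemma periodic_min (f : W -> R) : continuous f -> periodic_rV f -> exists a, forall x, f a <= f x.
Proof.
move=> cf pf; pose A : set W := [set x | forall i, `[- pi, pi]%classic (x ord0 i)].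
have cA : compact A by exact: (@rV_compact R n (fun=> `[- pi, pi]%classic) (fun i => @segment_compact R _ _)).
have A0 : A !=set0.
  by exists 0 => i; rewrite mxE /= in_itv/= oppr_le0 pi_ge0.
have [|a _ ha] := EVT_min_rV A0 cA (f := f); first exact: continuous_subspaceT.
exists a => x; have [y xy hy] := lattice_reduce x; rewrite (pf _ _ xy).
by apply: ha; rewrite inE => i; rewrite /= in_itv/=; exact: hy.
Qed.

(** If the integral were 0, all Fourier coefficients would vanish, and inversion would give 0 at the
    centre, where the bump is 1. *)
Lemma tint_bump_gt0 m L (a : W) : (2 * n <= m)%N ->
  0 < tint (fun X : T => cos_bump m.+1 L (repr X - a)).
Proof.
move=> nm; have [C jb] := jackson_cos_bump R n m.+1 L.
have js := jackson_shift a jb; have B1 := jackson_L1 js.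
rewrite lt_neqAle tint_ge0 ?andbT => [|X]; last exact: cos_bump_ge0.
apply/negP => /eqP b0.
have f0 k t : ft ((fun x => cos_bump m.+1 L (x - a)) \o @repr _ T) k t = 0.
  apply/eqP; rewrite -normr_le0; apply: le_trans (ft_le _ _ B1) _.
  rewrite b0 le_eqVlt; apply/orP; left; apply/eqP; apply: eq_tint => X.
  by rewrite ger0_norm// cos_bump_ge0.
have := @cos_bump0 R n m.+1 L; rewrite -[X in cos_bump _ _ X = _](subrr a).
rewrite (@jackson_inversion _ _ (fun x => cos_bump m.+1 L (x - a)) C a); last first.
  exact: (jackson_leq _ js).
rewrite /synth (zsum_ext (v := fun=> 0)) ?zsum0 ?mulr0; last by move=> k; exact: f0.
by move/eqP; rewrite eq_sym oner_eq0.
Qed.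

Lemma bump_near m L (a x : W) : cos_bump m L (x - a) != 0 -> near_box a (2^-1 ^+ L) x.
Proof. by move=> /cos_bump_support h i; have := h i; rewrite !mxE. Qed.

Lemma half_pow_lt (e : R) : 0 < e -> exists L, 2^-1 ^+ L < e.
Proof.
move=> e0; have : (2^-1 : R) ^+ L @[L --> \oo] --> (0 : R).
  by apply: cvg_expr; rewrite ger0_norm ?invr_ge0// invf_lt1 ?ltr1n.
move=> /cvgrPdist_lt/(_ _ e0)[L _ hL]; exists L; have := hL L (leqnn L).
by rewrite /= sub0r normrN ger0_norm// exprn_ge0// invr_ge0.
Qed.

Lemma near_boxW (a x : W) (d e : R) : d <= e -> near_box a d x -> near_box a e x.
Proof. by move=> de h i; apply: le_trans (h i) de. Qed.

Lemma open_near_box_pow (O : set T) (a : W) (c : R) : 0 < c -> open O -> O (\pi_T a)%qT ->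
  exists L, forall x, near_box a (c * 2^-1 ^+ L) x -> O (\pi_T x)%qT.
Proof.
move=> c0 oO Oa; have [d d0 hd] := open_near_box oO Oa.
have [L hL] := half_pow_lt (divr_gt0 d0 c0); exists L => x h; apply: hd.
by apply: near_boxW h; rewrite mulrC -ler_pdivlMr// ltW.
Qed.

(* A nonempty open set carries a bump, hence is not negligible. *)
Lemma periodic_ae_eq0 (w : W -> R) : continuous w -> periodic_rV w ->
  {ae mu, forall X, w (repr X) = 0} -> forall a, w a = 0.
Proof.
move=> cw pw w0 a; apply/eqP/negP => /negP wa.
have cwT := continuous_torus cw pw.
pose O : set T := (w \o @repr _ T) @^-1` [set r : R | r != 0].
have oO : open O.
  apply: open_comp => [X _|]; first exact: cwT.
  exact: open_neq.
have Oa : O (\pi_T a)%qT by rewrite /O /= periodic_repr_pi.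
have [L hL] := open_near_box_pow ltr01 oO Oa.
have [C jb] := jackson_cos_bump R n (2 * n).+1 L.
have := tint_bump_gt0 L a (leqnn (2 * n)).
rewrite (_ : tint _ = 0) ?ltxx// -[RHS](mul0r V) -tint_cst; apply: eq_tint_ae.
- exact: jackson_measurable (jackson_shift a jb).
- exact: measurable_cst.
apply: filterS w0 => X wX; apply/eqP/negP => /negP /bump_near h.
have := hL (repr X); rewrite mul1r => /(_ h); rewrite /O /= reprK => /eqP; exact.
Qed.

Lemma freq_dot_le k x : `|freq_dot k x| <= jp R k * enorm x.
Proof.
apply: le_trans (ler_norm_sum _ _ _) _.
apply: (@le_trans _ _ (\sum_i `|(k 0 i)%:~R : R| * enorm x)); last first.
  by rewrite -mulr_suml ler_wpM2r ?sqrtr_ge0// sum_abs_le_jp.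
apply: ler_sum => i _; rewrite normrM ler_wpM2l//.
rewrite /enorm -(@ler_pXn2r _ 2) ?nnegrE ?sqrtr_ge0//.
rewrite sqr_sqrtr ?sumr_ge0// => [|j _]; last exact: sqr_ge0.
by rewrite real_normK ?num_real// (bigD1 i)//= lerDl sumr_ge0// => j _; exact: sqr_ge0.
Qed.

(** The wave of frequency [k] has Lipschitz constant at most [jp k], which the two spare powers in
    the decay absorb. *)
Lemma synth_lipschitz v C : L1 v ->
  (forall k t, `|ft v k t| <= C / jp R k ^+ (2 * n + 2)) ->
  forall x y, `|synth v x - synth v y| <= V^-1 * (2 * C * 3 ^+ n) * enorm (x - y).
Proof.
move=> v1 vC x y; have V0 := volume_gt0 R n.
have C0 : 0 <= C by have := vC 0 0; rewrite jp0 expr1n divr1; exact: le_trans.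
have vd : decay v C.
  move=> k t; apply: le_trans (vC k t) _; rewrite ler_wpM2l//.
  by rewrite lef_pV2 ?posrE ?exprn_gt0 ?jp_gt0// ler_weXn2l ?jp_ge1// leq_addr.
rewrite /synth -mulrBr normrM gtr0_norm ?invr_gt0// -mulrA ler_wpM2l ?invr_ge0 ?(ltW V0)//.
rewrite -(zsumB (zdom_dwave x vd) (zdom_dwave y vd)).
have -> : 2 * C * 3 ^+ n * enorm (x - y) = 2 * C * enorm (x - y) * 3 ^+ n by ring.
apply: (@zsum_norm_le R n) => k.
pose th := freq_dot k (x - y).
have -> : dwave v k x - dwave v k y = (cos th - 1) * dwave v k y + sin th * ft v k (- freq_dot k y - pi / 2).
  rewrite /dwave (_ : - freq_dot k x = - freq_dot k y - th).
    by rewrite (ft_shift v1); ring.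
  by rewrite /th freq_dotB; ring.
have th1 := freq_dot_le k (x - y).
have J0 := jp_gt0 R k.
have key (c b : R) : `|c| <= `|th| -> `|b| <= C / jp R k ^+ (2 * n + 2) ->
    `|c * b| <= C * enorm (x - y) * wt R k.
  move=> hc hb; rewrite normrM.
  apply: (@le_trans _ _ (jp R k ^+ 2 * enorm (x - y) * (C / jp R k ^+ (2 * n + 2)))).
    apply: ler_pM => //; apply: le_trans hc _; apply: le_trans th1 _.
    by rewrite ler_wpM2r ?sqrtr_ge0// -[leLHS]expr1 ler_weXn2l// jp_ge1.
  rewrite exprD /wt le_eqVlt; apply/orP; left; apply/eqP; field.
  by rewrite !expf_neq0// gt_eqF.
apply: le_trans (ler_normD _ _) _.
rewrite (_ : 2 * C * _ * _ = C * enorm (x - y) * wt R k + C * enorm (x - y) * wt R k); last by ring.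
by apply: lerD; apply: key; rewrite ?cosB1_norm_le ?sin_norm_le//; exact: vC.
Qed.

End torus_tools.

(** * Mollification on the frequency side *)

Section mollify.
Context (R : realType) (n : nat).
Local Notation Z := 'rV[int]_n.
Local Notation T := (torus R n).
Local Notation W := 'rV[R]_n.
Local Notation mu := (torus_measure (R := R) (n := n)).
Local Notation V := ((2 * pi : R) ^+ n).
Implicit Types (F h : T -> R) (x d : W) (k : Z) (t : R).
Variables (b : W -> R) (C : R).
Hypothesis jb : jackson (2 * n).+2 b C.
Let B : T -> R := b \o repr.

Let B1 : L1 B. Proof. exact: jackson_L1 jb. Qed.

(* The frequency [k] part of the mollification [x |-> \int F(Y) b(Y - x) dY]. *)
Definition mollified F k x : R :=
  V^-1 * (ft F k 0 * ft B k (freq_dot k x) +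
          ft F k (- (pi / 2)) * ft B k (freq_dot k x - pi / 2)).

Lemma mollifiedE F k x : L1 F ->
  mollified F k x = V^-1 * tint (fun Y => F Y * ft B k (freq_dot k x - freq_dot k (repr Y))).
Proof.
move=> F1; rewrite /mollified; congr (_ * _).
have w1 s := ft_integrand k s F1.
rewrite -!tintZr// -tintD; last 2 first.
- by have := L1Z (ft B k (freq_dot k x)) (w1 0); congr L1; apply/funext => Y; rewrite mulrC.
- by have := L1Z (ft B k (freq_dot k x - pi / 2)) (w1 (- (pi / 2))); congr L1; apply/funext => Y; rewrite mulrC.
apply: eq_tint => Y; rewrite (ft_shift B1 k (freq_dot k x) (freq_dot k (repr Y))) /wave addr0 cosBpihalf; ring.
Qed.

Let bE x : b x = V^-1 * zsum (fun k => ft B k (- freq_dot k x)).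
Proof. by rewrite (@jackson_inversion _ _ b C x)//; exact: jackson_leq jb. Qed.

Let ftB_le k t : `|ft B k t| <= V * C / jp R k ^+ (2 * n + 2).
Proof. by rewrite addn2; exact: ft_jackson. Qed.

Let C0 : 0 <= V * C.
Proof. by rewrite mulr_ge0 ?(ltW (volume_gt0 R n))//; exact: jackson_ge0 jb. Qed.

Let decB : decay B (V * C).
Proof.
move=> k t; apply: le_trans (ftB_le k t) _; rewrite ler_wpM2l//.
by rewrite lef_pV2 ?posrE ?exprn_gt0 ?jp_gt0// ler_weXn2l ?jp_ge1// leq_addr.
Qed.

Lemma mollified_le F k x : L1 F ->
  `|mollified F k x| <= 2 * C * tint (fun X => `|F X|) / jp R k ^+ (2 * n + 2).
Proof.
move=> F1; have V0 := volume_gt0 R n.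
rewrite normrM gtr0_norm ?invr_gt0// ler_pdivrMl//.
have -> : V * (2 * C * tint (fun X => `|F X|) / jp R k ^+ (2 * n + 2)) =
  tint (fun X => `|F X|) * (V * C / jp R k ^+ (2 * n + 2)) +
  tint (fun X => `|F X|) * (V * C / jp R k ^+ (2 * n + 2)) by ring.
by apply: le_trans (ler_normD _ _) _; apply: lerD; rewrite normrM ler_pM ?ft_le.
Qed.

Lemma mollified_wave F k x d :
  mollified F k (x + d) + mollified F k (x - d) = 2 * cos (freq_dot k d) * mollified F k x.
Proof.
rewrite /mollified !freq_dotD freq_dotN -mulrDr.
have e1 := ft_cosine k (freq_dot k x) (freq_dot k d) B1.
have e2 := ft_cosine k (freq_dot k x - pi / 2) (freq_dot k d) B1.
rewrite (_ : freq_dot k x + freq_dot k d - pi / 2 = freq_dot k x - pi / 2 + freq_dot k d); last by ring.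
rewrite (_ : freq_dot k x - freq_dot k d - pi / 2 = freq_dot k x - pi / 2 - freq_dot k d); last by ring.
move: e1 e2; move: (ft B k (freq_dot k x + _)) (ft B k (freq_dot k x - freq_dot k d)) => u1 u2.
move: (ft B k (freq_dot k x - pi / 2 + _)) (ft B k (freq_dot k x - pi / 2 - freq_dot k d)) => u3 u4.
move=> e1 e2; rewrite addrACA -[ft F k 0 * u1 + _]mulrDr -[X in _ + X]mulrDr e1 e2; ring.
Qed.

(** Inversion of [b] under the integral, by exchanging integral and lattice sum. *)
Lemma zsum_mollified F x : L1 F ->
  zsum (fun k => mollified F k x) = tint (fun Y => F Y * b (repr Y - x)).
Proof.
move=> F1; have V0 := volume_gt0 R n.
pose u (Y : T) k := ft B k (freq_dot k x - freq_dot k (repr Y)).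
have uE Y k : u Y k = ft B k (freq_dot k x) * wave k 0 (repr Y) +
    ft B k (freq_dot k x - pi / 2) * wave k (- (pi / 2)) (repr Y).
  by rewrite /u (ft_shift B1 k (freq_dot k x) (freq_dot k (repr Y))) /wave addr0 cosBpihalf; ring.
have zu Y : zdom (u Y) (V * C) by move=> k; exact: decB.
have zt : zdom (fun k => tint (fun Y => F Y * u Y k)) (V * C * tint (fun X => `|F X|)).
  move=> k; rewrite mulrAC; apply: tint_mul_le => // [|Y]; last exact: zu.
  under eq_fun do rewrite uE.
  by apply: measurable_funD; apply: measurable_funM; try exact: measurable_cst; exact: (@measurable_wave R n).
rewrite (zsum_ext (v := fun k => V^-1 * tint (fun Y => F Y * u Y k))); last first.
  by move=> k; rewrite mollifiedE.
rewrite (zsumZ _ zt) -(@tint_zsum _ _ F u (V * C))//; last first.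
  move=> k; under eq_fun do rewrite uE.
  by apply: measurable_funD; apply: measurable_funM; try exact: measurable_cst; exact: (@measurable_wave R n).
rewrite -tintZ; last first.
  apply: (L1_mul F1); last by move=> Y; exact: zsum_norm_le (zu Y).
  apply: (@measurable_zsum _ _ u (V * C)) => // k.
  under eq_fun do rewrite uE.
  by apply: measurable_funD; apply: measurable_funM; try exact: measurable_cst; exact: (@measurable_wave R n).
apply: eq_tint => Y; rewrite bE mulrCA; congr (_ * (_ * _)); apply: zsum_ext => k.
by rewrite /u freq_dotB opprB.
Qed.

(** For nonnegative [F] and [b] no coefficient exceeds the one at frequency 0 ([mollified0]); this
    feeds the domination hypothesis of the minimum principle. *)
Lemma mollified_dom F k x : L1 F -> (forall X, 0 <= F X) -> (forall y, 0 <= b y) ->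
  `|mollified F k x| <= V^-1 * tint F * tint B.
Proof.
move=> F1 F0 b0; have V0 := volume_gt0 R n.
rewrite mollifiedE// normrM gtr0_norm ?invr_gt0// -mulrA ler_wpM2l ?invr_ge0 ?(ltW V0)//.
apply: le_trans (@tint_mul_le R n F _ (tint B) F1 _ _) _.
- under eq_fun do rewrite (ft_shift B1 k (freq_dot k x)).
  have mw s := @measurable_wave R n k s.
  rewrite (_ : (fun _ => _) = fun Y : T => wave k 0 (repr Y) * ft B k (freq_dot k x) +
    wave k (- (pi / 2)) (repr Y) * ft B k (freq_dot k x - pi / 2)).
    by apply: measurable_funD; apply: measurable_funM; try exact: measurable_cst; exact: mw.
  by apply/funext => Y; rewrite /wave addr0 cosBpihalf.
- move=> Y; apply: le_trans (ft_le _ _ B1) _; rewrite le_eqVlt; apply/orP; left; apply/eqP.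
  by apply: eq_tint => X; rewrite ger0_norm// /B/=.
rewrite mulrC ler_wpM2r ?tint_ge0// => [X|]; first exact: b0.
by rewrite le_eqVlt; apply/orP; left; apply/eqP; apply: eq_tint => X; rewrite ger0_norm.
Qed.

Lemma mollified0 F x : L1 F -> mollified F 0 x = V^-1 * tint F * tint B.
Proof.
move=> F1; rewrite mollifiedE// -mulrA; congr (_ * _).
rewrite -tintZr//; apply: eq_tint => Y; congr (_ * _).
by rewrite !freq_dot0l subr0; apply: eq_tint => X; rewrite wave0 cos0 mulr1.
Qed.

Lemma mollified_symb F h sigma k x : (forall k t, ft h k t = symb sigma k * ft F k t) ->
  mollified h k x = mollified F k x * symb sigma k.
Proof. by move=> hF; rewrite /mollified !hF; ring. Qed.

End mollify.

(** * The lower bound *)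

Lemma half_minus (R : realFieldType) (w p q : R) : p <= w / 2 -> q < 0 -> w / 2 <= w - p - q.
Proof. by lra. Qed.

Lemma half_quadruple (R : realFieldType) (w p : R) : w / 2 <= p -> 2 * w <= 4 * p.
Proof. by lra. Qed.

Section lower_bound.
Context (R : realType) (n : nat).
Local Notation Z := 'rV[int]_n.
Local Notation T := (torus R n).
Local Notation W := 'rV[R]_n.
Local Notation mu := (torus_measure (R := R) (n := n)).
Local Notation V := ((2 * pi : R) ^+ n).
Implicit Types (F h : T -> R) (x d : W) (k : Z) (t : R).

Lemma zdom_rate (u : Z -> R) D : (forall k, `|u k| <= D / jp R k ^+ (2 * n + 2)) -> zdom u D.
Proof.
move=> uD; have D0 : 0 <= D by have := uD 0; rewrite jp0 expr1n divr1; exact: le_trans.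
move=> k; apply: le_trans (uD k) _; rewrite ler_wpM2l//.
by rewrite lef_pV2 ?posrE ?exprn_gt0 ?jp_gt0// ler_weXn2l ?jp_ge1// leq_addr.
Qed.

Lemma symb_le_jp (sigma : R) k : 0 < sigma < 2 -> symb sigma k <= jp R k ^+ 2.
Proof.
move=> /andP[s0 s2]; apply: (@le_trans _ _ (jp R k `^ sigma)).
  by rewrite ge0_ler_powR ?nnegrE ?freq_norm_ge0 ?(ltW (jp_gt0 _ _)) ?(ltW s0)// freq_norm_le_jp.
by rewrite -powR_mulrn ?(ltW (jp_gt0 _ _))// ler_powR ?jp_ge1// ltW.
Qed.

Lemma zdom_symb (sigma : R) (u : Z -> R) D : 0 < sigma < 2 ->
  (forall k, `|u k| <= D / jp R k ^+ (2 * n + 2)) -> zdom (fun k => u k * symb sigma k) D.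
Proof.
move=> s02 uD k; rewrite normrM [ `|symb _ _|]ger0_norm ?powR_ge0//.
apply: le_trans (ler_pM _ _ (uD k) (symb_le_jp k s02)) _; rewrite ?powR_ge0//.
rewrite exprD /wt le_eqVlt; apply/orP; left; apply/eqP; field.
by rewrite !expf_neq0// gt_eqF// jp_gt0.
Qed.

Lemma symb0 (sigma : R) : 0 < sigma -> symb sigma (0 : Z) = 0.
Proof.
move=> s0; rewrite symbE /sq big1 ?powR0 ?gt_eqF ?divr_gt0// => i _.
by rewrite mxE expr0n.
Qed.

Lemma mollified_waves (b : W -> R) C F k : jackson (2 * n).+2 b C -> exists u v : R,
  forall x, mollified b F k x = u * wave k 0 x + v * wave k (- (pi / 2)) x.
Proof.
move=> jb; have B1 := jackson_L1 jb.
pose a0 := ft F k 0; pose a1 := ft F k (- (pi / 2)).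
pose b0 := ft (b \o @repr _ T) k 0; pose b1 := ft (b \o @repr _ T) k (- (pi / 2)).
exists (V^-1 * (a0 * b0 + a1 * b1)); exists (V^-1 * (a1 * b0 - a0 * b1)) => x.
rewrite /mollified (ftE k (freq_dot k x) B1) (ftE k (freq_dot k x - pi / 2) B1).
rewrite cosBpihalf sinBpihalf /wave addr0 cosBpihalf -/a0 -/a1 -/b0 -/b1; ring.
Qed.

Variables (Psi : W -> R) (Cp sigma : R).
Hypothesis n0 : (0 < n)%N.
Hypothesis s02 : 0 < sigma < 2.
Hypothesis jP : jackson (2 * n).+2 Psi Cp.
Let P : T -> R := Psi \o repr.

Let P1 : L1 P. Proof. exact: jackson_L1 jP. Qed.

Let Cp0 : 0 <= Cp. Proof. exact: jackson_ge0 jP. Qed.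

Let mode k x : R := V^-1 * dwave P k x.

Let mode_le k x : `|mode k x| <= Cp / jp R k ^+ (2 * n + 2).
Proof.
have V0 := volume_gt0 R n.
rewrite normrM gtr0_norm ?invr_gt0// ler_pdivrMl// mulrA addn2; exact: ft_jackson.
Qed.

Let mode_bound k x : `|mode k x| <= Cp.
Proof.
apply: le_trans (mode_le k x) _; rewrite ler_piMr// invf_le1 ?exprn_gt0 ?jp_gt0//.
by rewrite exprn_ege1// jp_ge1.
Qed.

Let mode_wave k x d : mode k (x + d) + mode k (x - d) = 2 * cos (freq_dot k d) * mode k x.
Proof.
rewrite /mode -mulrDr /dwave !freq_dotD freq_dotN !opprD opprK addrC.
by rewrite ft_cosine//; ring.
Qed.

Let zdom_mode x : zdom (mode ^~ x) Cp. Proof. by apply: zdom_rate => k; exact: mode_le. Qed.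

Let zsum_mode x : zsum (mode ^~ x) = Psi x.
Proof.
rewrite (@jackson_inversion _ _ Psi Cp x); last exact: jackson_leq jP.
rewrite /synth -(zsumZ _ (C := V * Cp))// => k.
have := zdom_mode x k; have V0 := volume_gt0 R n.
by rewrite /mode normrM gtr0_norm ?invr_gt0// ler_pdivrMl// mulrA.
Qed.

Lemma mollified_lower : exists2 kappa, 0 < kappa & forall (b : W -> R) C F h,
  jackson (2 * n).+2 b C -> (forall y, 0 <= b y) ->
  L1 F -> L1 h -> (forall X, 0 <= F X) -> (forall k t, ft h k t = symb sigma k * ft F k t) ->
  (forall x, Psi x != 0 -> tint (fun Y => h Y * b (repr Y - x)) = 0) ->
  forall x, kappa * (tint F * tint (b \o @repr _ T)) * Psi x <= tint (fun Y => F Y * b (repr Y - x)).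
Proof.
have V0 := volume_gt0 R n.
(* The ratio between the bound [2 w0] on [|om k a|] for [k != 0] and the lower bound [w0 / 2] on
   [om 0 a]. *)
have four0 : 0 < 4 :> R by [].
have [c c0 hc] := symb_min_principle n0 s02 four0.
pose E := Cp * 3 ^+ n + 1.
have E0 : 0 < E by rewrite ltr_wpDl// mulr_ge0// exprn_ge0.
have Cp1 : 0 < Cp + 1 by rewrite ltr_wpDl.
(* The first entry keeps the mean of the difference above [w0 / 2]; the second makes the
   contribution of [Psi] smaller than the drop [c * om 0 a] of the minimum principle. *)
pose kap := Num.min (2 * (Cp + 1))^-1 (c / (4 * E)).
have kap0 : 0 < kap by rewrite lt_min invr_gt0 divr_gt0 ?mulr_gt0.
have kap1 : kap * Cp <= 2^-1.
  apply: (@le_trans _ _ ((2 * (Cp + 1))^-1 * Cp)); first by rewrite ler_wpM2r// ge_min lexx.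
  by rewrite invfM -mulrA ler_piMr ?invr_ge0// ler_pdivrMl// mulr1 lerDl.
have kap2 : kap * (Cp * 3 ^+ n) < c / 2.
  apply: (@le_lt_trans _ _ (c / (4 * E) * E)).
    apply: ler_pM; rewrite ?(ltW kap0)// ?mulr_ge0 ?exprn_ge0// ?ge_min ?lexx ?orbT//.
    by rewrite /E lerDl.
  have -> : c / (4 * E) * E = c / 4 by field; rewrite gt_eqF.
  by rewrite ltr_pM2l// ltf_pV2 ?posrE// ltr_nat.
exists (kap * V^-1) => [|b C F h jb b0 F1 h1 F0 hF hb x]; first by rewrite mulr_gt0 ?invr_gt0.
pose B : T -> R := b \o repr.
pose w0 := V^-1 * tint F * tint B.
have w00 : 0 <= w0 by rewrite !mulr_ge0 ?invr_ge0 ?(ltW V0) ?tint_ge0// => X; exact: b0.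
have C0 : 0 <= C by exact: jackson_ge0 jb.
have rm G k y := @mollified_le R n b C jb G k y.
pose u y := tint (fun Y => F Y * b (repr Y - y)).
have uz y : zsum (fun k => mollified b F k y) = u y by exact: (zsum_mollified jb).
have u0 y : 0 <= u y by apply: tint_ge0 => Y; rewrite mulr_ge0.
have zm G y : L1 G -> zdom (fun k => mollified b G k y) (2 * C * tint (fun X => `|G X|)).
  by move=> G1; apply: zdom_rate => k; exact: rm.
have cu : continuous u.
  move=> y; rewrite (_ : u = fun y => zsum (fun k => mollified b F k y)); last first.
    by apply/funext => z; rewrite uz.
  apply: (@zsum_dominated_cvg R n _ (nbhs y) _ _ _ (2 * C * tint (fun X => `|F X|))).
    by near=> z; exact: zm.
  move=> k; have [p [q pq]] := mollified_waves F k jb.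
  have -> : mollified b F k = fun z => p * wave k 0 z + q * wave k (- (pi / 2)) z.
    by apply/funext => z; exact: pq.
  apply: (@cvgD _ _ _ (nbhs y)); apply: (@cvgMr _ _ (nbhs y)); exact: continuous_wave.
have pu : periodic_rV u.
  move=> y z yz; rewrite -!uz; apply: zsum_ext => k.
  by have [p [q pq]] := mollified_waves F k jb; rewrite !pq !(wave_periodic _ _ yz).
pose v y := u y - kap * w0 * Psi y.
suff v0 : 0 <= v x.
  by move: v0; rewrite /v subr_ge0; apply: le_trans; rewrite /w0 le_eqVlt; apply/orP; left; apply/eqP; rewrite -/B; ring.
have cv : continuous v.
  move=> y; apply: (@cvgB _ _ _ (nbhs y)); first exact: cu.
  apply: (@cvgMr _ _ (nbhs y)); exact: jackson_continuous jP y.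
have pv : periodic_rV v.
  by move=> y z yz; rewrite /v (pu _ _ yz) (jackson_periodic jP yz).
have [a ha] := periodic_min cv pv.
rewrite leNgt; apply/negP => vx; have va : v a < 0 by exact: le_lt_trans (ha x) vx.
(* Where [Psi] vanishes, [v = u >= 0]; so the negative minimum lies where the mollified equation is
   available. *)
have Pa : Psi a != 0.
  by apply/negP => /eqP Pa; move: va; rewrite /v Pa mulr0 subr0 ltNge u0.
have w01 : 0 < w0.
  rewrite lt_neqAle w00 andbT; apply/negP => /eqP W; move: va.
  by rewrite /v -W mulr0 mul0r subr0 ltNge u0.
(* The frequency parts of [v - v a], which is nonnegative with a zero at [a]. The subtracted
   constant sits at frequency 0, where the symbol vanishes. *)
pose om k y := mollified b F k y - kap * w0 * mode k y - (if k == 0 then v a else 0).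
have zd : zdom (fun k => if k == 0 then v a else 0 : R) (`|v a|).
  have := zdom_delta (0 : Z) (fun=> v a); by rewrite /wt jp0 expr1n invr1 divr1.
have zk y := zdomZ (kap * w0) (zdom_mode y).
have omz y : zsum (om ^~ y) = v y - v a.
  rewrite (zsumB (zdomB (zm _ y F1) (zk y)) zd) (zsumB (zm _ y F1) (zk y)).
  by rewrite uz (zsumZ _ (zdom_mode y)) zsum_mode (zsum_delta 0 (fun=> v a)).
pose D := 2 * C * tint (fun X => `|F X|) + kap * w0 * Cp + `|v a|.
have omD k y : `|om k y| <= D / jp R k ^+ (2 * n + 2).
  rewrite /D 2!mulrDl; apply: le_trans (ler_normB _ _) _; apply: lerD.
    apply: le_trans (ler_normB _ _) _; apply: lerD; first exact: rm.
    have kw : 0 <= kap * w0 by rewrite mulr_ge0// ltW.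
    by rewrite normrM (ger0_norm kw) -[leRHS]mulrA ler_wpM2l.
  case: eqP => [->|_]; first by rewrite jp0 expr1n divr1.
  by rewrite normr0 divr_ge0// exprn_ge0// ltW// jp_gt0.
have omw k y d : om k (y + d) + om k (y - d) = 2 * cos (freq_dot k d) * om k y.
  have e1 := mollified_wave jb F k y d; have e2 := mode_wave k y d.
  have e3 : (if k == 0 then v a else 0) + (if k == 0 then v a else 0) =
      2 * cos (freq_dot k d) * (if k == 0 then v a else 0).
    by case: eqP => [->|_]; [rewrite freq_dot0l cos0; ring|rewrite mulr0 addr0].
  rewrite /om; move: e1 e2 e3; move: (if k == 0 then v a else 0) => z.
  move: (mollified b F k (y + d)) (mollified b F k (y - d)) (mode k (y + d)) (mode k (y - d)).
  move=> p1 p2 q1 q2 e1 e2 e3.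
  have -> : p1 - kap * w0 * q1 - z + (p2 - kap * w0 * q2 - z) = (p1 + p2) - kap * w0 * (q1 + q2) - (z + z) by ring.
  by rewrite e1 e2 e3; ring.
have om0 y : 0 <= zsum (om ^~ y) by rewrite omz subr_ge0.
have oma : zsum (om ^~ a) = 0 by rewrite omz subrr.
have om00 : w0 / 2 <= om 0 a.
  rewrite /om eqxx (mollified0 jb)// -/B -/w0.
  have h1' : kap * w0 * mode 0 a <= w0 / 2.
    rewrite -[kap * w0]mulrC -mulrA ler_wpM2l//; apply: le_trans (ler_norm _) _.
    rewrite normrM (gtr0_norm kap0); apply: le_trans kap1.
    by rewrite ler_wpM2l// ltW.
  exact: half_minus.
have omdom k : `|om k a| <= 4 * om 0 a.
  have [->|k0] := eqVneq k 0.
    have o0 : 0 <= om 0 a by apply: le_trans om00; rewrite divr_ge0.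
    by rewrite ger0_norm// ler_peMl// ler1n.
  apply: (@le_trans _ _ (2 * w0)); last first.
    exact: half_quadruple.
  rewrite /om (negbTE k0) subr0; apply: le_trans (ler_normB _ _) _.
  have h1' := mollified_dom jb k a F1 F0 b0; rewrite -/B -/w0 in h1'.
  have h2' : `|kap * w0 * mode k a| <= w0.
    have kw : 0 <= kap * w0 by rewrite mulr_ge0// ltW.
    rewrite normrM (ger0_norm kw) [kap * w0]mulrC -mulrA ler_piMr//.
    apply: (@le_trans _ _ (kap * Cp)); first by rewrite ler_wpM2l// ltW.
    by apply: le_trans kap1 _; rewrite invf_le1// ler1n.
  by apply: le_trans (lerD h1' h2') _; rewrite mulr_natl mulr2n.
have := hc om D a omD omw om0 oma omdom.
have zms := zdom_symb s02 (fun k => mode_le k a).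
have zmm := zdom_symb s02 (fun k => rm F k a F1).
rewrite (zsum_ext (v := fun k => mollified b F k a * symb sigma k - kap * w0 * (mode k a * symb sigma k))); last first.
  move=> k; rewrite /om; have [->|_] := eqVneq k 0.
    by rewrite (symb0 (proj1 (andP s02))); ring.
  by rewrite subr0; ring.
rewrite (zsumB zmm (zdomZ (kap * w0) zms)) (zsumZ _ zms).
rewrite (zsum_ext (v := fun k => mollified b h k a)); last first.
  by move=> k; rewrite (mollified_symb _ _ _ hF).
rewrite (zsum_mollified jb)// (hb _ Pa) sub0r lerN2 => hle.
have z1 : zsum (fun k => mode k a * symb sigma k) <= Cp * 3 ^+ n.
  by apply: le_trans (ler_norm _) _; exact: zsum_norm_le zms.
have : c * (w0 / 2) < c * (w0 / 2).
  apply: (@le_lt_trans _ _ (c * om 0 a)); first by rewrite ler_wpM2l// ltW.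
  apply: le_lt_trans hle _; apply: (@le_lt_trans _ _ (w0 * (kap * (Cp * 3 ^+ n)))).
    rewrite -[kap * w0]mulrC -[leLHS]mulrA ler_wpM2l// ler_wpM2l// ltW//.
  by rewrite [ltRHS]mulrCA ltr_pM2l.
by rewrite ltxx.
Unshelve. all: by end_near. Qed.

End lower_bound.

(** * The Harnack inequality *)

Section bump_family.
Context (R : realType) (n : nat).
Local Notation Z := 'rV[int]_n.
Local Notation T := (torus R n).
Local Notation W := 'rV[R]_n.
Local Notation mu := (torus_measure (R := R) (n := n)).
Local Notation V := ((2 * pi : R) ^+ n).
Implicit Types (F h : T -> R) (x y : W) (k : Z) (t : R) (X Y : T).

Lemma ler_tint_ae (v g : T -> R) : L1 v -> L1 g ->
  {ae mu, forall X, v X <= g X} -> tint v <= tint g.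
Proof.
move=> v1 g1 vg; rewrite -subr_ge0 -tintB//; have d1 := L1B g1 v1.
rewrite (@eq_tint_ae _ _ _ (fun X => `|g X - v X|)) ?tint_ge0//.
- exact: L1_measurable.
- exact: L1_measurable (L1_norm d1).
by apply: filterS vg => X h; rewrite ger0_norm// subr_ge0.
Qed.

Lemma tint_ae_eq0 (v : T -> R) : L1 v -> {ae mu, forall X, v X = 0} -> tint v = 0.
Proof.
move=> v1 v0; rewrite -[RHS](mul0r V) -tint_cst; apply: eq_tint_ae => //.
exact: L1_measurable.
Qed.

(** The constant function 1 has only the frequency 0, so its mollification does not depend on
    [x]. *)
Lemma tint_translate (b : W -> R) C x : jackson (2 * n).+2 b C ->
  tint (fun Y : T => b (repr Y - x)) = tint (b \o @repr _ T).
Proof.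
move=> jb; have V0 := volume_gt0 R n.
have c1 : L1 (fun _ : T => 1 : R).
  by apply: (@L1_bounded _ _ _ 1); [exact: measurable_cst|move=> X; rewrite normr1].
have := zsum_mollified jb x c1; under [in RHS]eq_tint do rewrite mul1r.
move=> <-; rewrite (@zsum_seq _ _ [:: 0])//; last first.
  move=> k; rewrite inE => k0; have k1 : (1 <= l1deg k)%N by rewrite lt0n l1deg_eq0.
  by rewrite /mollified !(ft_tpoly_eq0 _ (tpoly_cst n 1) k1) !mul0r addr0 mulr0.
rewrite big_seq1 (mollified0 jb)// tint_cst mul1r mulVf ?mul1r// gt_eqF//.
Qed.

(** Decay [2 n + 2] makes a synthesis Lipschitz; [extra_order] is the number of derivatives that
    [regularity] charges for it, and [bump_order] the smoothness of the bumps that supplies them. *)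
Definition decay_order : nat := (2 * n + 2)%N.
Definition extra_order : nat := (2 * decay_order * decay_order.+1)%N.
Definition bump_order : nat := (2 * n + extra_order).+1.

Lemma le_bump_order : ((2 * n).+2 <= bump_order)%N.
Proof. rewrite /bump_order ltnS -addn1 leq_add2l /extra_order /decay_order; nia. Qed.

Definition center (q : 'rV[rat]_n) : W := map_mx ratr q.

Local Notation J := ('rV[rat]_n * nat)%type.

(** Rational centres and dyadic scales give a countable family, so that exceptional null sets can be
    merged. *)
Definition psi (j : J) x : R := cos_bump bump_order j.2 (x - center j.1).

Lemma psi_jackson j : exists C, jackson bump_order (psi j) C.
Proof.
have [C jC] := jackson_cos_bump R n bump_order j.2; exists C; exact: jackson_shift jC.
Qed.

Lemma psi_ge0 j x : 0 <= psi j x. Proof. exact: cos_bump_ge0. Qed.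

Lemma psi_continuous j : continuous (psi j).
Proof. by have [C jC] := psi_jackson j; exact: jackson_continuous jC. Qed.

Lemma psi_periodic j : periodic_rV (psi j).
Proof. by have [C jC] := psi_jackson j; exact: jackson_periodic jC. Qed.

Lemma psi_measurable j : measurable_fun setT (fun X : T => psi j (repr X)).
Proof. by have [C jC] := psi_jackson j; exact: jackson_measurable jC. Qed.

Lemma psi_bounded j : exists C, forall x, `|psi j x| <= C.
Proof. by have [C jC] := psi_jackson j; exists C; exact: jackson_bounded jC. Qed.

Lemma L1_psi F j : L1 F -> L1 (fun X => F X * psi j (repr X)).
Proof.
move=> F1; have [C hC] := psi_bounded j.
by apply: (L1_mul F1 (psi_measurable j)) => X; exact: hC.
Qed.

Variable O : set T.
Hypothesis oO : open O.

(** The support of [psi j] needs only the box of size [2^(-L)]; the factor 4 leaves room for a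
    mollifier of the same scale, in view of [near_box_trans]. *)
Definition admissible (j : J) : Prop :=
  forall x, near_box (center j.1) (4 * 2^-1 ^+ j.2) x -> O (\pi_T x)%qT.

Lemma rational_near x (A : set W) : nbhs x A -> exists q, A (center q).
Proof.
move=> /nbhs_ballP[e /= e0 eA].
have qP i : {a : rat | x 0 i - e < ratr a < x 0 i}.
  apply: cid; have /rat_in_itvoo[q] : x 0 i - e < x 0 i by rewrite gtrBl.
  by rewrite in_itv; exists q.
exists (\row_i sval (qP i)); apply: eA; split=> // i j; rewrite !mxE /ball/= (ord1 i).
by case: (qP j) => a /= /andP[a1 a2]; rewrite ltr_norml; apply/andP; split; lra.
Qed.

Lemma admissible_cover X : O X -> exists j, admissible j /\ 0 < psi j (repr X).
Proof.
move=> OX; set x := repr X; have Ox : O (\pi_T x)%qT by rewrite reprK.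
(* [10 = 2 + 2 * 4]: the centre is within [2^(-L)] of [x], and the admissible box has size
   [4 * 2^(-L)]. *)
have c0 : 0 < 10 :> R by [].
have [L hL] := open_near_box_pow c0 oO Ox.
have p0 : 0 < 2^-1 ^+ L :> R by rewrite exprn_gt0// invr_gt0.
have nb : \forall y \near x, 0 < cos_bump bump_order L (x - y).
  have [C jC] := jackson_cos_bump R n bump_order L.
  have cb : continuous (fun y : W => cos_bump bump_order L (x - y)).
    move=> y; apply: (@continuous_comp _ _ _ (fun y : W => x - y) (cos_bump bump_order L)).
      by apply: (@cvgB _ _ _ (nbhs y)); [exact: cvg_cst|exact: cvg_id].
    exact: jackson_continuous jC _.
  have := cb x; rewrite /continuous_at subrr cos_bump0 => h.
  by apply: (h [set z | 0 < z]); apply: open_nbhs_nbhs; split; [exact: open_gt|exact: ltr01].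
have [q [q1 q2]] := rational_near (filterI (nbhs_near_box x p0) nb).
exists (q, L); split => // y hy; apply: hL; apply: near_boxW (near_box_trans q1 hy).
by rewrite /=; lra.
Qed.

Lemma open_far_box a d : open (~` (near_box a d : set W)).
Proof.
rewrite (_ : ~` _ = \bigcup_(i in [set: 'I_n]) ((fun x : W => cos (x 0 i - a 0 i)) @^-1` [set r : R | r < 1 - d])).
  apply: bigcup_open => i _; apply: open_comp; last exact: open_lt.
  move=> x _; apply: (@continuous_comp _ _ _ (fun x : W => x 0 i - a 0 i) cos).
    by apply: (@cvgB _ _ _ (nbhs x)); [exact: coord_continuous|exact: cvg_cst].
  exact: continuous_cos.
apply/seteqP; split => x.
  by rewrite /= /near_box /= => /existsNP[i /negP]; rewrite -ltNge => h; exists i => //=; lra.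
by move=> [i _ /= h] nx; have := nx i; lra.
Qed.

Variable sigma : R.
Hypothesis s02 : 0 < sigma < 2.

(* The fourth clause is [(-Delta)^(sigma/2) F = h], read on Fourier coefficients. *)
Definition nonneg_solution F h : Prop :=
  [/\ L1 F, L1 h, forall X, 0 <= F X, forall k t, ft h k t = symb sigma k * ft F k t
    & {ae mu, forall X, O X -> h X = 0}].

(** The constant precedes the solution. Admissibility is placed inside the conjunction so that
    [choice] yields one function of all [j]. *)
Lemma psi_regularity j : exists C, 0 <= C /\ (admissible j -> forall F h, nonneg_solution F h ->
  forall k t, `|ft (fun X => F X * psi j (repr X)) k t| <= C * tint F / jp R k ^+ (2 * n + 2)).
Proof.
have [aj|aj] := pselect (admissible j); last by exists 0.
have [C jC] := psi_jackson j; pose v : T -> R := psi j \o repr.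
have v1 : L1 v by exact: jackson_L1 jC.
have vD k t : `|ft v k t| <= V * C / jp R k ^+ (2 * n + extra_order.+1).
  by rewrite addnS; exact: ft_jackson.
have sv x : synth v x = psi j x.
  rewrite -(@jackson_inversion _ _ (psi j) C x)//; apply: (jackson_leq _ jC).
  by apply: leq_trans le_bump_order.
pose U : set W := ~` near_box (center j.1) (2^-1 ^+ j.2).
have v0 x : U x -> synth v x = 0.
  by move=> Ux; rewrite sv; apply/eqP/negP => /negP /bump_near.
have s02' : 0 < sigma <= 2 by case/andP: s02 => -> /ltW ->.
have [B B0 hB] := regularity v1 vD (@open_far_box _ _) v0 s02' (leqnSn extra_order).
exists B; split => // _ F h [F1 h1 F0 hF hO] k t.
have fh : frac_harmonic U sigma F h.
  split => //; apply: filterS hO => X hX.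
  have [NX|UX] := pselect (near_box (center j.1) (2^-1 ^+ j.2) (repr X)); last by right.
  left; apply: hX; rewrite -[X]reprK; apply: aj; apply: near_boxW NX.
  by rewrite ler_peMl ?exprn_ge0 ?invr_ge0// ler1n.
have := hB F h k t fh; rewrite (_ : (fun X => F X * synth v (repr X)) = fun X => F X * psi j (repr X)).
  by rewrite (eq_tint (g := F))// => X; rewrite ger0_norm.
by apply/funext => X; rewrite sv.
Qed.

Definition local_rep F j : W -> R := synth (fun X : T => F X * psi j (repr X)).

Section solution.
Variables (F h : T -> R).
Hypothesis sol : nonneg_solution F h.
Implicit Types (i j : J).

Let F1 : L1 F. Proof. by case: sol. Qed.

Lemma local_decay j : admissible j -> exists C, decay (fun X : T => F X * psi j (repr X)) C.
Proof.
move=> aj; have [C [C0 hC]] := psi_regularity j; exists (C * tint F) => k t.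
apply: le_trans (hC aj _ _ sol k t) _; rewrite ler_wpM2l//.
  by rewrite mulr_ge0 ?tint_ge0//; case: sol.
by rewrite lef_pV2 ?posrE ?exprn_gt0 ?jp_gt0// ler_weXn2l ?jp_ge1// leq_addr.
Qed.

Lemma local_rep_continuous j : admissible j -> continuous (local_rep F j).
Proof. by move=> /local_decay[C dC]; exact: synth_continuous (L1_psi j F1) dC. Qed.

Lemma local_rep_periodic j : periodic_rV (local_rep F j).
Proof. exact: synth_periodic (L1_psi j F1). Qed.

Lemma local_rep_ae j : admissible j ->
  {ae mu, forall X, F X * psi j (repr X) = local_rep F j (repr X)}.
Proof.
move=> aj; have [C dC] := local_decay aj; have f1 := L1_psi j F1.
have g1 : L1 (local_rep F j \o @repr _ T).
  apply: L1_periodic; [exact: local_rep_continuous|exact: local_rep_periodic|].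
  by move=> x; exact: synth_le dC.
have d0 k t : ft (fun X => F X * psi j (repr X) - local_rep F j (repr X)) k t = 0.
  by rewrite (ftB k t f1 g1) (ft_synth k t f1 dC) subrr.
by apply: filterS (ft_unique (L1B f1 g1) d0) => X /eqP; rewrite subr_eq0 => /eqP.
Qed.

(** Both sides are continuous and equal [F psi_i psi_j] almost everywhere. *)
Lemma local_rep_consistent i j x : admissible i -> admissible j ->
  local_rep F i x * psi j x = local_rep F j x * psi i x.
Proof.
move=> ai aj; apply/eqP; rewrite -subr_eq0; apply/eqP.
apply: (@periodic_ae_eq0 _ _ (fun x => local_rep F i x * psi j x - local_rep F j x * psi i x)).
- move=> y; apply: (@cvgB _ _ _ (nbhs y)).
    by apply: (@cvgM _ _ (nbhs y)); [exact: local_rep_continuous|exact: psi_continuous].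
  by apply: (@cvgM _ _ (nbhs y)); [exact: local_rep_continuous|exact: psi_continuous].
- move=> y z yz.
  by rewrite !(local_rep_periodic _ yz) !(psi_periodic _ yz).
apply: filterS2 (local_rep_ae ai) (local_rep_ae aj) => X ei ej.
by rewrite -ei -ej; ring.
Qed.

Definition covered X j : Prop := admissible j /\ 0 < psi j (repr X).

(** The value does not depend on the chosen bump by [local_rep_consistent]; the default 0 never
    occurs on [O] by [admissible_cover]. *)
Definition cont_rep X : R :=
  match pselect (exists j, covered X j) with
  | left e => let j := projT1 (cid e) in local_rep F j (repr X) / psi j (repr X)
  | right _ => 0
  end.

(** Valid even where [psi j] vanishes, which is what allows summation over a whole cover. *)
Lemma cont_rep_mul X j : O X -> admissible j ->
  cont_rep X * psi j (repr X) = local_rep F j (repr X).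
Proof.
move=> /admissible_cover eX aj; rewrite /cont_rep; case: pselect => // e.
case: (cid e) => i [ai i0] /=; rewrite mulrAC -(local_rep_consistent _ aj ai).
by rewrite mulfK// gt_eqF.
Qed.

Lemma cont_repE X j : O X -> covered X j -> cont_rep X = local_rep F j (repr X) / psi j (repr X).
Proof. by move=> OX [aj j0]; rewrite -(cont_rep_mul OX aj) mulfK// gt_eqF. Qed.

Lemma open_psi_pos j : open [set X : T | 0 < psi j (repr X)].
Proof.
apply: (@open_comp _ _ (psi j \o @repr _ T) [set r : R | 0 < r]); last exact: open_gt.
by move=> X _; apply: continuous_torus; [exact: psi_continuous|exact: psi_periodic].
Qed.

Lemma cont_rep_continuous X : O X -> {for X, continuous cont_rep}.
Proof.
move=> OX; have [j [aj j0]] := admissible_cover OX.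
have cl : continuous (local_rep F j \o @repr _ T).
  by apply: continuous_torus; [exact: local_rep_continuous|exact: local_rep_periodic].
have cp : continuous (psi j \o @repr _ T).
  by apply: continuous_torus; [exact: psi_continuous|exact: psi_periodic].
have nX : \forall Y \near X, O Y /\ 0 < psi j (repr Y).
  by apply: filterI; apply: open_nbhs_nbhs; split => //; exact: open_psi_pos.
have cc : (fun Y : T => local_rep F j (repr Y) / psi j (repr Y)) @ X --> cont_rep X.
  rewrite (cont_repE OX (conj aj j0)).
  apply: (@cvgM _ _ (nbhs X)); first exact: cl.
  by apply: (@cvgV _ _ (nbhs X)); [rewrite gt_eqF|exact: cp].
have nE : \forall Y \near nbhs X, local_rep F j (repr Y) / psi j (repr Y) = cont_rep Y.
  by near=> Y; have [OY Y0] : O Y /\ 0 < psi j (repr Y) by [near: Y]; rewrite (cont_repE OY (conj aj Y0)).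
exact: cvg_trans (near_eq_cvg nE) cc.
Unshelve. all: by end_near.
Qed.

(** The indices are countable, so the null sets of all the local representatives merge into one. *)
Lemma cont_rep_ae : {ae mu, forall X, O X -> F X = cont_rep X}.
Proof.
have cJ : {ae mu, forall X m, forall j, pickle_inv m = Some j -> admissible j ->
    F X * psi j (repr X) = local_rep F j (repr X)}.
  apply/ae_foralln => m.
  case e : (pickle_inv m : option J) => [j|]; last by apply: aeW => X j.
  have [aj|aj] := pselect (admissible j); last by apply: aeW => X i [<-].
  by apply: filterS (local_rep_ae aj) => X hX i [<-].
apply: filterS cJ => X hX OX; have [j [aj j0]] := admissible_cover OX.
have := hX (choice.pickle j) j (pickleK_inv j) aj; rewrite -(cont_rep_mul OX aj).
by move/mulIf; apply; rewrite gt_eqF.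
Qed.

End solution.

End bump_family.

Lemma quotient_diff (R : numFieldType) (s1 s2 t1 t2 : R) : t1 != 0 -> t2 != 0 ->
  s1 / t1 - s2 / t2 = ((s1 - s2) + s2 / t2 * (t2 - t1)) / t1.
Proof. by move=> h1 h2; field; rewrite h1. Qed.

Lemma quotient_lipschitz (R : realFieldType) (s t1 t2 g N A B e p L : R) :
  0 < p -> p <= t1 -> 0 <= e -> 0 <= L -> `|s| <= N * e -> `|t1 - t2| <= B * e ->
  `|g| <= A -> N + A * B <= L * p -> `|(s + g * (t2 - t1)) / t1| <= L * e.
Proof.
move=> p0 pt e0 L0 hs ht hg hL; have t0 : 0 < t1 by exact: lt_le_trans pt.
rewrite normrM normfV (gtr0_norm t0) ler_pdivrMr//.
apply: (@le_trans _ _ ((N + A * B) * e)).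
  apply: le_trans (ler_normD _ _) _; rewrite mulrDl lerD//.
  by rewrite normrM -mulrA ler_pM// distrC.
apply: (@le_trans _ _ (L * p * e)); first by rewrite ler_wpM2r.
by rewrite [leRHS]mulrAC ler_wpM2r// ler_wpM2l.
Qed.

(** * Comparison of the two bounds over a finite cover *)

Section harnack.
Context (R : realType) (n : nat).
Local Notation Z := 'rV[int]_n.
Local Notation T := (torus R n).
Local Notation W := 'rV[R]_n.
Local Notation J := ('rV[rat]_n * nat)%type.
Local Notation mu := (torus_measure (R := R) (n := n)).
Local Notation V := ((2 * pi : R) ^+ n).
Implicit Types (F h : T -> R) (x y : W) (k : Z) (t : R) (X Y : T).
Hypothesis n0 : (0 < n)%N.
Variables (O : set T) (sigma : R).
Hypothesis oO : open O.
Hypothesis s02 : 0 < sigma < 2.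

Variable D : seq J.
Hypothesis Dadm : forall j, j \in D -> admissible O j.

Definition bump_sum x : R := \sum_(j <- D) psi j x.

Lemma bump_sum_jackson : exists C, jackson (bump_order n) bump_sum C.
Proof. by apply: jackson_sum => j; exact: psi_jackson. Qed.

Lemma bump_sum_neq0 x : bump_sum x != 0 -> exists2 j, j \in D & psi j x != 0.
Proof.
move=> Px; apply: contrapT => nj; move/eqP: Px; apply; rewrite /bump_sum big_seq big1// => j jD.
by apply/eqP; apply: contrapT => /negP pj; apply: nj; exists j.
Qed.

(** A failure at [X] would persist strictly on a neighbourhood, by continuity; a mollifier supported
    there would contradict [mollified_lower], whose constant does not depend on the mollifier. *)
Lemma cont_rep_lower : exists2 kappa, 0 < kappa & forall F h, nonneg_solution O sigma F h ->
  forall X, O X -> kappa * tint F * bump_sum (repr X) <= cont_rep O F X.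
Proof.
have [Cp jP] := bump_sum_jackson; have jP2 := jackson_leq (le_bump_order n) jP.
have [kap kap0 hk] := mollified_lower n0 s02 jP2.
exists kap => // F h sol X OX; have [F1 h1 F0 hF hO] := sol.
pose x := repr X; pose q := kap * tint F * bump_sum x.
rewrite leNgt; apply/negP => lt; have ltq : cont_rep O F X < q by [].
pose e := (cont_rep O F X + q) / 2; have [ge eq] : cont_rep O F X < e /\ e < q.
  by split; case: (midf_lt ltq).
have nX : nbhs X [set Y | O Y /\ cont_rep O F Y < e].
  apply: filterI; first by apply: open_nbhs_nbhs.
  have := @cont_rep_continuous _ _ _ oO _ s02 _ _ sol _ OX => cX.
  by apply: (cX [set r | r < e]); apply: open_nbhs_nbhs; split; [exact: open_lt|].
move: nX; rewrite nbhsE => -[U [oU UX] US].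
have Ux : U (\pi_T x)%qT by rewrite reprK.
have [L0 hL0] := open_near_box_pow ltr01 oU Ux.
(* Fine enough for the neighbourhood of [X], and at least as fine as every bump of the cover, so
   that mollifiers centred in their supports stay in the admissible boxes. *)
pose L := (L0 + \max_(j <- D) j.2)%N.
have L0L : (L0 <= L)%N by exact: leq_addr.
have DL j : j \in D -> (j.2 <= L)%N.
  by move=> jD; apply: leq_trans (leq_addl _ _); exact: (@leq_bigmax_seq _ _ xpredT (fun j : J => j.2)).
have pow_le a c : (a <= c)%N -> 2^-1 ^+ c <= 2^-1 ^+ a :> R.
  by move=> ac; rewrite ler_wiXn2l ?invr_ge0// invf_le1// ler1n.
have [C jC] := jackson_cos_bump R n (bump_order n) L.
pose b : W -> R := cos_bump (bump_order n) L.
have jb : jackson (2 * n).+2 b C by exact: jackson_leq (le_bump_order n) jC.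
have b0 y : 0 <= b y by exact: cos_bump_ge0.
have mb y : measurable_fun setT (fun Y : T => b (repr Y - y)).
  exact: jackson_measurable (jackson_shift y jb).
have bb y (Y : T) : `|b (repr Y - y)| <= C by exact: jackson_bounded jb _.
have hb y : bump_sum y != 0 -> tint (fun Y => h Y * b (repr Y - y)) = 0.
  move=> /bump_sum_neq0[j jD pj]; apply: tint_ae_eq0.
    exact: L1_mul h1 (mb y) (bb y).
  apply: filterS hO => Y hY; have [bY|bY] := eqVneq (b (repr Y - y)) 0; first by rewrite bY mulr0.
  rewrite hY ?mul0r//; rewrite -[Y]reprK; apply: (Dadm jD).
  apply: near_boxW (near_box_trans (bump_near pj) (bump_near bY)).
  rewrite (_ : 4 * 2^-1 ^+ j.2 = 2 * 2^-1 ^+ j.2 + 2 * 2^-1 ^+ j.2); last by ring.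
  by rewrite lerD2l ler_wpM2l// pow_le// DL.
have main := hk b C F h jb b0 F1 h1 F0 hF hb x.
have tb : 0 < tint (b \o @repr _ T).
  rewrite -(tint_translate x jb); apply: tint_bump_gt0; exact: leq_addr.
have : tint (fun Y => F Y * b (repr Y - x)) <= e * tint (b \o @repr _ T).
  rewrite -(tint_translate x jb) -tintZ; last exact: L1_bounded (mb x) (bb x).
  apply: ler_tint_ae; first exact: L1_mul F1 (mb x) (bb x).
    by apply: L1Z; exact: L1_bounded (mb x) (bb x).
  have := @cont_rep_ae _ _ _ oO _ s02 _ _ sol; apply: filterS => Y FY.
  have [bY|bY] := eqVneq (b (repr Y - x)) 0; first by rewrite bY !mulr0.
  have UY : U Y.
    rewrite -[Y]reprK; apply: hL0; rewrite mul1r.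
    exact: near_boxW (pow_le _ _ L0L) (bump_near bY).
  have [OY gY] := US _ UY; rewrite ler_wpM2r// FY// ltW//.
move/(le_trans main).
have -> : kap * (tint F * tint (b \o repr)) * bump_sum x = q * tint (b \o @repr _ T) by rewrite /q; ring.
by rewrite ler_pM2r// leNgt eq.
Qed.

Lemma cont_rep_bump_sum F h X : nonneg_solution O sigma F h -> O X ->
  cont_rep O F X * bump_sum (repr X) = \sum_(j <- D) local_rep F j (repr X).
Proof.
move=> sol OX; rewrite /bump_sum mulr_sumr big_seq [RHS]big_seq; apply: eq_bigr => j jD.
exact: (cont_rep_mul oO s02 sol OX (Dadm jD)).
Qed.

Lemma local_rep_bounds : exists2 B, 0 <= B & forall F h, nonneg_solution O sigma F h ->
  (forall x, `|\sum_(j <- D) local_rep F j x| <= B * tint F) /\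
  (forall x y, `|\sum_(j <- D) local_rep F j x - \sum_(j <- D) local_rep F j y| <=
     B * tint F * enorm (x - y)).
Proof.
have [Cf hC] := choice (psi_regularity O s02).
have V0 := volume_gt0 R n.
have Cf0 j : 0 <= Cf j by case: (hC j).
exists (\sum_(j <- D) V^-1 * (2 * Cf j * 3 ^+ n)).
  by apply: sumr_ge0 => j _; rewrite mulr_ge0 ?invr_ge0 ?(ltW V0)// !mulr_ge0// exprn_ge0.
move=> F h sol; have [F1 _ F0 _ _] := sol; have M0 : 0 <= tint F by exact: tint_ge0.
have dec j : j \in D -> forall k t, `|ft (fun X => F X * psi j (repr X)) k t| <=
    Cf j * tint F / jp R k ^+ (2 * n + 2).
  by move=> jD; exact: (hC j).2 (Dadm jD) _ _ sol.
split=> [x|x y].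
  apply: le_trans (ler_norm_sum _ _ _) _; rewrite mulr_suml big_seq [leRHS]big_seq.
  apply: ler_sum => j jD.
  have dj : decay (fun X : T => F X * psi j (repr X)) (Cf j * tint F).
    move=> k t; apply: le_trans (dec _ jD k t) _; rewrite ler_wpM2l ?mulr_ge0//.
    by rewrite lef_pV2 ?posrE ?exprn_gt0 ?jp_gt0// ler_weXn2l ?jp_ge1// leq_addr.
  apply: le_trans (synth_le x dj) _; rewrite -[leRHS]mulrA ler_wpM2l ?invr_ge0 ?(ltW V0)//.
  have -> : 2 * Cf j * 3 ^+ n * tint F = Cf j * tint F * 3 ^+ n + Cf j * tint F * 3 ^+ n by ring.
  by rewrite lerDl !mulr_ge0 ?exprn_ge0.
rewrite -sumrB; apply: le_trans (ler_norm_sum _ _ _) _.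
rewrite !mulr_suml big_seq [leRHS]big_seq; apply: ler_sum => j jD.
apply: le_trans (synth_lipschitz (L1_psi j F1) (dec _ jD) x y) _.
by rewrite le_eqVlt; apply/orP; left; apply/eqP; ring.
Qed.

Lemma bump_sum_lipschitz : exists2 B, 0 <= B & forall x y, `|bump_sum x - bump_sum y| <= B * enorm (x - y).
Proof.
have [C jC] := bump_sum_jackson; have V0 := volume_gt0 R n.
have jC2 := jackson_leq (le_bump_order n) jC.
exists (V^-1 * (2 * (V * C) * 3 ^+ n)).
  rewrite mulr_ge0 ?invr_ge0 ?(ltW V0)// mulr_ge0 ?exprn_ge0// mulr_ge0//.
  by rewrite mulr_ge0 ?(ltW V0)//; exact: jackson_ge0 jC.
move=> x y; have inv z := @jackson_inversion _ _ bump_sum C z (jackson_leq (leqnSn _) jC2).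
rewrite !inv; apply: synth_lipschitz; first exact: jackson_L1 jC.
by move=> k t; rewrite addn2; exact: ft_jackson.
Qed.

Lemma torus_dist_lub (X Y : T) (r L : R) : 0 < L ->
  (forall x y, (\pi_T x)%qT = X -> (\pi_T y)%qT = Y -> r <= L * enorm (x - y)) ->
  r <= L * torus_dist X Y.
Proof.
move=> L0 h; rewrite -ler_pdivrMl//; apply: lb_le_inf.
  by exists (enorm (repr X - repr Y)); exists (repr X), (repr Y); rewrite !reprK.
by move=> _ [x [y [xX yY ->]]]; rewrite ler_pdivrMl//; exact: h.
Qed.

(** The exponent has to be strictly below 1; interpolation with the sup bound gives [1 / 2], through
    [|g X - g Y|^2 <= (2 A) (L d)]. *)
Lemma hoelder_of_lipschitz (K : set T) (g : T -> R) (A L : R) : 0 < L -> 0 <= A ->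
  (forall X, K X -> `|g X| <= A) ->
  (forall X Y, K X -> K Y -> `|g X - g Y| <= L * torus_dist X Y) -> hoelder_on K g.
Proof.
move=> L0 A0 gA gL; exists 2^-1, (Num.sqrt (2 * A * L)); split.
  by rewrite invr_gt0 ltr0n/= invf_lt1// ltr1n.
move=> X Y KX KY; have d1 := gL _ _ KX KY; set d := torus_dist X Y in d1 *.
have d0 : 0 <= d by rewrite -(pmulr_rge0 _ L0); exact: le_trans d1.
have d2 : `|g X - g Y| <= 2 * A.
  by apply: le_trans (ler_normB _ _) _; rewrite mulr_natl mulr2n lerD// gA.
rewrite powR12_sqrt// -sqrtrM ?mulr_ge0 ?(ltW L0)//.
rewrite -(@ler_pXn2r _ 2) ?nnegrE ?sqrtr_ge0// sqr_sqrtr; last by rewrite !mulr_ge0// ltW.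
by rewrite expr2 -[leRHS]mulrA ler_pM.
Qed.

Variables (K : set T) (p0 : R).
Hypothesis KO : K `<=` O.
Hypothesis p0_gt0 : 0 < p0.
Hypothesis bump_sum_ge : forall X, K X -> p0 <= bump_sum (repr X).

Lemma harnack_cover : exists C, 0 < C /\ forall F h, nonneg_solution O sigma F h ->
  (ereal_sup [set (cont_rep O F X)%:E | X in K] <=
     C%:E * ereal_inf [set (cont_rep O F X)%:E | X in K])%E /\ hoelder_on K (cont_rep O F).
Proof.
have [kap kap0 lower] := cont_rep_lower.
have [B B0 bounds] := local_rep_bounds; have [Bt Bt0 lipt] := bump_sum_lipschitz.
(* The ratio of the upper bound [B / p0 * tint F] to the lower bound [kap * p0 * tint F]; the added
   1 keeps it positive when [B = 0]. *)
exists (B / (kap * p0 ^+ 2) + 1); have C0 : 0 < B / (kap * p0 ^+ 2) + 1.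
  by rewrite ltr_wpDl// divr_ge0// mulr_ge0 ?exprn_ge0 ?ltW.
split=> // F h sol; have [F1 _ F0 _ _] := sol; have M0 : 0 <= tint F by exact: tint_ge0.
have [ub lip] := bounds F h sol.
pose S x := \sum_(j <- D) local_rep F j x.
have tp X : K X -> 0 < bump_sum (repr X) by move=> KX; exact: lt_le_trans (bump_sum_ge KX).
have gE X : K X -> cont_rep O F X = S (repr X) / bump_sum (repr X).
  by move=> KX; rewrite /S -(cont_rep_bump_sum sol (KO KX)) mulfK// gt_eqF// tp.
have up X : K X -> `|cont_rep O F X| <= B / p0 * tint F.
  move=> KX; rewrite gE// normrM normfV (gtr0_norm (tp _ KX)) mulrAC.
  apply: ler_pM => //; first by rewrite invr_ge0 ltW// tp.
    exact: ub.
  by rewrite lef_pV2 ?posrE ?tp// bump_sum_ge.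
have lo X : K X -> kap * p0 * tint F <= cont_rep O F X.
  move=> KX; apply: le_trans (lower _ _ sol _ (KO KX)).
  rewrite mulrAC ler_wpM2l ?mulr_ge0 ?(ltW kap0)//; exact: bump_sum_ge.
split.
  apply: (@le_trans _ _ (B / p0 * tint F)%:E).
    apply: ge_ereal_sup => _ [X KX <-]; rewrite lee_fin.
    by apply: le_trans (ler_norm _) (up _ KX).
  apply: (@le_trans _ _ ((B / (kap * p0 ^+ 2) + 1)%:E * (kap * p0 * tint F)%:E)%E); last first.
    apply: lee_wpmul2l; first by rewrite lee_fin ltW.
    by apply/ereal_infP => _ [X KX <-]; rewrite lee_fin; exact: lo.
  rewrite -EFinM lee_fin mulrDl mul1r.
  have -> : B / (kap * p0 ^+ 2) * (kap * p0 * tint F) = B / p0 * tint F.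
    by move: kap0 p0_gt0 => u v; field; rewrite !gt_eqF.
  by rewrite lerDl !mulr_ge0 ?(ltW kap0) ?(ltW p0_gt0).
pose A := B / p0 * tint F.
have A0 : 0 <= A by rewrite !mulr_ge0 ?invr_ge0 ?(ltW p0_gt0).
pose L := (B * tint F + A * Bt) / p0 + 1.
have N0 : 0 <= B * tint F + A * Bt by apply: addr_ge0; exact: mulr_ge0.
have L0 : 0 < L by rewrite ltr_wpDl// divr_ge0// ltW.
have upA X : K X -> `|cont_rep O F X| <= A by exact: up.
have LE : B * tint F + A * Bt <= L * p0.
  by rewrite /L mulrDl divfK ?gt_eqF// lerDl mul1r ltW.
clearbody L A; apply: (hoelder_of_lipschitz L0 A0) => // X Y KX KY.
apply: torus_dist_lub => // x y xX yY.
have [Ct jCt] := bump_sum_jackson.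
have ptot := jackson_periodic jCt.
have Sper : periodic_rV S.
  by move=> u v uv; apply: eq_bigr => j _; exact: (local_rep_periodic sol j uv).
have tX : bump_sum (repr X) = bump_sum x by rewrite -xX (periodic_repr_pi _ ptot).
have tY : bump_sum (repr Y) = bump_sum y by rewrite -yY (periodic_repr_pi _ ptot).
have SX : S (repr X) = S x by rewrite -xX (periodic_repr_pi _ Sper).
have SY : S (repr Y) = S y by rewrite -yY (periodic_repr_pi _ Sper).
have tx0 := tp _ KX; have ty0 := tp _ KY; have uY := upA _ KY.
rewrite tX in tx0; rewrite tY in ty0.
have gY := gE _ KY; have gX := gE _ KX; rewrite SY tY in gY; rewrite SX tX in gX.
have pX : p0 <= bump_sum x by rewrite -tX bump_sum_ge.
have -> : cont_rep O F X - cont_rep O F Y =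
    ((S x - S y) + cont_rep O F Y * (bump_sum y - bump_sum x)) / bump_sum x.
  by rewrite gX gY; apply: quotient_diff; rewrite gt_eqF.
have e0 : 0 <= enorm (x - y) by exact: sqrtr_ge0.
exact: (quotient_lipschitz p0_gt0 pX e0 (ltW L0) (lip x y) (lipt x y) uY LE).
Qed.

End harnack.

Theorem theorem1p2 (R : realType) (n : nat) (hn : (0 < n)%N)
    (sigma : R) (hsigma : 0 < sigma < 2)
    (O : set (torus R n)) (hO : open O)
    (K : set (torus R n)) (hK : compact K) (hKO : K `<=` O) :
  exists C : R, 0 < C /\
    forall f : torus R n -> R,
      Dom_Laplacian f ->
      (exists2 h : torus R n -> R, is_frac_Laplacian sigma f h &
         {ae @torus_measure R n, forall x, O x -> h x = 0}) ->
      {ae @torus_measure R n, forall x, 0 <= f x} ->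
      exists g : torus R n -> R,
        [/\ {within O, continuous g},
            {ae @torus_measure R n, forall x, O x -> f x = g x},
            (ereal_sup [set (g x)%:E | x in K]
               <= C%:E * ereal_inf [set (g x)%:E | x in K])%E
          & hoelder_on K g].
Proof.
pose J := ('rV[rat]_n * nat)%type.
pose pos (j : J) := [set X : torus R n | 0 < psi j (repr X)].
(* The finite cover, and with it [p0] and [C], is fixed before [f] is introduced. *)
have [E sE KE] : finite_subset_cover [set j | admissible O j] pos K.
  move: (hK); rewrite compact_cover; apply; first by move=> j _; exact: open_psi_pos.
  by move=> X /hKO OX; have [j [aj j0]] := admissible_cover hO OX; exists j.
pose D : seq J := E.
have Dadm j : j \in D -> admissible O j by move=> /sE; rewrite inE.
have tot0 X : K X -> 0 < bump_sum D (repr X).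
  move=> /KE[j /= jE j0]; rewrite /bump_sum (big_rem j)//= ltr_pwDl// sumr_ge0// => i _.
  exact: psi_ge0.
have [p0 p00 hp] : exists2 p0, 0 < p0 & forall X, K X -> p0 <= bump_sum D (repr X).
  have [->|/set0P K0] := eqVneq K set0; first by exists 1.
  have [C jC] := bump_sum_jackson R D.
  have ct : continuous (bump_sum D \o @repr _ (torus R n)).
    by apply: continuous_torus; [exact: jackson_continuous jC|exact: jackson_periodic jC].
  have [c cK hc] := compact_EVT_min K0 hK (continuous_subspaceT ct).
  exists (bump_sum D (repr c)) => [|X KX]; first by apply: tot0; rewrite inE in cK.
  by apply: hc; rewrite inE.
have [C [C0 hC]] := harnack_cover hn hO hsigma Dadm hKO p00 hp.
exists C; split=> // f [f2 _] [h hf hO'] f0.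
have f1 := L1_Lfun2 f2; have [h2 _] := hf; have h1 := L1_Lfun2 h2.
(* [|f|] agrees with [f] almost everywhere, so it has the same Fourier coefficients, and it is
   nonnegative at every point. *)
have sol : nonneg_solution O sigma (fun X => `|f X|) h.
  split=> //; first exact: L1_norm.
  move=> k t; rewrite (ft_frac_Laplacian f1 hf); congr (_ * _).
  apply: eq_tint_ae.
  - exact: L1_measurable (ft_integrand k t f1).
  - exact: L1_measurable (ft_integrand k t (L1_norm f1)).
  by apply: filterS f0 => X fX; rewrite ger0_norm.
have [hsup hhol] := hC _ _ sol.
exists (cont_rep O (fun X => `|f X|)); split=> //.
  apply: continuous_in_subspaceT => X; rewrite inE => OX.
  exact: (@cont_rep_continuous _ _ _ hO _ hsigma _ _ sol _ OX).
apply: filterS2 f0 (@cont_rep_ae _ _ _ hO _ hsigma _ _ sol) => X fX gX OX.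
by rewrite -gX// ger0_norm.
Qed.
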